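(* Let $\mathbb{G}$ be a finite quantum group with Haar state $h$ and antipode $S$, and let $\varphi$ be a state on $C(\mathbb{G})$. Put $\psi=(\varphi\circ S)\star\varphi$. The following assertions are equivalent: (1) there exists $1\leq p<2$ such that $\|\varphi\star x\|_{2}\leq\|x\|_{p}$ for all $x\in C(\mathbb{G})$; (2) there exists $1\leq p<2$ such that $\|x\star\varphi\|_{2}\leq\|x\|_{p}$ for all $x\in C(\mathbb{G})$; (3) $\|\hat{\varphi}(\alpha)\|<1$ for all $\alpha\in\mathrm{Irr}(\mathbb{G})\setminus\{1\}$; (4) $\lim_{n\to\infty}\frac{1}{n}\sum_{k=1}^{n}\psi^{\star k}=h$; (5) for any nonzero $x\in C(\mathbb{G})_{+}$ there exists $n\geq1$ such that $\psi^{\star n}(x)>0$.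
   Context: A compact quantum group $\mathbb{G}=(A,\Delta)$ is a unital C*-algebra $A=C(\mathbb{G})$ with a unital $*$-homomorphism $\Delta:A\to A\otimes A$ (minimal tensor product) such that $(\Delta\otimes\iota)\Delta=(\iota\otimes\Delta)\Delta$ and the sets $\{\Delta(a)(1\otimes b):a,b\in A\}$ and $\{\Delta(a)(b\otimes1):a,b\in A\}$ are linearly dense in $A\otimes A$; here $\iota$ is the identity map. It is a finite quantum group if $A$ is finite dimensional. The Haar state $h$ is the unique state with $(h\otimes\iota)\Delta(x)=h(x)1=(\iota\otimes h)\Delta(x)$ for all $x$; for a finite quantum group $h$ is a faithful trace, and $\|x\|_p=h(|x|^p)^{1/p}$ for $1\le p<\infty$. $\mathrm{Irr}(\mathbb{G})$ is the set of equivalence classes of irreducible unitary (finite-dimensional) representations, with representatives $u^\alpha=[u^\alpha_{ij}]\in C(\mathbb{G})\otimes B(H_\alpha)$, $\Delta(u^\alpha_{ij})=\sum_k u^\alpha_{ik}\otimes u^\alpha_{kj}$; the class of the trivial representation is denoted $1$. The antipode $S$ is the linear antihomomorphism determined by $S(u^\alpha_{ij})=(u^\alpha_{ji})^*$. For a linear functional $\varphi$, its Fourier transform is $\hat\varphi(\alpha)=(\varphi\otimes\iota)((u^\alpha)^* )\in B(H_\alpha)$, and $\|\hat\varphi(\alpha)\|$ is the operator norm. Convolutions: for functionals $\varphi,\varphi'$ and $x\in C(\mathbb{G})$, $\varphi\star\varphi'=(\varphi\otimes\varphi')\circ\Delta$, $x\star\varphi=(\varphi\otimes\iota)\Delta(x)$,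 $\varphi\star x=(\iota\otimes\varphi)\Delta(x)$; $\psi^{\star k}$ is the $k$-fold convolution power. $C(\mathbb{G})_+$ is the set of positive elements. The limit in (4) is taken in the (finite-dimensional) dual of $C(\mathbb{G})$. *)

(* Defs.v *)
From HB Require Import structures.
From mathcomp Require Import all_boot all_order all_algebra all_field.
From mathcomp Require Import complex.
From mathcomp Require Import all_classical all_reals all_analysis.

Set Implicit Arguments.
Unset Strict Implicit.
Unset Printing Implicit Defensive.

Import Order.TTheory GRing.Theory Num.Theory.
Import numFieldNormedType.Exports.

Local Open Scope ring_scope.

(** * Algebraic tensor product of finite-dimensional spaces

    [tens U V] stores the coordinates of a tensor in the basis
    [e_i (x) f_j], where [e] and [f] are the bases [vbasis] of [U] and [V].
    For finite-dimensional C*-algebras this is also the underlying space of the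
    minimal tensor product. The ring structure that matrices carry is unrelated
    to the product of tensors, which is [tmul] below. *)
Section Tensor.
Variable K : fieldType.
Implicit Types U V W : vectType K.

Definition tens U V : Type := 'M[K]_(\dim {:U}, \dim {:V}).

Definition tpure U V (u : U) (v : V) : tens U V :=
  \matrix_(i, j) (coord (vbasis {:U}) i u * coord (vbasis {:V}) j v).

(** The linear map on [tens U V] induced by a bilinear map [b]. *)
Definition tlift U V (W : lmodType K) (b : U -> V -> W) (t : tens U V) : W :=
  \sum_i \sum_j t i j *: b (vbasis {:U})`_i (vbasis {:V})`_j.

Definition tmap U V (U' V' : vectType K) (f : U -> U') (g : V -> V') :
    tens U V -> tens U' V' :=
  tlift (fun u v => tpure (f u) (g v)).

Definition tassoc U V W : tens (tens U V) W -> tens U (tens V W) :=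
  tlift (fun p w => tlift (fun u v => tpure u (tpure v w)) p).

Lemma linear_coordE U (W : lmodType K) (f : U -> W) : linear f ->
  forall u, f u = \sum_i coord (vbasis {:U}) i u *: f (vbasis {:U})`_i.
Proof.
move=> linf u; pose bf := GRing.isLinear.Build _ _ _ _ f linf.
pose g : {linear U -> W} := HB.pack f bf.
rewrite -[f u]/(g u) {1}(coord_vbasis (memvf u)) linear_sum.
by apply: eq_bigr => i _; rewrite linearZ.
Qed.

(** The universal property of the tensor product. *)
Lemma tlift_tpure U V (W : lmodType K) (b : U -> V -> W) :
    (forall v, linear (b^~ v)) -> (forall u, linear (b u)) ->
  forall u v, tlift b (tpure u v) = b u v.
Proof.
move=> linl linr u v; rewrite (linear_coordE (linl v)) /tlift.
apply: eq_bigr => i _; rewrite (linear_coordE (linr _) v) scaler_sumr.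
by apply: eq_bigr => j _; rewrite scalerA mxE.
Qed.

Lemma tens_sum_pure U V (t : tens U V) :
  t = tlift (@tpure U V) t.
Proof.
apply/matrixP => i j; rewrite /tlift summxE (bigD1 i) //= summxE (bigD1 j) //=.
have cb (X : vectType K) (k l : 'I_(\dim {:X})) :
    coord (vbasis {:X}) k (vbasis {:X})`_l = (k == l)%:R.
  by rewrite coord_free ?(basis_free (vbasisP _)) // eq_sym.
rewrite !mxE !cb !eqxx !mulr1 !big1 ?addr0 // => k nk.
  by rewrite summxE big1 // => l _; rewrite !mxE !cb eq_sym (negPf nk) mul0r mulr0.
by rewrite !mxE !cb (eq_sym j) (negPf nk) !mulr0.
Qed.

End Tensor.

Definition tmul (K : fieldType) (A B : falgType K) (s t : tens A B) :
    tens A B :=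
  tlift (fun a b => tlift (fun c d => tpure (a * c) (b * d)) t) s.

(** * Finite-dimensional unital C*-algebras

    Completeness is automatic in finite dimension. *)
Record finCstarAlg (R : realType) := FinCstarAlg {
  cstar_sort :> falgType R[i];
  star : cstar_sort -> cstar_sort;
  cnorm : cstar_sort -> R;
  starD : forall x y, star (x + y) = star x + star y;
  starZ : forall (c : R[i]) x, star (c *: x) = c^* *: star x;
  starM : forall x y, star (x * y) = star y * star x;
  starK : involutive star;
  cnorm_eq0 : forall x, cnorm x = 0 -> x = 0;
  cnormD : forall x y, cnorm (x + y) <= cnorm x + cnorm y;
  cnormZ : forall (c : R[i]) x, cnorm (c *: x) = Normc.normc c * cnorm x;
  cnormM : forall x y, cnorm (x * y) <= cnorm x * cnorm y;
  cnorm_star : forall x, cnorm (star x * x) = cnorm x ^+ 2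
}.
Arguments star {R A} : rename.
Arguments cnorm {R A} : rename.

Section CstarAlgebra.
Variables (R : realType) (A : finCstarAlg R).
Local Notation C := R[i].

(** The involution of [tens A B] with [(a (x) b)^* = a^* (x) b^*]. *)
Definition tstar (B : finCstarAlg R) (t : tens A B) : tens A B :=
  tlift (fun a b => tpure (star a) (star b)) (map_mx Num.conj t : tens A B).

Definition cpos (x : A) : Prop := exists y : A, x = star y * y.

Definition is_state (phi : A -> C) : Prop :=
  [/\ scalar phi, forall x, cpos x -> 0 <= phi x & phi 1 = 1].

Definition spectrum (a : A) : set C :=
  [set l : C | a - l%:A \isn't a GRing.unit].

(** Functional calculus for self-adjoint [a]. The spectrum is finite, so
    [f(a)] is [P(a)] for any polynomial [P] that agrees with [f] on it. *)
Definition fcalc (f : C -> C) (a : A) : A :=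
  xget 0 [set b : A | exists2 P : {poly C},
    forall l, spectrum a l -> P.[l] = f l & b = horner_alg a P].

(** [a] to the real power [r], for [a] positive. *)
Definition cpow (a : A) (r : R) : A :=
  fcalc (fun l => (powR (complex.Re l) r)%:C%C) a.

Definition cabs (x : A) : A := cpow (star x * x) 2^-1.

(** [h(|x|^p)^(1/p)]; the value of [h] here is a nonnegative real. *)
Definition lpnorm (h : A -> C) (p : R) (x : A) : R :=
  powR (complex.Re (h (cpow (cabs x) p))) p^-1.

Definition dual_norm (phi : A -> C) : R :=
  sup [set Normc.normc (phi x) | x in [set x : A | cnorm x <= 1]].

End CstarAlgebra.

(** Operator norm on [B(C^n)] for the Euclidean norm of [C^n]. *)
Definition l2norm (R : realType) n (v : 'cV[R[i]]_n) : R :=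
  Num.sqrt (\sum_i Normc.normc (v i 0) ^+ 2).

Definition opnorm (R : realType) n (M : 'M[R[i]]_n) : R :=
  sup [set l2norm (M *m v) | v in [set v : 'cV[R[i]]_n | l2norm v <= 1]].

(** * Finite quantum groups

    Linear subspaces of a finite-dimensional space are closed, so linear density
    amounts to spanning. *)
Record finQuantumGroup (R : realType) := FinQuantumGroup {
  qg_alg :> finCstarAlg R;
  comul : {linear qg_alg -> tens qg_alg qg_alg};
  comul1 : comul 1 = tpure 1 1;
  comulM : forall x y, comul (x * y) = tmul (comul x) (comul y);
  comul_star : forall x, comul (star x) = tstar (comul x);
  comulA : forall x,
    tassoc (tmap comul idfun (comul x)) = tmap idfun comul (comul x);
  comul_densel : forall t : tens qg_alg qg_alg,
    exists s : seq (qg_alg * qg_alg),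
      t = \sum_(ab <- s) tmul (comul ab.1) (tpure 1 ab.2);
  comul_denser : forall t : tens qg_alg qg_alg,
    exists s : seq (qg_alg * qg_alg),
      t = \sum_(ab <- s) tmul (comul ab.1) (tpure ab.2 1)
}.
Arguments comul {R G} : rename.

Section QuantumGroup.
Variables (R : realType) (G : finQuantumGroup R).
Local Notation C := R[i].

(** [(phi (x) iota) Delta(x)] and [(iota (x) phi) Delta(x)]. *)
Definition slicel (phi : G -> C) (x : G) : G :=
  tlift (fun a b => phi a *: b) (comul x).
Definition slicer (phi : G -> C) (x : G) : G :=
  tlift (fun a b => phi b *: a) (comul x).

(** The three convolutions [phi * phi'], [x * phi] and [phi * x]. *)
Definition fconv (phi phi' : G -> C) (x : G) : C :=
  tlift (fun a b => phi a * phi' b : C^o) (comul x).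
Definition conv_elt_fun (x : G) (phi : G -> C) : G := slicel phi x.
Definition conv_fun_elt (phi : G -> C) (x : G) : G := slicer phi x.

(** [k]-fold convolution power, for [k >= 1] only. *)
Definition convpow (psi : G -> C) (k : nat) : G -> C :=
  iter k.-1 (fconv^~ psi) psi.

Definition is_haar (h : G -> C) : Prop :=
  is_state h /\
  forall x, slicel h x = (h x)%:A /\ slicer h x = (h x)%:A.

(** Matrices over [C(G)], i.e. elements of [C(G) (x) B(C^n)]. *)
Definition adjmx n (u : 'M[G]_n) : 'M[G]_n := \matrix_(i, j) star (u j i).

Definition scalmx m n (T : 'M[C]_(m, n)) : 'M[G]_(m, n) :=
  map_mx (in_alg G) T.

Definition unitary_rep n (u : 'M[G]_n) : Prop :=
  [/\ adjmx u *m u = 1%:M, u *m adjmx u = 1%:M &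
      forall i j, comul (u i j) = \sum_k tpure (u i k) (u k j)].

(** A subspace of [C^n] is given as the range of an idempotent [P]; it is
    invariant under [u] when [u P = P u P]. *)
Definition irreducible_rep n (u : 'M[G]_n) : Prop :=
  [/\ (0 < n)%N, unitary_rep u &
      forall P : 'M[C]_n, P *m P = P ->
        u *m scalmx P = scalmx P *m u *m scalmx P -> P = 0 \/ P = 1%:M].

Definition equiv_rep m n (u : 'M[G]_m) (v : 'M[G]_n) : Prop :=
  exists (T : 'M[C]_(n, m)) (T' : 'M[C]_(m, n)),
    [/\ T *m T' = 1%:M, T' *m T = 1%:M & scalmx T *m u = v *m scalmx T].

Definition trivial_rep : 'M[G]_1 := 1%:M.

(** The set of classes of irreducible unitary representations together with a
    choice of representatives. *)
Record irr_reps := IrrReps {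
  Irr :> Type;
  irr_one : Irr;
  irr_dim : Irr -> nat;
  irr_rep : forall a : Irr, 'M[G]_(irr_dim a);
  irr_irreducible : forall a, irreducible_rep (irr_rep a);
  irr_inj : forall a b, equiv_rep (irr_rep a) (irr_rep b) -> a = b;
  irr_complete : forall n (u : 'M[G]_n), irreducible_rep u ->
    exists a, equiv_rep u (irr_rep a);
  irr_oneE : equiv_rep (irr_rep irr_one) trivial_rep
}.

Definition is_antipode (I : irr_reps) (S : G -> G) : Prop :=
  [/\ linear S, forall x y, S (x * y) = S y * S x &
      forall (a : I) i j, S (irr_rep a i j) = star (irr_rep a j i)].

(** [phi (x) iota] applied to the adjoint of the representation [a]. *)
Definition fourier (I : irr_reps) (phi : G -> C) (a : I) :
    'M[C]_(irr_dim a) :=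
  map_mx phi (adjmx (irr_rep a)).

Lemma star1 : star (1 : G) = 1.
Proof. by rewrite -[LHS]mulr1 -[X in _ * X]starK -starM mulr1 starK. Qed.

Lemma scalmxM m n p (S : 'M[C]_(m, n)) (T : 'M[C]_(n, p)) :
  scalmx (S *m T) = scalmx S *m scalmx T.
Proof. by rewrite /scalmx map_mxM. Qed.

Lemma equiv_rep_refl n (u : 'M[G]_n) : equiv_rep u u.
Proof.
by exists 1%:M, 1%:M; rewrite !mulmx1 /scalmx map_mx1 mul1mx mulmx1.
Qed.

Lemma equiv_rep_sym m n (u : 'M[G]_m) (v : 'M[G]_n) :
  equiv_rep u v -> equiv_rep v u.
Proof.
case=> T [T' [TT' T'T Tu]]; exists T', T; split=> //.
have e : scalmx T' *m scalmx T = 1%:M by rewrite -scalmxM T'T /scalmx map_mx1.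
have e' : scalmx T *m scalmx T' = 1%:M by rewrite -scalmxM TT' /scalmx map_mx1.
by rewrite -[LHS]mulmx1 -e' !mulmxA -(mulmxA _ v) -Tu mulmxA e mul1mx.
Qed.

Lemma equiv_rep_trans m n p (u : 'M[G]_m) (v : 'M[G]_n) (w : 'M[G]_p) :
  equiv_rep u v -> equiv_rep v w -> equiv_rep u w.
Proof.
case=> S [S' [SS' S'S Su]] [T [T' [TT' T'T Tv]]].
exists (T *m S), (S' *m T'); split.
- by rewrite mulmxA -(mulmxA T) SS' mulmx1.
- by rewrite mulmxA -(mulmxA S') T'T mulmx1.
- by rewrite !scalmxM -mulmxA Su mulmxA Tv mulmxA.
Qed.

Lemma trivial_rep_irreducible : irreducible_rep trivial_rep.
Proof.
have adj1 : adjmx trivial_rep = 1%:M.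
  by apply/matrixP => i j; rewrite !mxE !ord1 eqxx star1.
split=> //.
- split; rewrite ?adj1 ?mulmx1 // => i j.
  by rewrite !ord1 big_ord1 !mxE eqxx comul1.
- move=> P PP _; have /matrixP/(_ 0 0) := PP.
  rewrite mxE big_ord1 => e.
  have /eqP : P 0 0 * (P 0 0 - 1) = 0 by rewrite mulrBr mulr1 e subrr.
  rewrite mulf_eq0 subr_eq0 => /orP[] /eqP e0; [left|right];
    by apply/matrixP => i j; rewrite !ord1 e0 !mxE ?eqxx.
Qed.

Lemma irr_reps_inhabited : inhabited irr_reps.
Proof.
pose M (n : nat) : Type := 'M[G]_n; pose T := {n & M n}.
pose mkT n (u : 'M[G]_n) : T := existT M n u.
pose irr (a : T) := irreducible_rep (projT2 a).
pose cls (a b : T) := irr b /\ equiv_rep (projT2 a) (projT2 b).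
pose pick (P : T -> Prop) : T :=
  if pselect (exists x, P x) is left H then projT1 (cid H)
  else mkT 0%N 0.
have pickP a : irr a -> cls a (pick (cls a)).
  move=> ia; rewrite /pick; case: pselect => [H|]; first exact: (projT2 (cid H)).
  by case; exists a; split=> //; exact: equiv_rep_refl.
have cls_eq a b : equiv_rep (projT2 a) (projT2 b) -> cls a = cls b.
  move=> ab; apply/funext => c; apply/propext; split=> -[ic h]; split=> //.
    exact: equiv_rep_trans (equiv_rep_sym ab) h.
  exact: equiv_rep_trans ab h.
pose J := {a : T | irr a /\ pick (cls a) = a}.
have mk a : irr a -> irr (pick (cls a)) /\
    pick (cls (pick (cls a))) = pick (cls a).
  move=> ia; have [ip ep] := pickP _ ia; split=> //.
  by rewrite -(cls_eq _ _ ep).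
pose j a ia : J := exist (fun a : T => irr a /\ pick (cls a) = a) _ (mk a ia).
pose one : T := mkT 1%N trivial_rep.
have i1 : irr one by exact: trivial_rep_irreducible.
apply: inhabits; refine (@IrrReps J (j _ i1)
  (fun a => projT1 (proj1_sig a)) (fun a => projT2 (proj1_sig a)) _ _ _ _).
- by case=> a [].
- move=> [a [ia ea]] [b [ib eb]] /= ab.
  have eab : a = b by rewrite -ea -eb (cls_eq _ _ ab).
  by subst b; congr exist; exact: Prop_irrelevance.
- move=> n u iu; exists (j (mkT n u) iu) => /=.
  by have [_] := pickP (mkT n u) iu.
- by have [_ /equiv_rep_sym] := pickP _ i1.
Qed.

End QuantumGroup.

(* Main.v *)
(** The trace [tau] of the left regular representation is a faithful positive
    trace, by the C*-identity. Multiplication by [Delta x] is conjugate to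
    multiplication by [x (x) 1], so [tau] is, up to normalisation, an idempotent
    for convolution; a faithful idempotent state is the Haar state, hence the
    Haar state is tracial. Consequently the regular corepresentation and its
    entrywise adjoint are both unitary, and splitting unitary representations
    into irreducible ones shows that [S] inverts them, is involutive and
    commutes with the involution.

    In an orthonormal basis of [L^2(h)], convolution by [phi] has matrix
    [F = phi(u)], [u] being the regular representation, and convolution by [psi]
    has matrix [F^* F]. Each of the five assertions is equivalent to ergodicity:
    the only [x] with [h x = 0] and [psi * x = x] is [0].
    - For (1) and (2), ergodicity is the strict contractivity of [F] on [ker h],
      hence a spectral gap. For [s >= 0] and [0 < q < 1],
      [s - (1 - q) (s^2 - s) <= s^q <= 1 + q (s - 1)]; the lower bound, applied
      to the eigenvalues of [x^* x], turns the gap into an [L^p]-[L^2] bound with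
      [p = 2 q], and the equality case of the upper bound, applied to [1 + c x]
      with [c^4 = 1], gives the converse.
    - For (3), [psi] acts in an irreducible [u] by [F^* F] with [F = phi(u)], and
      an induction on unitary representations reaches the regular one.
    - For (4), Cesaro means telescope since [1 - psi] is invertible on [ker h].
    - For (5), a fixed vector [w] of the regular representation [u] satisfies
      [sum_k psi^n (y_k^* y_k) = 0] for all [n], where [y = u w - w], so [u w = w]. *)

Require Import Defs.
From HB Require Import structures.
From mathcomp Require Import all_boot all_order all_algebra all_field.
From mathcomp Require Import complex.
From mathcomp Require Import all_classical all_reals all_analysis.
From mathcomp Require Import ring lra.
Import Order.TTheory GRing.Theory Num.Theory.
Import numFieldNormedType.Exports.
Local Open Scope classical_set_scope.
Local Open Scope ring_scope.

Set Implicit Arguments.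
Unset Strict Implicit.
Unset Printing Implicit Defensive.

(** * Linear algebra and tensor products *)

Section LinearMaps.
Variables (K : fieldType) (V : lmodType K).

Section LinearFor.
Variables (W : lmodType K) (f : V -> W).
Hypothesis lf : linear f.
Let g : {linear V -> W} := HB.pack f (GRing.isLinear.Build _ _ _ _ f lf).

(** Slices, states and the antipode are bare functions with a linearity hypothesis, so the rules for
    bundled linear maps are transported to them. *)
Lemma linD x y : f (x + y) = f x + f y. Proof. exact: (linearD g). Qed.
Lemma linB x y : f (x - y) = f x - f y. Proof. exact: (linearB g). Qed.
Lemma linZ a x : f (a *: x) = a *: f x. Proof. exact: (linearZ_LR g). Qed.
Lemma lin0 : f 0 = 0. Proof. exact: (linear0 g). Qed.
Lemma lin_sum I (r : seq I) (P : pred I) F :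
  f (\sum_(i <- r | P i) F i) = \sum_(i <- r | P i) f (F i).
Proof. exact: (linear_sum g). Qed.

End LinearFor.

Section ScalarMaps.
Variable f : V -> K.
Hypothesis lf : scalar f.
Let g : {scalar V} := HB.pack f (GRing.isLinear.Build _ _ _ _ f lf).

Lemma scalD x y : f (x + y) = f x + f y. Proof. exact: (linearD g). Qed.
Lemma scalB x y : f (x - y) = f x - f y. Proof. exact: (linearB g). Qed.
Lemma scalZ a x : f (a *: x) = a * f x. Proof. exact: (linearZ_LR g). Qed.
Lemma scal0 : f 0 = 0. Proof. exact: (linear0 g). Qed.
Lemma scal_sum I (r : seq I) (P : pred I) F :
  f (\sum_(i <- r | P i) F i) = \sum_(i <- r | P i) f (F i).
Proof. exact: (linear_sum g). Qed.

End ScalarMaps.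
End LinearMaps.

Lemma scalar_coord (K : fieldType) (V : vectType K) n (b : n.-tuple V) i :
  scalar (coord b i).
Proof. by move=> a u w; rewrite linearP. Qed.

Section Frame.
Variables (K : fieldType) (V : vectType K) (J : finType).

(** A spanning family with dual functionals. The index is any finite type, so that pairs can index a
    basis of a tensor product. *)
Definition frame (b : J -> V) (c : J -> V -> K) : Prop :=
  (forall j, scalar (c j)) /\ forall x, x = \sum_j c j x *: b j.

End Frame.

Lemma frame_vbasis (K : fieldType) (V : vectType K) :
  frame (fun i : 'I_(\dim {:V}) => (vbasis {:V})`_i) (coord (vbasis {:V})).
Proof.
split=> [i|x]; first exact: scalar_coord.
by rewrite {1}(coord_vbasis (memvf x)).
Qed.

(** Cyclicity of the trace: expanding each inner vector in the other frame produces the same double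
    sum on both sides. *)
Lemma frame_trace (K : fieldType) (V W : vectType K) (J L : finType)
    (b : J -> V) c (b' : L -> W) c' (f : V -> W) (g : W -> V) :
    frame b c -> frame b' c' -> linear f -> linear g ->
  \sum_j c j (g (f (b j))) = \sum_l c' l (f (g (b' l))).
Proof.
move=> [sc bc] [sc' bc'] lf lg.
under eq_bigr => j _ do
  rewrite (bc' (f (b j))) (lin_sum lg) (scal_sum (sc j)).
under [RHS]eq_bigr => l _ do
  rewrite (bc (g (b' l))) (lin_sum lf) (scal_sum (sc' l)).
rewrite exchange_big; apply: eq_bigr => l _; apply: eq_bigr => j _.
by rewrite (linZ lg) (linZ lf) (scalZ (sc j)) (scalZ (sc' l)) mulrC.
Qed.

Lemma inj_linear_surj (K : fieldType) (V : vectType K) (f : V -> V) :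
  linear f -> (forall x, f x = 0 -> x = 0) -> forall y, exists x, f x = y.
Proof.
move=> lf f0 y; pose g : {linear V -> V} :=
  HB.pack f (GRing.isLinear.Build _ _ _ _ f lf).
have gE x : linfun g x = f x by rewrite lfunE.
have k0 : lker (linfun g) == 0%VS.
  apply/lker0P => x x'; rewrite !gE => e; apply/eqP; rewrite -subr_eq0.
  by apply/eqP/f0; rewrite (linB lf) e subrr.
by exists ((linfun g)^-1%VF y); rewrite -gE lker0_lfunVK.
Qed.

Lemma surj_linear_inv (K : fieldType) (V : vectType K) (f : V -> V) :
  linear f -> (forall y, exists x, f x = y) ->
  exists g : V -> V, [/\ linear g, cancel f g & cancel g f].
Proof.
move=> lf sf; pose F : {linear V -> V} :=
  HB.pack f (GRing.isLinear.Build _ _ _ _ f lf).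
have FE x : linfun F x = f x by rewrite lfunE.
have k0 : lker (linfun F) == 0%VS.
  have im : limg (linfun F) = fullv.
    by apply/vspaceP => y; rewrite memvf; have [x <-] := sf y;
      rewrite -FE memv_img ?memvf.
  have := limg_ker_dim (linfun F) fullv; rewrite im capfv => /eqP.
  by rewrite -[X in _ == X]add0n eqn_add2r dimv_eq0.
exists ((linfun F)^-1%VF); split=> [|x|x]; first exact: linearP.
  by rewrite -FE lker0_lfunK.
by rewrite -FE lker0_lfunVK.
Qed.

(** * Bilinear maps and slices of tensors *)

Section TensorTheory.
Variable K : fieldType.
Implicit Types U V W : vectType K.

Definition bilin U V (W : lmodType K) (b : U -> V -> W) :=
  (forall v, linear (b^~ v)) /\ (forall u, linear (b u)).

Lemma tlift_linear U V (W : lmodType K) (b : U -> V -> W) : linear (tlift b).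
Proof.
move=> a s t; rewrite /tlift scaler_sumr -big_split; apply: eq_bigr => i _.
rewrite scaler_sumr -big_split; apply: eq_bigr => j _ /=.
by rewrite !mxE scalerDl scalerA.
Qed.

Lemma tlift_sum U V (W : lmodType K) (b : U -> V -> W) I (r : seq I)
    (P : pred I) (x : I -> U) (y : I -> V) : bilin b ->
  tlift b (\sum_(i <- r | P i) tpure (x i) (y i) : tens U V) =
    \sum_(i <- r | P i) b (x i) (y i).
Proof.
move=> [bl br]; rewrite (lin_sum (@tlift_linear _ _ _ b)).
by apply: eq_bigr => i _; rewrite tlift_tpure.
Qed.

Lemma bilin_tpure U V : bilin (@tpure K U V).
Proof.
by split=> [v|u] a x y; apply/matrixP => i j;
  rewrite !mxE scalar_coord; [rewrite mulrDl -mulrA | rewrite mulrDr mulrCA].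
Qed.

Lemma tpure_linr U V u k (v w : V) :
  tpure u (k *: v + w) = k *: tpure u v + tpure u w :> tens U V.
Proof. exact: (bilin_tpure U V).2. Qed.

Lemma tpure_suml U V I (r : seq I) (P : pred I) (x : I -> U) (v : V) :
  tpure (\sum_(i <- r | P i) x i) v = \sum_(i <- r | P i) tpure (x i) v.
Proof. exact: (lin_sum ((bilin_tpure U V).1 v)). Qed.

Lemma tpure_sumr U V I (r : seq I) (P : pred I) (x : I -> V) (u : U) :
  tpure u (\sum_(i <- r | P i) x i) = \sum_(i <- r | P i) tpure u (x i).
Proof. exact: (lin_sum ((bilin_tpure U V).2 u)). Qed.

Lemma tpureZl U V a (u : U) (v : V) : tpure (a *: u) v = a *: tpure u v.
Proof. exact: (linZ ((bilin_tpure U V).1 v)). Qed.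

Lemma tpureZr U V a (u : U) (v : V) : tpure u (a *: v) = a *: tpure u v.
Proof. exact: (linZ ((bilin_tpure U V).2 u)). Qed.

Lemma bilin_slicel U V (f : U -> K) : scalar f ->
  bilin (fun (a : U) (b : V) => f a *: b).
Proof.
move=> lf; split=> [v|u] a x y; first by rewrite lf scalerDl scalerA.
by rewrite scalerDr !scalerA mulrC.
Qed.

Lemma bilin_slicer U V (f : V -> K) : scalar f ->
  bilin (fun (a : U) (b : V) => f b *: a).
Proof.
move=> lf; split=> [v|u] a x y; last by rewrite lf scalerDl scalerA.
by rewrite scalerDr !scalerA mulrC.
Qed.

Lemma bilin_mul U V (f : U -> K) (g : V -> K) : scalar f -> scalar g ->
  bilin (fun a b => f a * g b : K^o).
Proof.
move=> lf lg; split=> [v|u] a x y.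
  by rewrite lf mulrDl -mulrA.
by rewrite lg mulrDr mulrCA.
Qed.

(** The right legs are the slices of [t] by the coordinate functionals; this is how coefficients of
    a comultiplication are read off. *)
Lemma tens_frame U V (J : finType) (b : J -> U) c (t : tens U V) :
  frame b c ->
  t = \sum_j tpure (b j) (tlift (fun x y => c j x *: y) t).
Proof.
move=> [sc bc]; rewrite {1}(tens_sum_pure t) /tlift.
under eq_bigr => i _ do under eq_bigr => j _ do
  rewrite [X in tpure X _]bc tpure_suml scaler_sumr.
under [RHS]eq_bigr => j _ do rewrite tpure_sumr.
rewrite [RHS]exchange_big; apply: eq_bigr => i _ /=.
under [RHS]eq_bigr => j _ do rewrite tpure_sumr.
rewrite exchange_big; apply: eq_bigr => j _; apply: eq_bigr => k _ /=.
by rewrite tpureZl !tpureZr.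
Qed.

Lemma tens_pure_sum U V (t : tens U V) :
  exists y : 'I_(\dim {:U}) -> V,
    t = \sum_(i < \dim {:U}) tpure (vbasis {:U})`_i (y i).
Proof. by eexists; rewrite {1}(tens_frame t (frame_vbasis U)). Qed.

Lemma frame_tens U V : @frame K (tens U V) _
  (fun p : 'I_(\dim {:U}) * 'I_(\dim {:V}) =>
     tpure (vbasis {:U})`_p.1 (vbasis {:V})`_p.2)
  (fun p t => t p.1 p.2).
Proof.
split=> [p a s t|t]; first by rewrite !mxE.
by rewrite {1}(tens_sum_pure t) /tlift pair_big.
Qed.

End TensorTheory.

Section TensorAlgebra.
Variables (K : fieldType) (A B : falgType K).

Lemma tmul_suml I (r : seq I) (P : pred I) (a : I -> A) (b : I -> B) t :
  tmul (\sum_(i <- r | P i) tpure (a i) (b i)) t =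
  \sum_(i <- r | P i) tlift (fun c d => tpure (a i * c) (b i * d)) t.
Proof.
rewrite /tmul tlift_sum //.
split=> [y|x] k u v; rewrite /tlift scaler_sumr -big_split /=;
    apply: eq_bigr => i _; rewrite scaler_sumr -big_split /=;
    apply: eq_bigr => j _; rewrite mulrDl -scalerAl.
  by rewrite ((bilin_tpure A B).1 _ k) scalerDr !scalerA mulrC.
by rewrite ((bilin_tpure A B).2 _ k) scalerDr !scalerA mulrC.
Qed.

Lemma tmul_sum I J (r : seq I) (s : seq J) (P : pred I) (Q : pred J)
    (a : I -> A) (b : I -> B) (c : J -> A) (d : J -> B) :
  tmul (\sum_(i <- r | P i) tpure (a i) (b i))
       (\sum_(j <- s | Q j) tpure (c j) (d j)) =
  \sum_(i <- r | P i) \sum_(j <- s | Q j) tpure (a i * c j) (b i * d j).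
Proof.
rewrite tmul_suml; apply: eq_bigr => i _; rewrite tlift_sum //.
split=> [w|z] k u v; rewrite mulrDr -scalerAr.
  exact: (bilin_tpure A B).1.
exact: (bilin_tpure A B).2.
Qed.

Lemma tmul_pure (a c : A) (b d : B) :
  tmul (tpure a b) (tpure c d) = tpure (a * c) (b * d).
Proof.
have := @tmul_sum _ _ [:: tt] [:: tt] predT predT (fun=> a) (fun=> b) (fun=> c)
  (fun=> d).
by rewrite !big_seq1.
Qed.

Lemma tmul_lin (s : tens A B) : linear (tmul s).
Proof.
have [y ->] := tens_pure_sum s => k t t'.
rewrite !tmul_suml scaler_sumr -big_split; apply: eq_bigr => i _ /=.
exact: tlift_linear.
Qed.

Lemma tmulA (s t w : tens A B) : tmul s (tmul t w) = tmul (tmul s t) w.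
Proof.
have [x ->] := tens_pure_sum s; have [y ->] := tens_pure_sum t.
have [z ->] := tens_pure_sum w.
rewrite !tmul_sum !pair_big /= !tmul_sum !pair_big /=.
rewrite (reindex (fun p : _ * _ * _ => (p.1.1, (p.1.2, p.2)))) /=.
  by apply: eq_bigr => p _; rewrite !mulrA.
by exists (fun p => ((p.1, p.2.1), p.2.2)) => [[[? ?] ?]|[? [? ?]]].
Qed.

End TensorAlgebra.

(** * Matrices over an algebraically closed number field *)

Section ClosedFieldMatrices.
Variable C : numClosedFieldType.
Local Open Scope sesquilinear_scope.

Lemma ctmxM m n p (X : 'M[C]_(m, n)) (Y : 'M[C]_(n, p)) :
  (X *m Y)^t* = Y^t* *m X^t*.
Proof. by rewrite trmx_mul map_mxM. Qed.

(** Schur's theorem makes [M] unitarily similar to a triangular [U] whose diagonal entries are the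
    eigenvalues, so the trace of the square is a sum of squares of reals. *)
Lemma mxtrace_sqr_real_eigen n (M : 'M[C]_n) :
    (forall a, eigenvalue M a -> a \is Num.real) ->
  0 <= \tr (M *m M) /\ (\tr (M *m M) = 0 -> forall a, eigenvalue M a -> a = 0).
Proof.
case: n M => [|n] M rM.
  split; first by rewrite /mxtrace big_ord0.
  by move=> _ a /eigenvalueP[v _]; rewrite thinmx0 eqxx.
have [P uP] := @Schur C n.+1 M isT.
rewrite /similar_to conjymx //; set U := P *m M *m P^t*.
move=> tU; have PP : P^t* *m P = 1%:M.
  by rewrite -invmx_unitary // mulVmx ?unitarymx_unit.
have PP' : P *m P^t* = 1%:M by apply/unitarymxP.
have charU : char_poly U = char_poly M.
  rewrite /char_poly /char_poly_mx /U.
  have -> : 'X%:M - map_mx polyC (P *m M *m P^t*) =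
      map_mx polyC P *m ('X%:M - map_mx polyC M) *m map_mx polyC (P^t*).
    rewrite mulmxBr mulmxBl !map_mxM scalar_mxC -[in X in _ = X - _]mulmxA.
    by rewrite -(map_mxM _ P (P^t*)) PP' map_mx1 mulmx1.
  by rewrite !det_mulmx mulrAC -det_mulmx -map_mxM PP' map_mx1 det1 mul1r.
have eU a : eigenvalue M a = [exists i, U i i == a].
  rewrite eigenvalue_root_char -charU char_poly_trig //.
  rewrite -(big_map (fun i => U i i) predT (fun c => 'X - c%:P)).
  rewrite root_prod_XsubC; apply/mapP/existsP => [[i _ ->]|[i /eqP <-]].
    by exists i.
  by exists i; rewrite ?mem_index_enum.
have -> : \tr (M *m M) = \sum_i U i i ^+ 2.
  transitivity (\tr (U *m U)).
    rewrite /U -!mulmxA (mulmxA (P^t*) P) PP mul1mx.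
    by rewrite [RHS]mxtrace_mulC -!mulmxA PP mulmx1.
  apply: eq_bigr => i _; rewrite mxE (bigD1 i) //= big1 ?addr0 // => j nj.
  have [ij|ji] : (i < j)%N \/ (j < i)%N.
    by apply/orP; rewrite -neq_ltn eq_sym.
  - by rewrite (is_trig_mxP tU i j ij) mul0r.
  - by rewrite (is_trig_mxP tU j i ji) mulr0.
have Ur i : U i i \is Num.real by apply: rM; rewrite eU; apply/existsP; exists i.
have U0 i : 0 <= U i i ^+ 2 by rewrite -realEsqr.
split; first exact: sumr_ge0.
move=> /eqP; rewrite psumr_eq0 // => /allP z a; rewrite eU => /existsP[i /eqP <-].
by have := z i (mem_index_enum _); rewrite /= sqrf_eq0 => /eqP.
Qed.

(** The characteristic polynomial splits with all roots zero, hence is a power of the indeterminate,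
    and Cayley-Hamilton concludes. *)
Lemma nilpotent_eigen n (M : 'M[C]_n) :
    (forall a, eigenvalue M a -> a = 0) ->
  exists k, iter k (mulmx M) 1%:M = 0.
Proof.
case: n M => [|n] M eM; first by exists 0%N; rewrite thinmx0.
have itE k : iter k (mulmx M) 1%:M = M ^+ k.
  by elim: k => [|k IH] /=; rewrite ?expr0 // IH exprS.
have [r charM] := closed_field_poly_normal (char_poly M).
have r0 a : a \in r -> a = 0.
  move=> ar; apply: eM; rewrite eigenvalue_root_char charM.
  rewrite (monicP (char_poly_monic M)) scale1r root_prod_XsubC //.
exists (size r); rewrite itE.
have := Cayley_Hamilton M; rewrite charM (monicP (char_poly_monic M)) scale1r.
rewrite (eq_big_seq (fun=> 'X)) => [|a /r0 ->]; last by rewrite subr0.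
by rewrite big_const_seq count_predT -Monoid.iteropE rmorphXn /= horner_mx_X.
Qed.

Definition hdot n (x y : 'cV[C]_n) : C := (x^t* *m y) 0 0.

Lemma hdotE n (x y : 'cV[C]_n) : hdot x y = \sum_i (x i 0)^* * y i 0.
Proof. by rewrite /hdot mxE; apply: eq_bigr => i _; rewrite !mxE. Qed.

Lemma hdotDr n (x y z : 'cV[C]_n) : hdot x (y + z) = hdot x y + hdot x z.
Proof. by rewrite /hdot mulmxDr mxE. Qed.

Lemma hdotBr n (x y z : 'cV[C]_n) : hdot x (y - z) = hdot x y - hdot x z.
Proof. by rewrite /hdot mulmxBr !mxE. Qed.

Lemma hdotC n (x y : 'cV[C]_n) : hdot y x = (hdot x y)^*.
Proof.
rewrite !hdotE rmorph_sum; apply: eq_bigr => i _.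
by rewrite rmorphM /= conjCK mulrC.
Qed.

Lemma hdotBl n (x y z : 'cV[C]_n) : hdot (x - y) z = hdot x z - hdot y z.
Proof. by rewrite hdotC hdotBr rmorphB /= -!hdotC. Qed.

Lemma hdot_mulmxr n m (M : 'M[C]_(m, n)) x y :
  hdot x (M *m y) = hdot (M^t* *m x) y.
Proof. by rewrite /hdot ctmxM trmxCK mulmxA. Qed.

Lemma hdot_ge0 n (x : 'cV[C]_n) : 0 <= hdot x x.
Proof.
by rewrite hdotE sumr_ge0 // => i _; rewrite mulrC -normCK exprn_ge0.
Qed.

Lemma hdot_eq0 n (x : 'cV[C]_n) : hdot x x = 0 -> x = 0.
Proof.
rewrite hdotE => /eqP; rewrite psumr_eq0 => [/allP z|i _]; last first.
  by rewrite mulrC -normCK exprn_ge0.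
apply/matrixP => i j; rewrite ord1 mxE.
have := z i (mem_index_enum _).
by rewrite /= mulrC -normCK sqrf_eq0 normr_eq0 => /eqP.
Qed.

(** The spectral theorem writes [M] as [P^* D P] with [D >= 0], and [B] is the square root of [D]
    times [P]. *)
Lemma psd_gram n (M : 'M[C]_n) :
  M^t* = M -> (forall x, 0 <= hdot x (M *m x)) ->
  exists B : 'M[C]_n, M = B^t* *m B.
Proof.
move=> hM pM; have nM : M \is normalmx by apply/normalmxP; rewrite hM.
have /orthomx_spectralP := nM.
set P := spectralmx M; set d := spectral_diag M => eM.
have uP : P \is unitarymx by exact: spectral_unitarymx.
clearbody P d.
have PP' : P *m P^t* = 1%:M by apply/unitarymxP.
have d0 i : 0 <= d 0 i.
  have : hdot (delta_mx i 0 : 'cV_n) (diag_mx d *m delta_mx i 0) = d 0 i.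
    rewrite hdotE (bigD1 i) //= big1 => [|k nk]; last first.
      by rewrite !mxE (negPf nk) rmorph0 mul0r.
    by rewrite mul_diag_mx !mxE !eqxx rmorph1 mul1r mulr1 addr0.
  have := pM (P^t* *m delta_mx i 0).
  rewrite /hdot ctmxM trmxCK {1}eM (invmx_unitary uP) -!mulmxA.
  rewrite (mulmxA P (P^t*)) PP' mul1mx (mulmxA P (P^t*)) PP' mul1mx.
  by move=> + <-.
exists (diag_mx (map_mx sqrtC d) *m P).
rewrite ctmxM tr_diag_mx map_diag_mx -mulmxA (mulmxA (diag_mx _) (diag_mx _)).
rewrite mulmx_diag {1}eM (invmx_unitary uP) -mulmxA; congr (_ *m (diag_mx _ *m _)).
apply/rowP => i.
transitivity ((sqrtC (d 0 i))^* * sqrtC (d 0 i)); last by rewrite !mxE.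
by rewrite geC0_conj ?sqrtC_ge0 // -expr2 sqrtCK.
Qed.

Lemma mulmx_bounded m n (M : 'M[C]_(m, n)) :
  exists2 K, 0 <= K & forall x, hdot (M *m x) (M *m x) <= K * hdot x x.
Proof.
(* Each entry of [x] is at most the norm of [x], so the [i]-th entry of [M *m x] is at most the
   [i]-th absolute row sum times that norm. *)
exists (\sum_i (\sum_j `|M i j|) ^+ 2).
  by apply: sumr_ge0 => i _; rewrite exprn_ge0 // sumr_ge0.
move=> x; rewrite [leLHS]hdotE mulr_suml ler_sum // => i _.
rewrite mulrC -normCK -[hdot x x]sqrtCK -exprMn.
have l0 : 0 <= sqrtC (hdot x x) by rewrite sqrtC_ge0 hdot_ge0.
rewrite ler_pXn2r ?nnegrE ?mulr_ge0 ?sumr_ge0 // mxE.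
apply: le_trans (ler_norm_sum _ _ _) _; rewrite mulr_suml ler_sum // => j _.
rewrite normrM ler_wpM2l // -(@ler_pXn2r _ 2) ?nnegrE // sqrtCK hdotE.
rewrite (bigD1 j) //= [_^* * _]mulrC -normCK lerDl sumr_ge0 // => k _.
by rewrite mulrC -normCK exprn_ge0.
Qed.

Lemma pd_gram n (M : 'M[C]_n) :
    M^t* = M -> (forall x, x != 0 -> 0 < hdot x (M *m x)) ->
  exists2 B : 'M[C]_n, B \in unitmx & M = B^t* *m B.
Proof.
move=> hM pM; have [|B eM] := @psd_gram n M hM.
  move=> x; have [->|/pM/ltW //] := eqVneq x 0.
  by rewrite mulmx0 hdotE big1 // => i _; rewrite !mxE mulr0.
exists B => //; rewrite -unitmx_tr -row_free_unit -kermx_eq0.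
apply/eqP/row_matrixP => i; rewrite row0.
apply/trmx_inj; rewrite trmx0; apply/eqP; apply: contraT => nz.
have := pM _ nz; rewrite eM -mulmxA hdot_mulmxr trmxCK.
have -> : B *m (row i (kermx B^T))^T = 0.
  by apply/trmx_inj; rewrite trmx_mul trmxK trmx0 -row_mul mulmx_ker row0.
by rewrite hdotE big1 ?ltxx // => k _; rewrite !mxE mulr0.
Qed.

(** Strict positivity becomes uniform without a compactness argument: with [M = B^* B], the bound on
    the inverse of [B] gives the constant. *)
Lemma pd_coercive n (M : 'M[C]_n) :
    M^t* = M -> (forall x, x != 0 -> 0 < hdot x (M *m x)) ->
  exists2 d, 0 < d & forall x, d * hdot x x <= hdot x (M *m x).
Proof.
move=> hM pM; have [B uB eM] := pd_gram hM pM.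
have [K K0 KE] := mulmx_bounded (invmx B).
(* Only [0 <= K] is known, hence the added 1. *)
exists (K + 1)^-1; first by rewrite invr_gt0 ltr_wpDl.
move=> x; rewrite eM -mulmxA hdot_mulmxr trmxCK ler_pdivrMl ?ltr_wpDl //.
have := KE (B *m x); rewrite mulKmx // => /le_trans; apply.
by rewrite ler_wpM2r ?hdot_ge0 // lerDl.
Qed.

End ClosedFieldMatrices.

(** * The trace of the left regular representation *)

Section CstarTheory.
Variables (R : realType) (A : finCstarAlg R).
Local Notation C := R[i].
Local Notation N := (\dim {:A}).
Implicit Types (x y r : A) (f : A -> C).

Lemma star0 : star (0 : A) = 0.
Proof. by rewrite -[X in star X](scale0r 0) starZ rmorph0 scale0r. Qed.

Lemma starN x : star (- x) = - star x.
Proof. by rewrite -scaleN1r starZ rmorphN1 scaleN1r. Qed.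

Lemma starB x y : star (x - y) = star x - star y.
Proof. by rewrite starD starN. Qed.

Lemma starA1 : star (1 : A) = 1.
Proof. by rewrite -[LHS]mulr1 -[X in _ * X]starK -starM mulr1 starK. Qed.

Lemma star_sum I (r : seq I) (P : pred I) (F : I -> A) :
  star (\sum_(i <- r | P i) F i) = \sum_(i <- r | P i) star (F i).
Proof. by elim/big_rec2: _ => [|i y1 y2 _ <-]; rewrite ?star0 ?starD. Qed.

Lemma star_scalar (c : C) : star (c%:A : A) = (c^*)%:A.
Proof. by rewrite starZ starA1. Qed.

Lemma cnorm0 : cnorm (0 : A) = 0.
Proof. by rewrite -[X in cnorm X](scale0r 0) cnormZ Normc.normc0 mul0r. Qed.

Lemma cnorm_ge0 x : 0 <= cnorm x.
Proof.
have := cnormD x (- x).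
have normcN1 : Normc.normc (-1 : C) = 1 by rewrite normcN Normc.normc1.
by rewrite subrr cnorm0 -scaleN1r cnormZ normcN1 mul1r -mulr2n pmulrn_lge0.
Qed.

Lemma cnorm_gt0 x : x != 0 -> 0 < cnorm x.
Proof.
by move=> x0; rewrite lt_def cnorm_ge0 andbT; apply: contra_neq x0 => /cnorm_eq0.
Qed.

Lemma cnorm1 : cnorm (1 : A) = 1.
Proof.
have n1 : cnorm (1 : A) != 0 by rewrite gt_eqF // cnorm_gt0 // oner_eq0.
apply: (mulfI n1); rewrite mulr1 -expr2 -cnorm_star starA1 mulr1 //.
Qed.

(** For real [t], the C*-identity bounds the square of the norm of [r + i t] by
    [cnorm r ^+ 2 + t ^+ 2], while [l + i t] is an eigenvalue. An imaginary part [b] would then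
    satisfy [b ^+ 2 + 2 * b * t <= cnorm r ^+ 2] for every [t]. *)
Lemma sa_eigen_real r (l : C) y :
  star r = r -> y != 0 -> r * y = l *: y -> l \is Num.real.
Proof.
move=> sr y0; case: l => a b ry; rewrite complex_real.
apply: contraT => b0.
have key t : (b + t) ^+ 2 <= cnorm r ^+ 2 + t ^+ 2.
  have e : (r + (0 +i* t)%C%:A) * y = (a +i* (b + t))%C *: y.
    rewrite mulrDl ry -scalerAl mul1r -scalerDl; congr (_ *: _).
    by simpc.
  have : Normc.normc (a +i* (b + t))%C <= cnorm (r + (0 +i* t)%C%:A).
    by rewrite -(ler_pM2r (cnorm_gt0 y0)) -cnormZ -e cnormM.
  rewrite -(@ler_pXn2r _ 2) ?nnegrE ?cnorm_ge0 ?sqrtr_ge0 //.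
  rewrite -(cnorm_star (r + _)) starD sr star_scalar /=.
  rewrite sqr_sqrtr ?addr_ge0 ?sqr_ge0 // => le1.
  apply: le_trans (_ : a ^+ 2 + (b + t) ^+ 2 <= _).
    by rewrite lerDr sqr_ge0.
  apply: le_trans le1 _.
  have -> : (r + ((0 +i* t)%C^*)%:A) * (r + (0 +i* t)%C%:A) =
      r * r + (t ^+ 2)%:C%C%:A.
    rewrite mulrDl !mulrDr -!scalerAl -!scalerAr !mul1r !mulr1.
    rewrite scalerA addrA -[r * r + _ + _]addrA -scalerDl.
    have -> : (0 +i* t)%C + ((0 +i* t)%C)^* = 0 :> C by simpc.
    rewrite scale0r addr0; congr (_ + _ *: _).
    by simpc; rewrite -expr2.
  apply: le_trans (cnormD _ _) _; apply: lerD.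
    by rewrite -[X in X * _]sr cnorm_star.
  rewrite cnormZ cnorm1 mulr1 /= expr0n /= addr0 sqrtr_sqr ger0_norm //.
  exact: sqr_ge0.
(* This [t] makes [2 * b * t] exceed [cnorm r ^+ 2] by 1. *)
have := key ((cnorm r ^+ 2 + 1) / (2 * b)); set c := cnorm r.
set t := (_ / _); have tb : 2 * b * t = c ^+ 2 + 1.
  by rewrite /t mulrC divfK // mulf_neq0 // pnatr_eq0.
have := sqr_ge0 b; rewrite sqrrD; lra.
Qed.

Lemma sa_pow_norm r k : star r = r -> cnorm (r ^+ (2 ^ k)) = cnorm r ^+ (2 ^ k).
Proof.
move=> sr; have srX n : star (r ^+ n) = r ^+ n.
  by elim: n => [|n IH]; rewrite ?expr0 ?starA1 // exprSr starM IH sr -exprS -exprSr.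
elim: k => [|k IH]; first by rewrite !expr1.
rewrite expnS mulnC !exprM -IH -cnorm_star srX -expr2 //.
Qed.

(** The norm is multiplicative on the powers [2 ^ k] of a self-adjoint element, and [k < 2 ^ k]. *)
Lemma sa_nilpotent r k : star r = r -> r ^+ k = 0 -> r = 0.
Proof.
move=> sr rk; apply: cnorm_eq0; apply/eqP.
have : cnorm r ^+ (2 ^ k) = 0.
  rewrite -sa_pow_norm // -(subnK (ltnW (ltn_expl k (isT : 1 < 2)%N))).
  by rewrite exprD rk mulr0 cnorm0.
by move/eqP; rewrite expf_eq0 => /andP[].
Qed.

Definition posfun f := scalar f /\ forall x, 0 <= f (star x * x).

(** Positivity at [1 + c *: x] makes [c * f x + c^* * f (star x)] real; the cases [c = 1] and
    [c = 'i] determine [f (star x)]. *)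
Lemma posfun_star f : posfun f -> forall x, f (star x) = (f x)^*.
Proof.
move=> [lf pf] x.
have real1 (c : C) : c * f x + c^* * f (star x) \is Num.real.
  have /ger0_real := pf (1 + c *: x).
  rewrite starD starA1 starZ mulrDl !mulrDr !mul1r mulr1.
  rewrite -!scalerAl -!scalerAr !(scalD lf) !(scalZ lf).
  have r1 : f 1 \is Num.real by have := pf 1; rewrite starA1 mulr1 => /ger0_real.
  have rx : c^* * (c * f (star x * x)) \is Num.real.
    by rewrite mulrA [_^* * _]mulrC -normCK ger0_real // mulr_ge0 ?exprn_ge0.
  set s := (X in X \is _) => rs.
  have -> : c * f x + c^* * f (star x) = s - f 1 - c^* * (c * f (star x * x)).
    by rewrite /s; ring.
  by rewrite !rpredB.
have /CrealP := real1 1; have /CrealP := real1 'i.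
rewrite !rmorphD !rmorphM /= !conjCK !rmorph1 conjCi !mul1r.
set a := f x; set b := f (star x) => e1 e2.
have e3 : a^* - b^* = b - a.
  have i0 : 'i != 0 :> C by exact: neq0Ci.
  apply: (mulfI i0); move: e1; rewrite !mulrBr mulNr mulNr => e1.
  have -> : 'i * b - 'i * a = - ('i * a - 'i * b) by ring.
  by rewrite -e1; ring.
have : 2 * a^* = 2 * b.
  have -> : 2 * a^* = (a^* + b^*) + (a^* - b^*) by ring.
  by rewrite e2 e3; ring.
by move/(mulfI _) => -> //; rewrite pnatr_eq0.
Qed.

(** The difference of the two sides is the variance of [x], the value of [f] at the square of
    [x - f x]. *)
Lemma posfun_CS f : posfun f -> f 1 = 1 ->
  forall x, `|f x| ^+ 2 <= f (star x * x).
Proof.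
move=> pf f1 x; have [lf pos] := pf.
rewrite -subr_ge0; have := pos (x - (f x)%:A).
rewrite starB star_scalar mulrBl !mulrBr -!scalerAl -!scalerAr !mul1r mulr1.
rewrite !(scalB lf) !(scalZ lf) f1 (posfun_star pf) normCK.
set a := f x; set b := f _.
have -> // : b - a * a^* - (a^* * a - a^* * (a * 1)) = b - a * a^*.
by ring.
Qed.

Local Notation b := (fun i : 'I_N => (vbasis {:A})`_i).

(** Acts on row vectors, so that [regmx] reverses products. *)
Definition regmx x : 'M[C]_N := \matrix_(i, j) coord (vbasis {:A}) j (x * b i).

Definition regtr x : C := \tr (regmx x).

Lemma coord_vb i j : coord (vbasis {:A}) i (b j) = (i == j)%:R.
Proof. by rewrite coord_free ?(basis_free (vbasisP _)) // eq_sym. Qed.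

Lemma regmxE x (w : 'rV[C]_N) :
  x * \sum_i w 0 i *: b i = \sum_j (w *m regmx x) 0 j *: b j.
Proof.
have [_ fr] := frame_vbasis A.
rewrite mulr_sumr; under eq_bigr => i _ do rewrite -scalerAr (fr (x * b i)) scaler_sumr.
rewrite exchange_big; apply: eq_bigr => j _; rewrite mxE scaler_suml.
by apply: eq_bigr => i _; rewrite !mxE scalerA.
Qed.

Lemma regmxM x y : regmx (x * y) = regmx y *m regmx x.
Proof.
have [_ fr] := frame_vbasis A.
apply/matrixP => i j; rewrite !mxE -mulrA.
rewrite (fr (y * b i)) mulr_sumr (scal_sum (scalar_coord _ _)).
by apply: eq_bigr => k _; rewrite -scalerAr (scalZ (scalar_coord _ _)) !mxE.
Qed.

Lemma regmx1 : regmx 1 = 1%:M.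
Proof. by apply/matrixP => i j; rewrite !mxE mul1r coord_vb eq_sym. Qed.

Lemma regmx_inj0 x : regmx x = 0 -> x = 0.
Proof.
move=> /matrixP x0; have [_ fr] := frame_vbasis A.
rewrite -[x]mulr1 [X in _ * X]fr mulr_sumr big1 // => i _.
rewrite -scalerAr (fr (x * _)) big1 ?scaler0 // => j _.
by have := x0 i j; rewrite !mxE => ->; rewrite scale0r.
Qed.

Lemma scalar_regtr : scalar regtr.
Proof.
move=> a x y; rewrite /regtr /mxtrace mulr_sumr -big_split; apply: eq_bigr => i _.
by rewrite !mxE mulrDl -scalerAl scalar_coord.
Qed.

Lemma regtrC x y : regtr (x * y) = regtr (y * x).
Proof. by rewrite /regtr !regmxM mxtrace_mulC. Qed.

Lemma regtr1 : regtr 1 = N%:R.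
Proof. by rewrite /regtr regmx1 mxtrace1. Qed.

Lemma sa_eigenvalue_real r a : star r = r -> eigenvalue (regmx r) a -> a \is Num.real.
Proof.
move=> sr /eigenvalueP[w ew w0].
apply: (sa_eigen_real (y := \sum_i w 0 i *: b i) sr); last first.
  by rewrite regmxE ew scaler_sumr; apply: eq_bigr => i _; rewrite !mxE scalerA.
apply: contra_neq w0 => w0; apply/rowP => i; rewrite mxE.
have := congr1 (coord (vbasis {:A}) i) w0.
rewrite (scal_sum (scalar_coord _ _)) linear0 (bigD1 i) //= big1 => [|j nj].
  by rewrite (scalZ (scalar_coord _ _)) coord_vb eqxx mulr1 addr0.
by rewrite (scalZ (scalar_coord _ _)) coord_vb eq_sym (negPf nj) mulr0.
Qed.

(** Left multiplication by [r] has real eigenvalues. If the trace of its square vanishes they are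
    all zero, so [r] is nilpotent, and a self-adjoint nilpotent is zero. *)
Lemma regtr_sqr_sa r : star r = r ->
  0 <= regtr (r * r) /\ (regtr (r * r) = 0 -> r = 0).
Proof.
move=> sr; rewrite /regtr regmxM.
have [h0 h1] := mxtrace_sqr_real_eigen (fun a => @sa_eigenvalue_real r a sr).
split=> // /h1 /nilpotent_eigen[k rk]; apply: (sa_nilpotent (k := k) sr).
apply: regmx_inj0; rewrite -[RHS]rk; elim: k {rk} => [|k IH] /=.
  by rewrite expr0 regmx1.
by rewrite exprSr regmxM IH.
Qed.

(** The trace property gives [4 tr(x^* x) = tr(r^2) + tr(s^2)] for the
    self-adjoint elements [r = x + x^*] and [s = i (x - x^* )]. *)
Lemma posfun_regtr : posfun regtr /\ forall x, regtr (star x * x) = 0 -> x = 0.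
Proof.
have key x : exists r s, [/\ star r = r, star s = s, (r = 0 -> s = 0 -> x = 0) &
    4 * regtr (star x * x) = regtr (r * r) + regtr (s * s)].
  exists (x + star x), ('i *: (x - star x)); split.
  - by rewrite starD starK addrC.
  - by rewrite starZ starB starK conjCi scaleNr -scalerN opprB.
  - move=> r0 /eqP; rewrite scaler_eq0 (negPf (neq0Ci _)) /= subr_eq0 => /eqP s0.
    move: r0; rewrite -s0 -mulr2n -scaler_nat => /eqP.
    by rewrite scaler_eq0 pnatr_eq0 => /eqP.
  - rewrite -(scalD scalar_regtr).
    have -> : ('i *: (x - star x)) * ('i *: (x - star x)) =
        - ((x - star x) * (x - star x)).
      by rewrite -scalerAl -scalerAr scalerA -[X in X *: _]expr2 sqrCi scaleN1r.
    have -> : (x + star x) * (x + star x) - (x - star x) * (x - star x) =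
       2 *: (x * star x) + 2 *: (star x * x).
      rewrite !(mulrDl, mulrDr, mulNr, mulrN, opprD, opprK) !scaler_nat !mulr2n.
      rewrite [LHS](AC ((2*2)*(2*2)) ((1*5)*(2*6)*(3*7)*(4*8))) /=.
      by rewrite !subrr add0r addr0.
    rewrite (scalD scalar_regtr) !(scalZ scalar_regtr) [regtr (x * _)]regtrC.
    by ring.
have four : (0 : C) < 4 by rewrite ltr0n.
split=> [|x x0].
  split=> [|x]; first exact: scalar_regtr.
  have [r [s [sr ss _ e]]] := key x.
  rewrite -(pmulr_rge0 _ four) e addr_ge0 //.
    by have [] := regtr_sqr_sa sr.
  by have [] := regtr_sqr_sa ss.
have [r [s [sr ss rs e]]] := key x.
move: e; rewrite x0 mulr0 => /esym/eqP.
have [r0 r1] := regtr_sqr_sa sr; have [s0 s1] := regtr_sqr_sa ss.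
by rewrite paddr_eq0 // => /andP[/eqP/r1 ? /eqP/s1 ?]; apply: rs.
Qed.

End CstarTheory.

(** * Orthonormal bases and the Haar state *)

Section OrthonormalBases.
Variables (R : realType) (A : finCstarAlg R).
Local Notation C := R[i].
Local Notation N := (\dim {:A}).
Implicit Types (f : A -> C).
Local Open Scope sesquilinear_scope.

Definition faithful f := forall x, f (star x * x) = 0 -> x = 0.

Definition onb f n (e : 'I_n -> A) :=
  (forall i j, f (star (e i) * e j) = (i == j)%:R) /\
  forall x, x = \sum_i f (star (e i) * x) *: e i.

Definition gram f n (b : 'I_n -> A) : 'M[C]_n :=
  \matrix_(i, j) f (star (b i) * b j).

Definition lincomb n (b : 'I_n -> A) (w : 'cV[C]_n) : A :=
  \sum_i w i 0 *: b i.

Lemma gramE f n (b : 'I_n -> A) (w z : 'cV[C]_n) : scalar f ->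
  f (star (lincomb b w) * lincomb b z) = hdot w (gram f b *m z).
Proof.
move=> lf; rewrite star_sum mulr_suml (scal_sum lf) hdotE.
apply: eq_bigr => i _; rewrite mulr_sumr (scal_sum lf) mxE mulr_sumr.
apply: eq_bigr => j _; rewrite starZ -scalerAl -scalerAr !(scalZ lf) !mxE.
by congr (_ * _); rewrite mulrC.
Qed.

Lemma gram_herm f n (b : 'I_n -> A) : posfun f -> (gram f b)^t* = gram f b.
Proof.
by move=> pf; apply/matrixP => i j; rewrite !mxE -(posfun_star pf) starM starK.
Qed.

Lemma gram_ge0 f n (b : 'I_n -> A) : posfun f ->
  forall x, 0 <= hdot x (gram f b *m x).
Proof. by move=> [lf pf] x; rewrite -gramE. Qed.

Lemma onb_dot f n (e : 'I_n -> A) (w z : 'cV[C]_n) : scalar f -> onb f e ->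
  f (star (lincomb e w) * lincomb e z) = hdot w z.
Proof.
move=> lf [oe _]; rewrite gramE //; suff -> : gram f e = 1%:M by rewrite mul1mx.
by apply/matrixP => i j; rewrite !mxE oe.
Qed.

Lemma onb_expand f n (e : 'I_n -> A) : onb f e ->
  forall x, x = lincomb e (\col_i f (star (e i) * x)).
Proof.
by move=> [_ fr] x; rewrite {1}(fr x); apply: eq_bigr => i _; rewrite mxE.
Qed.

Lemma scalar_starl f (a : A) : scalar f -> scalar (fun x => f (star a * x)).
Proof. by move=> lf k x y; rewrite mulrDr -scalerAr lf. Qed.

Lemma onb_frame f n (e : 'I_n -> A) : scalar f -> onb f e ->
  frame e (fun i x => f (star (e i) * x)).
Proof. by move=> lf [_ fr]; split=> // i; apply: scalar_starl. Qed.

Lemma lincomb_inj f n (e : 'I_n -> A) : scalar f -> onb f e ->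
  injective (lincomb e).
Proof.
move=> lf oe w z wz; apply/colP => i.
have coordE (u : 'cV[C]_n) : f (star (e i) * lincomb e u) = u i 0.
  rewrite mulr_sumr (scal_sum lf) (bigD1 i) //= big1 => [|j nj].
    by rewrite -scalerAr (scalZ lf) oe.1 eqxx mulr1 addr0.
  by rewrite -scalerAr (scalZ lf) oe.1 eq_sym (negPf nj) mulr0.
by rewrite -!coordE wz.
Qed.

Lemma onb_intro f n (e : 'I_n -> A) : scalar f ->
    (forall i j, f (star (e i) * e j) = (i == j)%:R) ->
    (forall x, exists w, x = lincomb e w) ->
  onb f e.
Proof.
move=> lf oe se; split=> // x; have [w xE] := se x.
rewrite {1}xE; apply: eq_bigr => i _; congr (_ *: _); rewrite xE.
rewrite mulr_sumr (scal_sum lf) (bigD1 i) //= big1 => [|j nj].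
  by rewrite -scalerAr (scalZ lf) oe eqxx mulr1 addr0.
by rewrite -scalerAr (scalZ lf) oe eq_sym (negPf nj) mulr0.
Qed.

(** Faithfulness makes the Gram matrix of the standard basis positive definite, say [B^* B]; the
    columns of the inverse of [B] are the coordinates of an orthonormal basis. *)
Lemma exists_onb f : posfun f -> faithful f ->
  exists e : 'I_N -> A, onb f e.
Proof.
move=> pf ff; have [lf pos] := pf.
pose b := fun i : 'I_N => (vbasis {:A})`_i; set M := gram f b.
have [_ fr] := frame_vbasis A.
have lincomb0 w : lincomb b w = 0 -> w = 0.
  move=> w0; apply/colP => i; rewrite mxE.
  have := congr1 (coord (vbasis {:A}) i) w0.
  rewrite (scal_sum (scalar_coord _ _)) linear0 (bigD1 i) //= big1 => [|j nj].
    by rewrite (scalZ (scalar_coord _ _)) coord_vb eqxx mulr1 addr0.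
  by rewrite (scalZ (scalar_coord _ _)) coord_vb eq_sym (negPf nj) mulr0.
have [|B uB eM] := @pd_gram _ N M (gram_herm b pf).
  move=> w w0; rewrite -gramE // lt_def pos andbT.
  by apply: contra_neq w0 => /ff/lincomb0.
pose X := invmx B; pose e := fun i => lincomb b (col i X).
have oe i j : f (star (e i) * e j) = (i == j)%:R.
  rewrite gramE // -/M eM -mulmxA hdot_mulmxr trmxCK.
  rewrite !colE !mulKVmx // hdotE (bigD1 i) //= big1 => [|k nk].
    by rewrite !mxE !eqxx !andbT /= rmorph1 mul1r addr0.
  by rewrite !mxE (negPf nk) rmorph0 mul0r.
exists e; apply: onb_intro => // x.
(* Passing from the old basis to [e] multiplies coordinates by [B]. *)
exists (B *m (\col_i coord (vbasis {:A}) i x)).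
rewrite {1}(fr x) /lincomb.
under [RHS]eq_bigr => k _ do rewrite /e /lincomb scaler_sumr.
rewrite exchange_big; apply: eq_bigr => i _ /=.
under eq_bigr => k _ do rewrite scalerA.
rewrite -scaler_suml; congr (_ *: _).
transitivity ((X *m (B *m \col_i coord (vbasis {:A}) i x)) i 0).
  by rewrite mulKmx // mxE.
by rewrite [LHS]mxE; apply: eq_bigr => k _; rewrite !mxE mulrC.
Qed.

End OrthonormalBases.

Section TensorStar.
Variables (R : realType) (A B : finCstarAlg R).
Local Notation C := R[i].

Lemma tstar_pure (a : A) (b : B) : tstar (tpure a b) = tpure (star a) (star b).
Proof.
have [_ fa] := frame_vbasis A; have [_ fb] := frame_vbasis B.
rewrite [a in RHS]fa [b in RHS]fb !star_sum tpure_suml.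
apply: eq_bigr => i _; rewrite tpure_sumr; apply: eq_bigr => j _.
by rewrite !starZ tpureZl tpureZr scalerA !mxE rmorphM.
Qed.

Lemma tstar_sum I (r : seq I) (P : pred I) (a : I -> A) (b : I -> B) :
  tstar (\sum_(i <- r | P i) tpure (a i) (b i)) =
  \sum_(i <- r | P i) tpure (star (a i)) (star (b i)).
Proof.
transitivity (\sum_(i <- r | P i) tstar (tpure (a i) (b i))); last first.
  by apply: eq_bigr => i _; rewrite tstar_pure.
elim/big_rec2: _ => [|i y1 y2 _ <-].
  by rewrite /tstar map_mx0 (lin0 (@tlift_linear _ _ _ _ _)).
by rewrite /tstar map_mxD (linD (@tlift_linear _ _ _ _ _)).
Qed.

End TensorStar.

(** * The Haar state as the normalised regular trace *)

Section HaarTrace.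
Variables (R : realType) (G : finQuantumGroup R).
Local Notation C := R[i].
Local Notation N := (\dim {:G}).
Implicit Types (f g : G -> C).

Lemma fconv_slicer f g x : scalar f -> scalar g -> fconv f g x = f (slicer g x).
Proof.
move=> lf lg; rewrite /fconv /slicer; have [y ->] := tens_pure_sum (comul x).
rewrite !tlift_sum; [|exact: bilin_slicer|exact: bilin_mul].
by rewrite (scal_sum lf); apply: eq_bigr => i _; rewrite (scalZ lf) mulrC.
Qed.

Lemma fconv_slicel f g x : scalar f -> scalar g -> fconv f g x = g (slicel f x).
Proof.
move=> lf lg; rewrite /fconv /slicel; have [y ->] := tens_pure_sum (comul x).
rewrite !tlift_sum; [|exact: bilin_slicel|exact: bilin_mul].
by rewrite (scal_sum lg); apply: eq_bigr => i _; rewrite (scalZ lg).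
Qed.

Lemma slicer_linear f : linear (slicer f).
Proof. by move=> a x y; rewrite /slicer linearP; apply: tlift_linear. Qed.

Lemma slicel_linear f : linear (slicel f).
Proof. by move=> a x y; rewrite /slicel linearP; apply: tlift_linear. Qed.

Lemma fconv_scalar f g : scalar (fconv f g).
Proof. by move=> a x y; rewrite /fconv linearP; apply: tlift_linear. Qed.

Lemma slicer1 f : scalar f -> slicer f 1 = (f 1)%:A.
Proof. by move=> lf; rewrite /slicer comul1 tlift_tpure //; apply bilin_slicer. Qed.

(** Multiplication by [Delta x] is conjugate to multiplication by [x (x) 1]
    through the bijection [a (x) b |-> Delta(a)(1 (x) b)]. *)
Lemma regtr_conv (x : G) : fconv (@regtr R G) (@regtr R G) x = N%:R * regtr x.
Proof.
pose V (t : tens G G) : tens G G :=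
  tlift (fun a b => tmul (comul a) (tpure 1 b)) t.
have linV : linear V by exact: tlift_linear.
have bV : bilin (fun a b : G => tmul (comul a) (tpure 1 b)).
  split=> [v|u] k y z; first by rewrite linearP; exact: tlift_linear.
  by rewrite tpure_linr; exact: tmul_lin.
have [g [lg Vg gV]] : exists g : tens G G -> tens G G, [/\ linear g, cancel V g & cancel g V].
  apply: surj_linear_inv => // t; have [s ->] := comul_densel t.
  by exists (\sum_(ab <- s) tpure ab.1 ab.2); rewrite /V tlift_sum.
have VL t : tmul (comul x) (V t) = V (tmul (tpure x 1) t).
  have [y ->] := tens_pure_sum t.
  have -> : tmul (tpure x 1) (\sum_(i < N) tpure (vbasis {:G})`_i (y i)) =
      \sum_(i < N) tpure (x * (vbasis {:G})`_i) (y i).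
    rewrite (lin_sum (tmul_lin _)); apply: eq_bigr => i _.
    by rewrite tmul_pure mul1r.
  rewrite /V !(tlift_sum _ _ _ _ bV) (lin_sum (tmul_lin _)); apply: eq_bigr => i _.
  by rewrite (comulM x) tmulA.
pose J := ('I_N * 'I_N)%type.
pose b (p : J) : tens G G := tpure (vbasis {:G})`_p.1 (vbasis {:G})`_p.2.
pose c (p : J) (t : tens G G) : C := t p.1 p.2.
have fr : frame b c by exact: frame_tens.
(* The left side is the trace of left multiplication by [t] on the tensor square, which factors on
   pure tensors. *)
have trE t : \sum_p c p (tmul t (b p)) =
    tlift (fun y z => regtr y * regtr z : C^o) t.
  have [y ->] := tens_pure_sum t.
  rewrite tlift_sum; last by apply: bilin_mul; exact: scalar_regtr.
  have -> : \sum_p c p (tmul (\sum_(i < N) tpure (vbasis {:G})`_i (y i)) (b p)) =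
      \sum_(p : J) \sum_(i < N) coord (vbasis {:G}) p.1 ((vbasis {:G})`_i * (vbasis {:G})`_p.1) *
        coord (vbasis {:G}) p.2 (y i * (vbasis {:G})`_p.2).
    apply: eq_bigr => p _.
    have -> : b p = \sum_(k <- [:: tt]) tpure (vbasis {:G})`_p.1 (vbasis {:G})`_p.2.
      by rewrite big_seq1.
    rewrite tmul_sum.
    rewrite /c summxE; apply: eq_bigr => i _; rewrite big_seq1 mxE //.
  rewrite exchange_big; apply: eq_bigr => i _ /=.
  rewrite /regtr /mxtrace mulr_suml -(pair_bigA _ (fun k l => coord (vbasis {:G}) k
    ((vbasis {:G})`_i * (vbasis {:G})`_k) * coord (vbasis {:G}) l (y i * (vbasis {:G})`_l))).
  by apply: eq_bigr => k _; rewrite mulr_sumr; apply: eq_bigr => l _; rewrite !mxE.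
rewrite /fconv -trE.
transitivity (\sum_p c p (V (tmul (tpure x 1) (g (b p))))).
  by apply: eq_bigr => p _; rewrite -VL gV.
have lL : linear (fun t => tmul (tpure x 1) (g t)).
  by move=> k t u; rewrite lg; exact: tmul_lin.
transitivity (\sum_p c p (tmul (tpure x 1) (g (V (b p))))).
  exact: (frame_trace fr fr lL linV).
under eq_bigr => p _ do rewrite Vg.
have [bl br] := bilin_mul (@scalar_regtr R G) (@scalar_regtr R G).
by rewrite trE tlift_tpure // regtr1 mulrC.
Qed.

Section MatrixOfCoefficients.
Variables (n : nat) (e : 'I_n -> G) (c : 'I_n -> G -> C).
Hypotheses (fr : frame e c) (dual : forall i j, c i (e j) = (i == j)%:R).

(** The regular representation in the basis [e]: column [j] holds the right legs of
    [comul (e j)]. *)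
Definition coefmx : 'M[G]_n :=
  \matrix_(i, j) tlift (fun a b => c i a *: b) (comul (e j)).

Lemma comul_coef j : comul (e j) = \sum_i tpure (e i) (coefmx i j).
Proof.
by rewrite {1}(tens_frame (comul (e j)) fr); apply: eq_bigr => i _; rewrite mxE.
Qed.

(** Coassociativity at [e j], compared at the coefficient of [e i] in the first leg. *)
Lemma comul_coefmx i j : comul (coefmx i j) = \sum_k tpure (coefmx i k) (coefmx k j).
Proof.
have sc := fr.1; have b1 : bilin (fun (a : G) (b : G) => tpure (comul a) (idfun b)).
  split=> [v|u] k y z; last exact: tpure_linr.
  by rewrite linearP /= (bilin_tpure _ _).1.
have b2 : bilin (fun (a : G) (b : G) => tpure (idfun a) (comul b)).
  split=> [v|u] k y z; first by rewrite (bilin_tpure _ _).1.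
  by rewrite linearP /= (bilin_tpure _ _).2.
have b3 : bilin (fun (p : tens G G) (w : G) =>
    tlift (fun u v => tpure u (tpure v w)) p).
  split=> [v|u] k y z; first exact: tlift_linear.
  have [s ->] := tens_pure_sum u.
  have bb q : bilin (fun a b : G => tpure a (tpure b q)).
    split=> [v|v] l p r; first by rewrite (bilin_tpure _ _).1.
    by rewrite (bilin_tpure _ _).1 (bilin_tpure _ _).2.
  rewrite !tlift_sum // scaler_sumr -big_split; apply: eq_bigr => l _ /=.
  by rewrite tpure_linr (bilin_tpure _ _).2.
have := comulA (e j).
rewrite comul_coef /tmap /tassoc !tlift_sum //=.
have -> : \sum_i tlift (fun u v => tpure u (tpure v (coefmx i j))) (comul (e i)) =
    \sum_k tpure (e k) (\sum_i tpure (coefmx k i) (coefmx i j)).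
  under [RHS]eq_bigr => k _ do rewrite tpure_sumr.
  rewrite [RHS]exchange_big; apply: eq_bigr => l _ /=.
  rewrite comul_coef tlift_sum //.
  split=> [v|v] m p r; first by rewrite (bilin_tpure _ _).1.
  by rewrite (bilin_tpure _ _).1 (bilin_tpure _ _).2.
move/(congr1 (tlift (fun a b => c i a *: b))).
rewrite !tlift_sum; [|exact: bilin_slicel|exact: bilin_slicel].
have sumE (W : lmodType C) (F : 'I_n -> W) : \sum_k c i (e k) *: F k = F i.
  rewrite (bigD1 i) //= big1 => [|k nk]; rewrite dual.
    by rewrite eqxx scale1r addr0.
  by rewrite eq_sym (negPf nk) scale0r.
by rewrite !sumE.
Qed.

Lemma comul_lincomb w :
  comul (lincomb e w) = \sum_i tpure (e i) (\sum_j w j 0 *: coefmx i j).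
Proof.
rewrite linear_sum /=.
under [RHS]eq_bigr => i _ do rewrite tpure_sumr.
rewrite exchange_big; apply: eq_bigr => j _ /=.
rewrite linearZ /= comul_coef scaler_sumr; apply: eq_bigr => i _.
by rewrite tpureZr.
Qed.

(** The dictionary between convolution operators and matrices: on coordinates, convolution by [f] is
    the scalar matrix obtained by applying [f] to the regular representation. *)
Lemma slicer_lincomb f w : scalar f ->
  slicer f (lincomb e w) = lincomb e (map_mx f coefmx *m w).
Proof.
move=> lf; rewrite /slicer comul_lincomb tlift_sum; last exact: bilin_slicer.
apply: eq_bigr => i _; rewrite (scal_sum lf) [in RHS]mxE; congr (_ *: _).
by apply: eq_bigr => j _; rewrite (scalZ lf) [in RHS]mxE mulrC.
Qed.

End MatrixOfCoefficients.

Lemma comul_starM n (e : 'I_n -> G) (x y : G) (a b : 'I_n -> G) :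
    comul x = \sum_i tpure (e i) (a i) -> comul y = \sum_i tpure (e i) (b i) ->
  comul (star x * y) = \sum_i \sum_j tpure (star (e i) * e j) (star (a i) * b j).
Proof. by move=> ex ey; rewrite comulM comul_star ex ey tstar_sum tmul_sum. Qed.

Lemma map_mx_fconv n (u : 'M[G]_n) f g : scalar f -> scalar g ->
    (forall i j, comul (u i j) = \sum_k tpure (u i k) (u k j)) ->
  map_mx (fconv f g) u = map_mx f u *m map_mx g u.
Proof.
move=> lf lg cu; apply/matrixP => i j; rewrite !mxE /fconv cu tlift_sum.
  by apply: eq_bigr => k _; rewrite !mxE.
exact: bilin_mul.
Qed.

(** As [w] is fixed, [f (y i) = w i 0], and each summand on the left is the variance of [y i]. When
    the right side vanishes, so does every variance. *)
Lemma defect_sum n (u : 'M[G]_n) f (w : 'cV[C]_n) :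
    posfun f -> f 1 = 1 -> map_mx f u *m w = w ->
  let y i := \sum_j w j 0 *: u i j in
  \sum_i f (star (y i - (w i 0)%:A) * (y i - (w i 0)%:A)) =
  \sum_i f (star (y i) * y i) - hdot w w.
Proof.
move=> pf f1 fw y; have [lf _] := pf.
have fy i : f (y i) = w i 0.
  rewrite -[in RHS]fw mxE (scal_sum lf); apply: eq_bigr => j _.
  by rewrite (scalZ lf) mxE mulrC.
rewrite hdotE -sumrB; apply: eq_bigr => i _.
rewrite starB star_scalar mulrBl !mulrBr -!scalerAl -!scalerAr !mul1r mulr1.
rewrite !(scalB lf) !(scalZ lf) f1 (posfun_star pf) !fy.
by ring.
Qed.

Definition regstate (x : G) : C := N%:R^-1 * regtr x.

Lemma dimG_neq0 : N%:R != 0 :> C.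
Proof. by rewrite pnatr_eq0 -lt0n dimvf; exact: FalgType_proper. Qed.

Lemma posfun_regstate : posfun regstate.
Proof.
have [[lt pt] _] := posfun_regtr G; split=> [a x y|x].
  by rewrite /regstate lt mulrDr mulrCA.
by rewrite mulr_ge0 // invr_ge0 ler0n.
Qed.

Lemma faithful_regstate : faithful regstate.
Proof.
move=> x /eqP; rewrite mulf_eq0 invr_eq0 (negPf dimG_neq0) /= => /eqP.
exact: (posfun_regtr G).2.
Qed.

Lemma regstate1 : regstate 1 = 1.
Proof. by rewrite /regstate regtr1 mulVf // dimG_neq0. Qed.

Lemma regstate_idem x : fconv regstate regstate x = regstate x.
Proof.
have lt := @scalar_regtr R G.
have -> : fconv regstate regstate x = N%:R^-1 * (N%:R^-1 * fconv (@regtr R G) (@regtr R G) x).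
  rewrite /fconv; have [y ->] := tens_pure_sum (comul x).
  rewrite !tlift_sum; [|by apply: bilin_mul|by apply: bilin_mul; exact: posfun_regstate.1].
  by rewrite !mulr_sumr; apply: eq_bigr => i _; rewrite /regstate; ring.
by rewrite regtr_conv mulKf // dimG_neq0.
Qed.

Lemma comul_pure_scalar (h : G -> C) x :
  is_haar h -> comul x = tpure x 1 -> x = (h x)%:A.
Proof.
move=> [[lh _ h1] inv] cx; have [bl br] := bilin_slicer G lh.
by rewrite -(inv x).2 /slicer cx tlift_tpure // h1 scale1r.
Qed.

(** With [b = rho * a], [rho] the normalised trace, idempotence of the faithful
    state [rho] forces [Delta b = b (x) 1], so that [b] is scalar. *)
Lemma haar_regstate h : is_haar h -> h =1 regstate.
Proof.
move=> hh a; have [[lh _ h1] inv] := hh.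
have pr := posfun_regstate; have lr := pr.1.
have [e oe] := exists_onb pr faithful_regstate.
have fr := onb_frame lr oe; set v := coefmx e (fun i x => regstate (star (e i) * x)).
have cv := comul_coefmx fr oe.1.
set b := slicer regstate a.
pose w := \col_i regstate (star (e i) * b).
have bE : b = lincomb e w := onb_expand oe b.
have fixw : map_mx regstate v *m w = w.
  apply: (lincomb_inj lr oe); rewrite -(slicer_lincomb fr) // -bE.
  rewrite /b [a](onb_expand oe) !(slicer_lincomb fr) // mulmxA -map_mx_fconv //.
  by congr (lincomb _ (_ *m _)); apply/matrixP => i j; rewrite !mxE regstate_idem.
pose y i := \sum_j w j 0 *: v i j.
(* Expanding [comul (star b * b)] in the orthonormal basis, idempotence of [regstate] identifies
   [hdot w w], its value at [star b * b], with the sum of the values at [star (y i) * y i]. The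
   total variance is therefore zero. *)
have y0 : \sum_i regstate (star (y i - (w i 0)%:A) * (y i - (w i 0)%:A)) = 0.
  rewrite defect_sum //; last exact: regstate1.
  rewrite -(onb_dot w w lr oe) -bE -[X in _ - X]regstate_idem /fconv.
  have cb : comul b = \sum_i tpure (e i) (y i) by rewrite bE (comul_lincomb fr).
  rewrite (comul_starM cb cb) pair_big /= tlift_sum; last exact: bilin_mul.
  rewrite -(pair_bigA _ (fun i j => regstate (star (e i) * e j) * regstate (star (y i) * y j))) /=.
  apply/eqP; rewrite subr_eq0; apply/eqP; apply: eq_bigr => i _.
  rewrite -/(y i) [RHS](bigD1 i) //= oe.1 eqxx mul1r big1 ?addr0 // => j nj.
  by rewrite oe.1 eq_sym (negPf nj) mul0r.
have yw i : y i = (w i 0)%:A.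
  apply/eqP; rewrite -subr_eq0; apply/eqP/faithful_regstate/eqP.
  move/eqP: y0; rewrite psumr_eq0 => [/allP/(_ i (mem_index_enum _))//|k _].
  exact: pr.2.
have cb : comul b = tpure b 1.
  rewrite {2}bE bE (comul_lincomb fr) tpure_suml; apply: eq_bigr => i _.
  by rewrite -/(y i) yw tpureZr tpureZl.
have hb : b = (h b)%:A by exact: comul_pure_scalar hh cb.
have hba : h b = h a.
  rewrite /b -fconv_slicer // fconv_slicel // (inv a).1 (scalZ lr).
  by rewrite regstate1 mulr1.
by rewrite -hba -regstate_idem fconv_slicer // -/b hb (scalZ lr) regstate1 mulr1 -hb.
Qed.

Lemma posfun_state f : is_state f -> posfun f.
Proof. by move=> [lf pf _]; split=> // x; apply: pf; exists x. Qed.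

Lemma haar_trace (h : G -> C) : is_haar h -> forall x y, h (x * y) = h (y * x).
Proof.
by move=> hh x y; rewrite !(haar_regstate hh) /regstate regtrC.
Qed.

Lemma haar_faithful (h : G -> C) : is_haar h -> faithful h.
Proof. by move=> hh x; rewrite (haar_regstate hh); exact: faithful_regstate. Qed.

End HaarTrace.

(** * Decomposition of unitary representations *)

Section Representations.
Variables (R : realType) (G : finQuantumGroup R).
Local Notation C := R[i].
Local Open Scope sesquilinear_scope.

(** Right multiplication by [X] on rows is injective, hence surjective in finite dimension, which
    yields a left inverse of [X]. Rows are coded as finite functions to be vectors over the complex
    numbers. *)
Lemma mulmx1_comm n (X Y : 'M[G]_n) : X *m Y = 1%:M -> Y *m X = 1%:M.
Proof.
move=> XY; pose row_of (z : {ffun 'I_n -> G}) : 'rV[G]_n := \row_j z j.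
pose f (z : {ffun 'I_n -> G}) : {ffun 'I_n -> G} := [ffun j => (row_of z *m X) 0 j].
have rowf z : row_of (f z) = row_of z *m X.
  by apply/rowP => j; rewrite [LHS]mxE ffunE.
have lf : linear f.
  move=> a z w; apply/ffunP => j; rewrite !ffunE !mxE scaler_sumr -big_split.
  by apply: eq_bigr => k _; rewrite !mxE !ffunE mulrDl -scalerAl.
have f0 z : f z = 0 -> z = 0.
  move=> z0; have : row_of (f z) *m Y = row_of z.
    by rewrite rowf -mulmxA XY mulmx1.
  have -> : row_of (f z) = 0 by apply/rowP => j; rewrite z0 !mxE ffunE.
  by rewrite mul0mx => /rowP z1; apply/ffunP => j; have := z1 j; rewrite !mxE ffunE.
have surj i := inj_linear_surj lf f0 [ffun j => (1%:M : 'M[G]_n) i j].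
pose Z : 'M[G]_n := \matrix_(i, j) (sval (cid (surj i))) j.
have ZX : Z *m X = 1%:M.
  apply/row_matrixP => i; rewrite row_mul.
  have -> : row i Z = row_of (sval (cid (surj i))) by apply/rowP => j; rewrite !mxE.
  rewrite -rowf (svalP (cid (surj i))).
  by apply/rowP => j; rewrite !mxE ffunE mxE.
have -> : Y = Z by rewrite -[Z]mulmx1 -XY mulmxA ZX mul1mx.
exact: ZX.
Qed.

Lemma scalmxl m n p (X : 'M[C]_(m, n)) (u : 'M[G]_(n, p)) i j :
  (scalmx G X *m u) i j = \sum_k X i k *: u k j.
Proof. by rewrite mxE; apply: eq_bigr => k _; rewrite !mxE -scalerAl mul1r. Qed.

Lemma scalmxr m n p (u : 'M[G]_(m, n)) (X : 'M[C]_(n, p)) i j :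
  (u *m scalmx G X) i j = \sum_k X k j *: u i k.
Proof. by rewrite mxE; apply: eq_bigr => k _; rewrite !mxE -scalerAr mulr1. Qed.

Lemma scalmx1 n : scalmx G (1%:M : 'M[C]_n) = 1%:M.
Proof. by rewrite /scalmx map_mx1. Qed.

Lemma scalmxD m n (X Y : 'M[C]_(m, n)) : scalmx G (X + Y) = scalmx G X + scalmx G Y.
Proof. by rewrite /scalmx map_mxD. Qed.

Lemma scalmxB m n (X Y : 'M[C]_(m, n)) : scalmx G (X - Y) = scalmx G X - scalmx G Y.
Proof. by rewrite /scalmx map_mxB. Qed.

Lemma scalmx0 m n : scalmx G (0 : 'M[C]_(m, n)) = 0.
Proof. by rewrite /scalmx map_mx0. Qed.

Definition adjmxr m n (u : 'M[G]_(m, n)) : 'M[G]_(n, m) :=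
  \matrix_(i, j) star (u j i).

Lemma adjmxrM m n p (u : 'M[G]_(m, n)) (w : 'M[G]_(n, p)) :
  adjmxr (u *m w) = adjmxr w *m adjmxr u.
Proof.
apply/matrixP => i j; rewrite !mxE star_sum.
by apply: eq_bigr => k _; rewrite starM !mxE.
Qed.

Lemma adjmxrD m n (u w : 'M[G]_(m, n)) : adjmxr (u + w) = adjmxr u + adjmxr w.
Proof. by apply/matrixP => i j; rewrite !mxE starD. Qed.

Lemma adjmxr_scalmx m n (X : 'M[C]_(m, n)) : adjmxr (scalmx G X) = scalmx G (X^t*).
Proof. by apply/matrixP => i j; rewrite !mxE star_scalar. Qed.

Lemma map_scalmxl m n p (f : G -> G) (X : 'M[C]_(m, n)) (u : 'M[G]_(n, p)) :
  linear f -> map_mx f (scalmx G X *m u) = scalmx G X *m map_mx f u.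
Proof.
move=> lf; apply/matrixP => i j; rewrite scalmxl mxE scalmxl (lin_sum lf).
by apply: eq_bigr => k _; rewrite (linZ lf) mxE.
Qed.

Lemma map_scalmxr m n p (f : G -> G) (u : 'M[G]_(m, n)) (X : 'M[C]_(n, p)) :
  linear f -> map_mx f (u *m scalmx G X) = map_mx f u *m scalmx G X.
Proof.
move=> lf; apply/matrixP => i j; rewrite mxE !scalmxr (lin_sum lf).
by apply: eq_bigr => k _; rewrite (linZ lf) mxE.
Qed.

Lemma map_scalmxl_scalar m n p (f : G -> C) (X : 'M[C]_(m, n)) (u : 'M[G]_(n, p)) :
  scalar f -> map_mx f (scalmx G X *m u) = X *m map_mx f u.
Proof.
move=> lf; apply/matrixP => i j; rewrite mxE scalmxl (scal_sum lf) mxE.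
by apply: eq_bigr => k _; rewrite (scalZ lf) mxE.
Qed.

Lemma map_scalmxr_scalar m n p (f : G -> C) (u : 'M[G]_(m, n)) (X : 'M[C]_(n, p)) :
  scalar f -> map_mx f (u *m scalmx G X) = map_mx f u *m X.
Proof.
move=> lf; apply/matrixP => i j; rewrite mxE scalmxr (scal_sum lf) mxE.
by apply: eq_bigr => k _; rewrite (scalZ lf) mxE mulrC.
Qed.

Definition corep n (u : 'M[G]_n) : Prop :=
  forall i j, comul (u i j) = \sum_k tpure (u i k) (u k j).

Lemma comul_scal n k l (u : 'M[G]_n) (X : 'M[C]_(k, n)) (Y : 'M[C]_(n, l)) i j :
  corep u -> comul ((scalmx G X *m u *m scalmx G Y) i j) =
    \sum_m tpure ((scalmx G X *m u) i m) ((u *m scalmx G Y) m j).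
Proof.
move=> cu; rewrite scalmxr linear_sum /=.
under eq_bigr => b _ do rewrite scalmxl linearZ linear_sum /= scaler_sumr.
under [RHS]eq_bigr => m _ do rewrite scalmxr tpure_sumr.
rewrite [RHS]exchange_big; apply: eq_bigr => b _ /=.
under eq_bigr => a _ do rewrite linearZ /= cu !scaler_sumr.
rewrite exchange_big; apply: eq_bigr => m _ /=.
rewrite scalmxl tpure_suml; apply: eq_bigr => a _.
by rewrite tpureZl tpureZr !scalerA mulrC.
Qed.

Lemma tpure_scal a m k b (U : 'M[G]_(a, m)) (X : 'M[C]_(m, k)) (Z : 'M[G]_(k, b)) p q :
  \sum_i tpure (U p i) ((scalmx G X *m Z) i q) =
  \sum_i tpure ((U *m scalmx G X) p i) (Z i q).
Proof.
under eq_bigr => i _ do rewrite scalmxl tpure_sumr.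
rewrite exchange_big; apply: eq_bigr => j _ /=.
rewrite scalmxr tpure_suml; apply: eq_bigr => i _.
by rewrite tpureZl tpureZr.
Qed.

(** The product [Y *m X] can be inserted between the two legs, being absorbed by the right leg in
    the first case and by the left leg in the second; its factors then complete the two compressed
    matrices. *)
Lemma corep_compress n k (u : 'M[G]_n) (X : 'M[C]_(k, n)) (Y : 'M[C]_(n, k)) :
    corep u -> scalmx G (Y *m X) *m u *m scalmx G Y = u *m scalmx G Y \/
      scalmx G X *m u *m scalmx G (Y *m X) = scalmx G X *m u ->
  corep (scalmx G X *m u *m scalmx G Y).
Proof.
move=> cu inv i j; rewrite comul_scal //.
case: inv => inv; last by rewrite -{1}inv scalmxM !mulmxA -tpure_scal -!mulmxA.
by rewrite -{1}inv scalmxM -!mulmxA tpure_scal !mulmxA.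
Qed.

(** Gram-Schmidt on a basis of the range of [T]: [Q *m Q^t*] is the orthogonal projection onto that
    range, while [T] itself may be oblique. *)
Lemma idempotent_isometry n (T : 'M[C]_n) : T *m T = T ->
  exists Q : 'M[C]_(n, \rank T),
    [/\ Q^t* *m Q = 1%:M, T *m Q = Q & Q *m Q^t* *m T = T].
Proof.
move=> TT; pose W := schmidt (row_base T^T).
have rT : \rank T^T = \rank T by rewrite mxrank_tr.
have WE : (W :=: T^T)%MS.
  by apply: eqmx_trans (eqmx_schmidt_free (row_base_free _)) (eq_row_base _).
have uW : W *m W^t* = 1%:M.
  by apply/unitarymxP/schmidt_unitarymx; rewrite rank_leq_col.
(* The orthonormal family is indexed by the rank of [T^T], so the claim is first proved with that
   index and then transported along [rT]. *)
suff [Q [QQ TQ QT]] : exists Q : 'M[C]_(n, \rank T^T),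
    [/\ Q^t* *m Q = 1%:M, T *m Q = Q & Q *m Q^t* *m T = T].
  by move: Q QQ TQ QT; rewrite rT => Q QQ TQ QT; exists Q.
exists W^T; have WW : (W^T)^t* *m W^T = 1%:M.
  by apply/trmx_inj; rewrite trmx_mul trmxK trmx1 -[RHS]uW; rewrite map_trmx.
split=> //.
  have /submxP[D ->] : (W <= T^T)%MS by rewrite WE.
  by rewrite trmx_mul trmxK mulmxA TT.
have /submxP[E eT] : (T^T <= W)%MS by rewrite WE.
have eT' : T = W^T *m E^T by apply/trmx_inj; rewrite trmx_mul !trmxK.
transitivity (W^T *m E^T); last exact: esym.
by rewrite [X in _ *m X = _]eT' !mulmxA -(mulmxA (W^T)) WW mulmx1.
Qed.

Definition ortho_sum n k l (Q : 'M[C]_(n, k)) (Q' : 'M[C]_(n, l)) : Prop :=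
  [/\ Q^t* *m Q = 1%:M, Q'^t* *m Q' = 1%:M, Q^t* *m Q' = 0, Q'^t* *m Q = 0 &
      Q *m Q^t* + Q' *m Q'^t* = 1%:M].

(** In the orthogonal decomposition along the range of [P], [u] is block triangular. The diagonal
    blocks have one-sided inverses, which are two-sided by finite dimension, and this forces the
    other off-diagonal block to vanish. *)
Lemma invariant_ortho_sum n (u : 'M[G]_n) (P : 'M[C]_n) :
    unitary_rep u -> P *m P = P -> P <> 0 -> P <> 1%:M ->
    u *m scalmx G P = scalmx G P *m u *m scalmx G P ->
  exists k l (Q : 'M[C]_(n, k)) (Q' : 'M[C]_(n, l)) (a : 'M[G]_k) (b : 'M[G]_l),
    [/\ (k < n)%N, (l < n)%N, ortho_sum Q Q', unitary_rep a /\ unitary_rep b &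
      u = scalmx G Q *m a *m scalmx G (Q^t*) + scalmx G Q' *m b *m scalmx G (Q'^t*)].
Proof.
move=> [u1 u2 cu] PP P0 P1 uP.
have [Q [QQ PQ QP]] := idempotent_isometry PP.
have hQ : (Q *m Q^t*)^t* = Q *m Q^t* by rewrite ctmxM trmxCK.
pose T := 1%:M - Q *m Q^t*.
have hT : T^t* = T.
  by rewrite /T linearB /= map_mxB hQ trmx1 map_mx1.
have TQ : T *m Q = 0 by rewrite mulmxBl mul1mx -mulmxA QQ mulmx1 subrr.
have TT : T *m T = T by rewrite {2}/T mulmxBr mulmx1 mulmxA TQ mul0mx subr0.
have [Q' [QQ' TQ' QT']] := idempotent_isometry TT.
have QtT : Q^t* *m T = 0 by rewrite -hT -ctmxM TQ trmx0 map_mx0.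
have QtQ' : Q^t* *m Q' = 0 by rewrite -TQ' mulmxA QtT mul0mx.
have Q'tQ : Q'^t* *m Q = 0.
  by rewrite -[Q]trmxCK -ctmxM QtQ' trmx0 map_mx0.
have sumQT : Q' *m Q'^t* = T.
  rewrite -[RHS]hT -[in RHS]QT' !ctmxM trmxCK hT mulmxA.
  by rewrite TQ'.
have sumQ : Q *m Q^t* + Q' *m Q'^t* = 1%:M by rewrite sumQT addrC subrK.
have rP : (\rank P < n)%N.
  rewrite ltn_neqAle rank_leq_row andbT; apply/negP => /eqP rP; apply: P1.
  have uP' : P \in unitmx by rewrite -row_free_unit /row_free rP.
  by rewrite -[LHS](mulKmx uP') PP mulVmx.
have rT : (\rank T < n)%N.
  rewrite ltn_neqAle rank_leq_row andbT; apply/negP => /eqP rT; apply: P0.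
  have uT : T \in unitmx by rewrite -row_free_unit /row_free rT.
  have T1 : T = 1%:M by rewrite -[LHS](mulKmx uT) TT mulVmx.
  by rewrite -QP -[Q]mul1mx -T1 TQ !mul0mx.
have uQ : scalmx G (Q *m Q^t*) *m u *m scalmx G Q = u *m scalmx G Q.
  have uQP : u *m scalmx G Q = scalmx G P *m (u *m scalmx G Q).
    by rewrite -{1}PQ scalmxM mulmxA uP -!mulmxA -scalmxM PQ.
  by rewrite -mulmxA uQP mulmxA -scalmxM QP.
pose a := scalmx G (Q^t*) *m u *m scalmx G Q.
pose b := scalmx G (Q'^t*) *m u *m scalmx G Q'.
have Q'uQ : scalmx G (Q'^t*) *m u *m scalmx G Q = 0.
  by rewrite -mulmxA -uQ !mulmxA -scalmxM mulmxA Q'tQ mul0mx scalmx0 !mul0mx.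
have adjE m (u' : 'M[G]_m) : adjmx u' = adjmxr u' by [].
have adja : adjmx a = scalmx G (Q^t*) *m adjmx u *m scalmx G Q.
  by rewrite !adjE !adjmxrM !adjmxr_scalmx trmxCK mulmxA.
have adjb : adjmx b = scalmx G (Q'^t*) *m adjmx u *m scalmx G Q'.
  by rewrite !adjE !adjmxrM !adjmxr_scalmx trmxCK mulmxA.
have aa : adjmx a *m a = 1%:M.
  rewrite adja /a !mulmxA -[_ *m scalmx G Q *m _]mulmxA -scalmxM.
  rewrite -!mulmxA [scalmx G (_ *m _) *m _]mulmxA uQ (mulmxA (adjmx u)) u1 mul1mx.
  by rewrite -scalmxM QQ scalmx1.
have bb : b *m adjmx b = 1%:M.
  have e : scalmx G (Q'^t*) *m u *m scalmx G (Q' *m Q'^t*) = scalmx G (Q'^t*) *m u.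
    by rewrite sumQT scalmxB scalmx1 mulmxBr mulmx1 scalmxM mulmxA Q'uQ mul0mx subr0.
  rewrite adjb /b !mulmxA -[_ *m scalmx G Q' *m _]mulmxA -scalmxM e.
  by rewrite -(mulmxA _ u) u2 mulmx1 -scalmxM QQ' scalmx1.
have aa' := mulmx1_comm aa; have bb' := mulmx1_comm bb.
(* Multiplied by the invertible [adjmx a], this block becomes, by unitarity of [u], minus a product
   with a factor adjoint to the block [Q'uQ], which is zero. *)
have c0 : scalmx G (Q^t*) *m u *m scalmx G Q' = 0.
  suff : adjmx a *m (scalmx G (Q^t*) *m u *m scalmx G Q') = 0.
    by move/(congr1 (mulmx a)); rewrite mulmxA aa' mul1mx mulmx0.
  have -> : adjmx a *m (scalmx G (Q^t*) *m u *m scalmx G Q') =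
      scalmx G (Q^t*) *m adjmx u *m scalmx G (1%:M - Q' *m Q'^t*) *m u *m scalmx G Q'.
    by rewrite adja -sumQ addrK scalmxM !mulmxA.
  rewrite scalmxB scalmx1 mulmxBr mulmx1 !mulmxBl.
  rewrite -(mulmxA _ (adjmx u)) u1 mulmx1 -scalmxM QtQ' scalmx0 sub0r.
  have : adjmxr (scalmx G (Q'^t*) *m u *m scalmx G Q) = 0.
    by rewrite Q'uQ; apply/matrixP => i j; rewrite !mxE star0.
  rewrite !adjmxrM !adjmxr_scalmx trmxCK !mulmxA => e.
  by rewrite scalmxM !mulmxA e !mul0mx oppr0.
exists (\rank P), (\rank T), Q, Q', a, b; split=> //.
  split; split=> //.
    by apply: corep_compress => //; left.
  apply: corep_compress => //; right.
  by rewrite sumQT scalmxB scalmx1 mulmxBr mulmx1 scalmxM mulmxA Q'uQ mul0mx subr0.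
transitivity (scalmx G (Q *m Q^t* + Q' *m Q'^t*) *m u *m scalmx G (Q *m Q^t* + Q' *m Q'^t*)).
  by rewrite sumQ scalmx1 mul1mx mulmx1.
rewrite !scalmxD !mulmxDl !mulmxDr !scalmxM.
have -> : scalmx G Q *m scalmx G (Q ^t*) *m u *m (scalmx G Q' *m scalmx G (Q' ^t*)) = 0.
  rewrite -!mulmxA !(mulmxA (scalmx G (Q^t*))) (mulmxA _ _ (scalmx G (Q'^t*))).
  by rewrite c0 mul0mx mulmx0.
have -> : scalmx G Q' *m scalmx G (Q' ^t*) *m u *m (scalmx G Q *m scalmx G (Q ^t*)) = 0.
  rewrite -!mulmxA !(mulmxA (scalmx G (Q'^t*))) (mulmxA _ _ (scalmx G (Q^t*))).
  by rewrite Q'uQ mul0mx mulmx0.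
by rewrite addr0 add0r /a /b !mulmxA.
Qed.

(** Strong induction on the dimension. Dimension 0 is a separate case because irreducible
    representations have positive dimension. *)
Lemma unitary_rep_ind (K : forall n, 'M[G]_n -> Prop) :
    (forall u : 'M[G]_0, K 0%N u) ->
    (forall n (u : 'M[G]_n), irreducible_rep u -> K n u) ->
    (forall n k l (Q : 'M[C]_(n, k)) (Q' : 'M[C]_(n, l)) (a : 'M[G]_k) (b : 'M[G]_l),
      ortho_sum Q Q' -> K k a -> K l b ->
      K n (scalmx G Q *m a *m scalmx G (Q^t*) + scalmx G Q' *m b *m scalmx G (Q'^t*))) ->
  forall n (u : 'M[G]_n), unitary_rep u -> K n u.
Proof.
move=> K0 Kirr Ksum n; have [m] := ubnP n; elim: m n => // m IH n nm u uu.
have [n0|npos] := posnP n; first by move: u {uu}; rewrite n0.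
have [iu|niu] := pselect (irreducible_rep u); first exact: Kirr.
have [P [PP uP P0 P1]] : exists P : 'M[C]_n, [/\ P *m P = P,
    u *m scalmx G P = scalmx G P *m u *m scalmx G P, P <> 0 & P <> 1%:M].
  apply: contrapT => nP; apply: niu; split=> // P PP uP.
  have [->|/eqP P0] := eqVneq P 0; first by left.
  have [->|/eqP P1] := eqVneq P 1%:M; first by right.
  by case: nP; exists P.
have [k [l [Q [Q' [a [b [kn ln oQ [ua ub] ->]]]]]]] :=
  invariant_ortho_sum uu PP P0 P1 uP.
apply: Ksum => //; apply: IH => //; exact: leq_trans (_ : _ < n)%N _.
Qed.

End Representations.

(** * The antipode *)

Section Antipode.
Variables (R : realType) (G : finQuantumGroup R) (I : irr_reps G) (S : G -> G).
Local Notation C := R[i].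
Local Open Scope sesquilinear_scope.
Hypothesis hS : is_antipode I S.

Let lS : linear S. Proof. by case: hS. Qed.

Lemma irr_rep_similar n (u : 'M[G]_n) : irreducible_rep u ->
  exists (a : I) (T : 'M[C]_(irr_dim a, n)) (T' : 'M[C]_(n, irr_dim a)),
    [/\ T *m T' = 1%:M, T' *m T = 1%:M &
        u = scalmx G T' *m irr_rep a *m scalmx G T].
Proof.
move=> /(@irr_complete _ _ I)[a [T [T' [TT' T'T e]]]]; exists a, T, T'; split=> //.
by rewrite -mulmxA -e mulmxA -scalmxM T'T scalmx1 mul1mx.
Qed.

(** The antipode is prescribed on the chosen representatives only, and the intertwiner to an
    arbitrary irreducible [u] need not be unitary. Still [S] turns [u] into a left inverse of [u],
    which must be its adjoint. *)
Lemma antipode_unitary_rep n (u : 'M[G]_n) : unitary_rep u -> map_mx S u = adjmx u.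
Proof.
move: n u; apply: unitary_rep_ind.
- by move=> u; apply/matrixP => -[].
- move=> n u iu; have [_ [_ uu _] _] := iu.
  have [a [T [T' [TT' T'T e]]]] := irr_rep_similar iu.
  have [_ [w1 _ _] _] := irr_irreducible a; set w := irr_rep a in e w1.
  have Sw : map_mx S w = adjmx w.
    by apply/matrixP => i j; rewrite !mxE; case: hS => _ _; apply.
  have Su : map_mx S u *m u = 1%:M.
    rewrite {1}e map_scalmxr // map_scalmxl // Sw e -!mulmxA.
    rewrite (mulmxA (scalmx G T)) -scalmxM TT' scalmx1 mul1mx.
    by rewrite (mulmxA (adjmx w)) w1 mul1mx -scalmxM T'T scalmx1.
  by rewrite -[LHS]mulmx1 -uu mulmxA Su mul1mx.
- move=> n k l Q Q' a b oQ Sa Sb.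
  have addS m p (x y : 'M[G]_(m, p)) : map_mx S (x + y) = map_mx S x + map_mx S y.
    by apply/matrixP => i j; rewrite !mxE (linD lS).
  have adjE m (u' : 'M[G]_m) : adjmx u' = adjmxr u' by [].
  rewrite addS !map_scalmxr // !map_scalmxl // Sa Sb [RHS]adjE adjmxrD.
  by rewrite !adjmxrM !adjmxr_scalmx !trmxCK !mulmxA.
Qed.

End Antipode.

(** * Unitarity of the regular representation and properties of the antipode *)

Section RegularRepresentation.
Variables (R : realType) (G : finQuantumGroup R) (h : G -> R[i]).
Local Notation C := R[i].
Local Open Scope sesquilinear_scope.
Hypothesis hh : is_haar h.

Let ph : posfun h := posfun_state hh.1.
Let lh : scalar h := ph.1.

(** Invariance of [h] at [star (e i) * e j] contracts, by orthonormality, to the entries of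
    [adjmx v *m v]. The entrywise adjoint is handled with the family [star (e i)], orthonormal
    because [h] is a trace. *)
Lemma coefmx_unitary n (e : 'I_n -> G) : onb h e ->
  unitary_rep (coefmx e (fun i x => h (star (e i) * x))) /\
  unitary_rep (map_mx star (coefmx e (fun i x => h (star (e i) * x)))).
Proof.
move=> oe; have fr := onb_frame lh oe; have dual := oe.1.
set v := coefmx _ _; have cv : corep v := comul_coefmx fr dual.
have ce j : comul (e j) = \sum_i tpure (e i) (v i j) := comul_coef fr j.
have contract (F : 'I_n -> 'I_n -> G) (x : 'I_n -> 'I_n -> G) :
    (forall k l, h (x k l) = (k == l)%:R) ->
    tlift (fun a b => h a *: b) (\sum_k \sum_l tpure (x k l) (F k l)) = \sum_k F k k.
  move=> xE; rewrite pair_big tlift_sum; last exact: bilin_slicel.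
  rewrite -(pair_bigA _ (fun k l => h (x k l) *: F k l)); apply: eq_bigr => k _.
  rewrite (bigD1 k) //= xE eqxx scale1r big1 ?addr0 // => l nl.
  by rewrite xE eq_sym (negPf nl) scale0r.
have v1 : adjmx v *m v = 1%:M.
  apply/matrixP => i j; rewrite mxE.
  have := (hh.2 (star (e i) * e j)).1.
  rewrite /slicel (comul_starM (ce i) (ce j)) contract // dual => e1.
  transitivity (\sum_k star (v k i) * v k j).
    by apply: eq_bigr => k _; rewrite !mxE.
  by rewrite e1 !mxE; case: (i == j); rewrite ?scale1r ?scale0r.
have cs j : comul (star (e j)) = \sum_i tpure (star (e i)) (star (v i j)).
  by rewrite comul_star ce tstar_sum.
have cb : corep (map_mx star v).
  move=> i j; rewrite mxE comul_star cv tstar_sum.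
  by apply: eq_bigr => k _; rewrite !mxE.
have v2 : adjmx (map_mx star v) *m map_mx star v = 1%:M.
  apply/matrixP => i j; rewrite mxE.
  have := (hh.2 (star (star (e i)) * star (e j))).1.
  have dual' k l : h (star (star (e k)) * star (e l)) = (k == l)%:R.
    by rewrite starK (haar_trace hh) dual eq_sym.
  rewrite /slicel (comul_starM (cs i) (cs j)) contract // dual' => e1.
  transitivity (\sum_k star (star (v k i)) * star (v k j)).
    by apply: eq_bigr => k _; rewrite !mxE.
  by rewrite e1 !mxE; case: (i == j); rewrite ?scale1r ?scale0r.
by split; split=> //; apply: mulmx1_comm.
Qed.

(** The coefficients span: by the density axiom [1 (x) x] is a sum of terms [Delta(a)(b (x) 1)], and
    slicing the first leg by [h] leaves combinations of coefficients. *)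
Lemma coefmx_span_ind n (e : 'I_n -> G) (K : G -> Prop) : onb h e ->
    K 0 -> (forall a x y, K x -> K y -> K (a *: x + y)) ->
    (forall i j, K (coefmx e (fun i x => h (star (e i) * x)) i j)) ->
  forall x, K x.
Proof.
move=> oe K0 Klin Kv x; set v := coefmx _ _ in Kv.
have fr := onb_frame lh oe.
have Ksum (J : Type) (r : seq J) (P : pred J) (F : J -> G) :
    (forall i, K (F i)) -> K (\sum_(i <- r | P i) F i).
  move=> KF; apply: (big_ind K) => // y z Ky Kz.
  by rewrite -[y]scale1r; exact: Klin.
have KZ a y : K y -> K (a *: y) by move=> Ky; rewrite -[_ *: _]addr0; exact: Klin.
have [s es] := comul_denser (tpure 1 x).
have [bl br] := bilin_slicel G lh.
have -> : x = tlift (fun a b => h a *: b) (tpure 1 x : tens G G).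
  rewrite tlift_tpure //; have [_ _ ->] := hh.1; by rewrite scale1r.
rewrite es (lin_sum (@tlift_linear _ _ _ _ _)); apply: (Ksum) => -[a b] /=.
rewrite [a](onb_expand oe) (comul_lincomb fr).
have -> : tpure b 1 = \sum_(k <- [:: tt]) tpure b 1 :> tens G G by rewrite big_seq1.
rewrite tmul_sum.
under eq_bigr => i _ do rewrite big_seq1 mulr1.
rewrite tlift_sum; last exact: bilin_slicel.
apply: (Ksum) => i; apply: (KZ).
by apply: (Ksum) => j; apply: (KZ).
Qed.

Variables (I : irr_reps G) (S : G -> G).
Hypothesis hS : is_antipode I S.
Let lS : linear S. Proof. by case: hS. Qed.

(** On a coefficient [v i j] of the regular representation, [S] gives the adjoint of [v j i], and on
    the adjoint of [v i j] it gives [v j i]. *)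
Lemma antipode_star x : S (star x) = star (S x).
Proof.
have [e oe] := exists_onb ph (haar_faithful hh).
have [uv ub] := coefmx_unitary oe.
apply: (coefmx_span_ind (K := fun x => S (star x) = star (S x)) oe).
- by rewrite star0 (lin0 lS) star0.
- by move=> a y z Ky Kz; rewrite starD starZ !lS Ky Kz starD starZ.
- move=> i j; have /matrixP/(_ i j) := antipode_unitary_rep hS ub.
  have /matrixP/(_ i j) := antipode_unitary_rep hS uv.
  by rewrite !mxE => -> ->; rewrite !starK.
Qed.

Lemma antipodeK x : S (S x) = x.
Proof.
have [e oe] := exists_onb ph (haar_faithful hh).
have [uv ub] := coefmx_unitary oe.
apply: (coefmx_span_ind (K := fun x => S (S x) = x) oe).
- by rewrite !(lin0 lS).
- by move=> a y z Ky Kz; rewrite !lS Ky Kz.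
- move=> i j; have /matrixP/(_ i j) := antipode_unitary_rep hS uv.
  rewrite !mxE => ->; have /matrixP/(_ j i) := antipode_unitary_rep hS ub.
  by rewrite !mxE starK.
Qed.

Lemma posfun_antipode f : posfun f -> posfun (f \o S).
Proof.
move=> [lf pf]; have [_ mS _] := hS; split=> [a x y|x] /=; first by rewrite lS lf.
by rewrite mS antipode_star; have := pf (star (S x)); rewrite starK.
Qed.

Lemma map_antipode n (u : 'M[G]_n) (f : G -> C) : posfun f -> unitary_rep u ->
  map_mx (f \o S) u = (map_mx f u)^t*.
Proof.
move=> pf uu; have /matrixP Su := antipode_unitary_rep hS uu.
apply/matrixP => i j; have := Su i j; rewrite !mxE /= => ->.
exact: posfun_star.
Qed.

Lemma antipode1 : S 1 = 1.
Proof.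
have [_ mS _] := hS.
by rewrite -[LHS]mul1r -[X in X * _]antipodeK -mS mul1r antipodeK.
Qed.

Lemma haar_rep n (u : 'M[G]_n) : corep u ->
  scalmx G (map_mx h u) *m u = scalmx G (map_mx h u) /\
  u *m scalmx G (map_mx h u) = scalmx G (map_mx h u).
Proof.
move=> cu; split; apply/matrixP => i j; rewrite ?scalmxl ?scalmxr !mxE.
  rewrite -[RHS]/((h (u i j))%:A) -(hh.2 (u i j)).1 /slicel cu tlift_sum; last exact: bilin_slicel.
  by apply: eq_bigr => k _; rewrite mxE.
rewrite -[RHS]/((h (u i j))%:A) -(hh.2 (u i j)).2 /slicer cu tlift_sum; last exact: bilin_slicer.
by apply: eq_bigr => k _; rewrite mxE.
Qed.

(** With [H] the value of [h] on the regular representation [v], invariance and unitarity give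
    [H v^* = H]. Applying [h] gives [H = H H^*], so [H] is self-adjoint, which is the claim on
    coefficients. *)
Lemma haar_antipode x : h (S x) = h x.
Proof.
have [e oe] := exists_onb ph (haar_faithful hh).
have [uv ub] := coefmx_unitary oe.
apply: (coefmx_span_ind (K := fun x => h (S x) = h x) oe).
- by rewrite (lin0 lS).
- by move=> a y z Ky Kz; rewrite !lS !lh Ky Kz.
- set v := coefmx _ _ in uv *; have [v1 v2 cv] := uv; set H := map_mx h v.
  have [Hv vH] := haar_rep cv.
  have HS : map_mx h (map_mx S v) = H^t*.
    by rewrite -(map_antipode ph uv); apply/matrixP => i j; rewrite !mxE.
  have e1 : H = H *m H^t*.
    have : scalmx G H *m adjmx v = scalmx G H by rewrite -{1}Hv -mulmxA v2 mulmx1.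
    move/(congr1 (map_mx h)); rewrite map_scalmxl_scalar //.
    rewrite -(antipode_unitary_rep hS uv) HS => ->.
    apply/matrixP => i j; rewrite !mxE (scalZ lh); have [_ _ ->] := hh.1.
    by rewrite mulr1.
  have e2 : H^t* = H by rewrite e1 ctmxM trmxCK.
  by move=> i j; have /matrixP/(_ i j) := HS; rewrite e2 !mxE.
Qed.

(** The antipode reverses the legs of the comultiplication; this reduces right convolutions to left
    ones. *)
Lemma slicel_antipode f x : scalar f -> slicel f x = S (slicer (f \o S) (S x)).
Proof.
move=> lf; have [e oe] := exists_onb ph (haar_faithful hh).
have [uv ub] := coefmx_unitary oe.
apply: (coefmx_span_ind (K := fun x => slicel f x = S (slicer (f \o S) (S x))) oe).
- by rewrite (lin0 lS) !(lin0 (slicer_linear _)) (lin0 (slicel_linear _)) (lin0 lS).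
- move=> a y z Ky Kz; rewrite (slicel_linear f) Ky Kz lS (slicer_linear _).
  by rewrite lS.
- set v := coefmx _ _ in uv *; have [v1 v2 cv] := uv => i j.
  have Sv k l : S (v k l) = star (v l k).
    by have /matrixP/(_ k l) := antipode_unitary_rep hS uv; rewrite !mxE.
  rewrite Sv /slicel /slicer comul_star !cv tstar_sum !tlift_sum.
  + rewrite (lin_sum lS); apply: eq_bigr => k _.
    by rewrite (linZ lS) /= -!Sv !antipodeK.
  + by apply: bilin_slicer => a y z /=; rewrite lS lf.
  + exact: bilin_slicel.
Qed.

End RegularRepresentation.

(** * Functional calculus and noncommutative norms *)

Section RealInequalities.
Variable R : realType.
Implicit Types s q : R.

(** Strict concavity of the power. With [l = ln s], the strict tangent inequalities of the
    exponential at [(1 - q) * l] and [- (q * l)], with weights [q] and [1 - q], are added and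
    multiplied by [expR (q * l)]. *)
Lemma powR_tangent_lt s q : 0 <= s -> s != 1 -> 0 < q < 1 ->
  powR s q < 1 + q * (s - 1).
Proof.
move=> s0 s1 /andP[q0 q1]; have [->|sn0] := eqVneq s 0.
  by rewrite powR0 ?gt_eqF //; lra.
have sp : 0 < s by rewrite lt_def sn0.
rewrite /powR (negPf sn0); set l := ln s.
have l0 : l != 0 by rewrite ln_eq0.
have sE : s = expR l by rewrite lnK.
have e1 : 1 + (1 - q) * l < expR ((1 - q) * l).
  by rewrite expR_gt1Dx // mulf_neq0 // subr_eq0 gt_eqF.
have e2 : 1 + - (q * l) < expR (- (q * l)).
  by rewrite expR_gt1Dx // oppr_eq0 mulf_neq0 // gt_eqF.
have key : 1 < q * expR ((1 - q) * l) + (1 - q) * expR (- (q * l)).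
  have q1' : 0 < 1 - q by lra.
  have e1' : q * (1 + (1 - q) * l) < q * expR ((1 - q) * l) by rewrite ltr_pM2l.
  have e2' : (1 - q) * (1 + - (q * l)) < (1 - q) * expR (- (q * l)).
    by rewrite ltr_pM2l.
  have : q * (1 + (1 - q) * l) + (1 - q) * (1 + - (q * l)) = 1 by ring.
  lra.
rewrite -(ltr_pM2l (expR_gt0 (q * l))) mulr1 mulrDr in key.
apply: lt_le_trans key _.
rewrite mulrCA -expRD [X in _ + X]mulrCA -expRD.
have -> : q * l + (1 - q) * l = l by ring.
by rewrite subrr expR0 -sE; lra.
Qed.

Lemma powR_tangent_le s q : 0 <= s -> 0 < q < 1 -> powR s q <= 1 + q * (s - 1).
Proof.
move=> s0 q01; have [->|s1] := eqVneq s 1; last exact: ltW (powR_tangent_lt _ _ _).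
by rewrite powR1 subrr mulr0 addr0.
Qed.

(** Factor out [s], bound the exponential of [- (1 - q) * ln s] below by its tangent, and use
    [ln s <= s - 1]. *)
Lemma powR_ge_quadratic s q : 0 <= s -> 0 < q < 1 ->
  s - (1 - q) * (s ^+ 2 - s) <= powR s q.
Proof.
move=> s0 /andP[q0 q1]; have [->|sn0] := eqVneq s 0.
  by rewrite powR0 ?gt_eqF // expr0n /= subrr mulr0 subrr.
have sp : 0 < s by rewrite lt_def sn0.
rewrite /powR (negPf sn0); set l := ln s.
have sE : s = expR l by rewrite lnK.
have -> : expR (q * l) = s * expR (- ((1 - q) * l)).
  by rewrite {1}sE -expRD; congr expR; ring.
have -> : s - (1 - q) * (s ^+ 2 - s) = s * (1 - (1 - q) * (s - 1)) by ring.
rewrite ler_pM2l //.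
have e1 := expR_ge1Dx (- ((1 - q) * l)).
have e2 : l <= s - 1 by have := expR_ge1Dx l; rewrite -sE; lra.
apply: le_trans e1; rewrite lerD2l lerN2 ler_wpM2l //; lra.
Qed.

End RealInequalities.

(** * Functional calculus in an eigenbasis, and comparison of norms *)

Section SpectralCalculus.
Variables (R : realType) (A : finCstarAlg R) (h : A -> R[i]).
Local Notation C := R[i].
Local Notation N := (\dim {:A}).
Local Open Scope sesquilinear_scope.
Hypotheses (ph : posfun h) (fh : faithful h) (h1 : h 1 = 1).

Let lh : scalar h := ph.1.

(** Left multiplication by a self-adjoint [a] is Hermitian for the inner product of [h], so the
    spectral theorem gives an orthonormal eigenbasis. *)
Lemma sa_diagonal (a : A) : star a = a ->
  exists (e : 'I_N -> A) (l : 'I_N -> C),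
    onb h e /\ forall i, a * e i = l i *: e i.
Proof.
move=> sa; have [f of_] := exists_onb ph fh.
pose M : 'M[C]_N := \matrix_(i, j) h (star (f i) * (a * f j)).
have aE w : a * lincomb f w = lincomb f (M *m w).
  rewrite [LHS](onb_expand of_); congr lincomb; apply/colP => i.
  rewrite mxE mulr_sumr mulr_sumr (scal_sum lh) [RHS]mxE.
  by apply: eq_bigr => j _; rewrite -!scalerAr (scalZ lh) mxE mulrC.
have hM : M^t* = M.
  apply/matrixP => i j; rewrite !mxE -(posfun_star ph) !starM starK sa.
  by rewrite mulrA.
have /orthomx_spectralP : M \is normalmx by apply/normalmxP; rewrite hM.
set P := spectralmx M; set d := spectral_diag M => eM.
have uP : P \is unitarymx by exact: spectral_unitarymx.
clearbody P d.
have PP' : P *m P^t* = 1%:M by apply/unitarymxP.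
have P'P : P^t* *m P = 1%:M.
  by rewrite -invmx_unitary // mulVmx ?unitarymx_unit.
exists (fun i => lincomb f (col i (P^t*))), (fun i => d 0 i); split.
  apply: onb_intro => // [i j|x].
    rewrite (onb_dot _ _ lh of_) /hdot.
    have := PP'; move/matrixP/(_ i j); rewrite [RHS]mxE => <-.
    rewrite !mxE; apply: eq_bigr => k _; rewrite !mxE; congr (_ * _).
    by rewrite conjCK.
  exists (P *m \col_i h (star (f i) * x)).
  rewrite [LHS](onb_expand of_) -[X in lincomb f X]mul1mx -P'P -mulmxA.
  set w := P *m _; rewrite /lincomb.
  under [RHS]eq_bigr => i _ do rewrite scaler_sumr.
  rewrite exchange_big; apply: eq_bigr => j _ /=; rewrite mxE scaler_suml.
  apply: eq_bigr => i _; rewrite !scalerA mulrC; congr (_ * _ *: _).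
  by rewrite [RHS]mxE.
move=> i; rewrite aE eM (invmx_unitary uP) -!mulmxA.
have -> : P *m col i (P^t*) = delta_mx i 0.
  by rewrite colE mulmxA PP' mul1mx.
have -> : diag_mx d *m delta_mx i (0 : 'I_1) = d 0 i *: delta_mx i 0.
  apply/colP => j; rewrite mul_diag_mx !mxE.
  by have [->|] := eqVneq j i; rewrite ?andbF ?mulr0.
rewrite -scalemxAr -colE scaler_sumr; apply: eq_bigr => j _.
by rewrite scalerA mxE.
Qed.

Section Diagonal.
Variables (e : 'I_N -> A) (a : A) (l : 'I_N -> C).
Hypotheses (oe : onb h e) (ae : forall i, a * e i = l i *: e i).

Lemma onb_neq0 i : e i != 0.
Proof.
apply/eqP => e0; have := oe.1 i i; rewrite e0 mulr0 (scal0 lh) eqxx.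
by move/esym/eqP; rewrite oner_eq0.
Qed.

Lemma mul_diag w : a * lincomb e w = \sum_i (l i * w i 0) *: e i.
Proof.
rewrite mulr_sumr; apply: eq_bigr => i _.
by rewrite -scalerAr ae scalerA mulrC.
Qed.

Lemma spectrum_diag c : spectrum a c <-> exists i, l i = c.
Proof.
split; last first.
  move=> [i <-]; apply/negP => u; move: (onb_neq0 i); apply/negP; rewrite negbK.
  have : (a - (l i)%:A) * e i = 0.
    by rewrite mulrBl ae -scalerAl mul1r subrr.
  by move/(congr1 (fun y => (a - (l i)%:A)^-1 * y)); rewrite mulKr // mulr0 => ->.
rewrite /spectrum /= => /negP nu; apply: contrapT => ne; apply: nu; set b := a - c%:A.
have b0 x : b * x = 0 -> x = 0.
  rewrite [x](onb_expand oe); set w := \col_i _; rewrite mulrBl mul_diag.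
  rewrite -scalerAl mul1r scaler_sumr -sumrB => e0.
  have w0 i : w i 0 = 0.
    have : lincomb e (\col_i ((l i - c) * w i 0)) = lincomb e 0.
      rewrite /lincomb [RHS]big1 => [|j _]; last by rewrite mxE scale0r.
      rewrite -[RHS]e0; apply: eq_bigr => j _.
      by rewrite !mxE scalerA -scalerBl mulrBl.
    move/(lincomb_inj lh oe)/colP/(_ i); rewrite !mxE => /eqP.
    rewrite mulf_eq0 subr_eq0 => /orP[/eqP li|/eqP //].
    by case: ne; exists i.
  by rewrite /lincomb big1 // => i _; rewrite w0 scale0r.
have lb : linear (fun x => b * x).
  by move=> k x y; rewrite mulrDr -scalerAr.
have [y by1] := inj_linear_surj lb b0 1.
apply/unitrP; exists y; split=> //.
apply/eqP; rewrite -subr_eq0; apply/eqP/b0.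
by rewrite mulrBr mulrA by1 mul1r mulr1 subrr.
Qed.

Lemma horner_diag (P : {poly C}) i : horner_alg a P * e i = P.[l i] *: e i.
Proof.
elim/poly_ind: P => [|P c IH]; first by rewrite rmorph0 mul0r horner0 scale0r.
rewrite rmorphD rmorphM /= horner_algX horner_algC mulrDl -mulrA ae.
rewrite -scalerAr IH hornerMXaddC scalerDl -scalerAl mul1r scalerA.
by rewrite [l i * _]mulrC.
Qed.

(** The weights are the squared moduli of the coordinates of 1: [h] is the vector state of 1. *)
Lemma haar_diag : h a = \sum_i l i * `|h (e i)| ^+ 2.
Proof.
rewrite -[X in h X]mulr1 [X in a * X](onb_expand oe) mul_diag (scal_sum lh).
apply: eq_bigr => i _; rewrite (scalZ lh) mxE mulr1 (posfun_star ph) -mulrA.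
by rewrite normCK [_^* * _]mulrC.
Qed.

End Diagonal.

Lemma poly_interpolation (K : fieldType) (f : K -> K) (s : seq K) :
  exists P : {poly K}, forall x, x \in s -> P.[x] = f x.
Proof.
elim: s => [|c s [P PE]]; first by exists 0.
have [cs|ncs] := boolP (c \in s).
  by exists P => x; rewrite inE => /orP[/eqP ->|]; apply: PE.
pose Q := \prod_(a <- s) ('X - a%:P).
have Qc : Q.[c] != 0 by rewrite -[_ == 0]/(root Q c) root_prod_XsubC.
exists (P + ((f c - P.[c]) / Q.[c]) *: Q) => x; rewrite inE hornerD hornerZ.
have [->|_ /= xs] := eqVneq x c; first by rewrite divfK // addrC subrK.
have /eqP -> : Q.[x] == 0 by rewrite -[_ == 0]/(root Q x) root_prod_XsubC.
by rewrite mulr0 addr0 PE.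
Qed.

Lemma fcalc_diag (e : 'I_N -> A) a l (f : C -> C) : onb h e ->
  (forall i, a * e i = l i *: e i) -> forall i, fcalc f a * e i = f (l i) *: e i.
Proof.
move=> oe ae i.
have [P PE] := poly_interpolation f [seq l i | i <- enum 'I_N].
have : exists b, [set b : A | exists2 P : {poly C},
    forall c, spectrum a c -> P.[c] = f c & b = horner_alg a P] b.
  exists (horner_alg a P), P => // c /(spectrum_diag oe ae)[j <-].
  by apply: PE; apply: map_f; rewrite mem_enum.
(* An admissible value exists, so [xget] does not return its default 0; any polynomial it selects
   has the right values at the eigenvalues. *)
move/xgetPex => /(_ 0)[Q QE]; rewrite /fcalc => ->.
by rewrite (horner_diag ae) QE //; apply/(spectrum_diag oe ae); exists i.
Qed.

(** The squared norm of [L^2(h)], as a real number. *)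
Definition nrm2 (x : A) : R := complex.Re (h (star x * x)).

Lemma nrm2E x : h (star x * x) = (nrm2 x)%:C%C.
Proof. by rewrite /nrm2 RRe_real // ger0_real // ph.2. Qed.

Lemma nrm2_ge0 x : 0 <= nrm2 x.
Proof. by have := ph.2 x; rewrite nrm2E ler0c. Qed.

Lemma nrm2_eq0 x : nrm2 x = 0 -> x = 0.
Proof. by move=> x0; apply: fh; rewrite nrm2E x0. Qed.

(** The [l i] are the eigenvalues of [star x * x], with the weights of [h] as a vector state. The
    same data serve every [p], so noncommutative norms become weighted finite sums. *)
Lemma lpnorm_spectral x : exists (w l : 'I_N -> R),
  [/\ forall i, 0 <= w i, forall i, 0 <= l i,
      \sum_i w i = 1, \sum_i w i * l i = nrm2 x /\
      \sum_i w i * l i ^+ 2 = nrm2 (star x * x) &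
      forall p, lpnorm h p x = powR (\sum_i w i * powR (l i) (p / 2)) p^-1].
Proof.
set a := star x * x; have sa : star a = a by rewrite starM starK.
have [e [l [oe ae]]] := sa_diagonal sa.
pose lr i := complex.Re (l i); pose w i := Normc.normc (h (e i)) ^+ 2.
have wE i : `|h (e i)| ^+ 2 = (w i)%:C%C by rewrite rmorphXn.
have l0 i : 0 <= l i.
  have -> : l i = h (star (x * e i) * (x * e i)).
    rewrite starM -mulrA (mulrA (star x)) ae -scalerAr (scalZ lh) oe.1 eqxx.
    by rewrite mulr1.
  exact: ph.2.
have lE i : l i = (lr i)%:C%C by rewrite RRe_real // ger0_real.
have lr0 i : 0 <= lr i by have := l0 i; rewrite lE ler0c.
have hE b m : (forall i, b * e i = (m i)%:C%C *: e i) ->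
    h b = (\sum_i w i * m i)%:C%C.
  move=> be; rewrite (haar_diag oe be) rmorph_sum; apply: eq_bigr => i _ /=.
  by rewrite wE -rmorphM mulrC.
exists w, lr; split=> //.
- by move=> i; exact: sqr_ge0.
- have := hE 1 (fun=> 1); rewrite h1 => /(_ _)/esym e1.
  have /complexI : (\sum_i w i * 1)%:C%C = 1%:C%C :> C.
    by rewrite e1 // => i; rewrite mul1r scale1r.
  by under eq_bigr do rewrite mulr1.
- split; apply: complexI; rewrite -nrm2E.
    by rewrite -/a -(hE a lr) // => i; rewrite ae lE.
  rewrite sa -(hE (a * a) (fun i => lr i ^+ 2)) // => i.
  by rewrite -mulrA ae -scalerAr ae lE scalerA -rmorphM -expr2.
- move=> p; rewrite /lpnorm; congr (powR _ _).
  have be i : cabs x * e i = (powR (lr i) 2^-1)%:C%C *: e i.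
    by rewrite /cabs /cpow -/a (fcalc_diag _ oe ae) lE.
  rewrite (hE (cpow (cabs x) p) (fun i => powR (lr i) (p / 2))) // => i.
  by rewrite /cpow (fcalc_diag _ oe be) /= -powRrM mulrC.
Qed.

Lemma nrm2_mul_le z y : nrm2 (z * y) <= cnorm z ^+ 2 * nrm2 y.
Proof.
set a := star z * z; have sa : star a = a by rewrite starM starK.
have [e [l [oe ae]]] := sa_diagonal sa.
have l0 i : 0 <= l i.
  have -> : l i = h (star (z * e i) * (z * e i)).
    rewrite starM -mulrA (mulrA (star z)) ae -scalerAr (scalZ lh) oe.1 eqxx.
    by rewrite mulr1.
  exact: ph.2.
have ln i : l i <= (cnorm z ^+ 2)%:C%C.
  rewrite -(ger0_norm (l0 i)) -cnorm_star -/a lecR.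
  by rewrite -(ler_pM2r (cnorm_gt0 (onb_neq0 oe i))) -cnormZ -ae cnormM.
rewrite -lecR rmorphM /= -!nrm2E starM -mulrA (mulrA (star z)) -/a.
set w := \col_i h (star (e i) * y); have yE : y = lincomb e w := onb_expand oe y.
have -> : a * y = lincomb e (\col_i (l i * w i 0)).
  by rewrite {1}yE (mul_diag ae); apply: eq_bigr => i _; rewrite !mxE.
rewrite {1 2 3}yE !(onb_dot _ _ lh oe) !hdotE mulr_sumr ler_sum // => i _.
rewrite [X in _ * X <= _]mxE mulrCA; apply: ler_wpM2r => //.
by rewrite mulrC -normCK exprn_ge0.
Qed.

Lemma nrm2_le_cnorm x : nrm2 x <= cnorm x ^+ 2.
Proof.
have := nrm2_mul_le x 1; rewrite mulr1.
have -> : nrm2 1 = 1 by rewrite /nrm2 starA1 mulr1 h1.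
by rewrite mulr1.
Qed.

Lemma cnorm_le_nrm2 : exists2 K, 0 <= K & forall x, cnorm x ^+ 2 <= K * nrm2 x.
Proof.
have [e oe] := exists_onb ph fh.
have s0 : 0 <= \sum_i cnorm (e i) by apply: sumr_ge0 => i _; exact: cnorm_ge0.
exists ((\sum_i cnorm (e i)) ^+ 2); first exact: sqr_ge0.
move=> x; rewrite -[nrm2 x]sqr_sqrtr ?nrm2_ge0 // -exprMn.
rewrite ler_pXn2r ?nnegrE ?cnorm_ge0 ?mulr_ge0 ?sqrtr_ge0 //.
set w := \col_i h (star (e i) * x); have xE : x = lincomb e w := onb_expand oe x.
have -> : cnorm x = cnorm (lincomb e w) by rewrite -xE.
apply: (@le_trans _ _ (\sum_i cnorm (w i 0 *: e i))).
  rewrite /lincomb; elim/big_rec2: _ => [|i y1 y2 _ le12]; first by rewrite cnorm0.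
  by apply: le_trans (cnormD _ _) _; rewrite lerD2l.
rewrite mulr_suml ler_sum // => i _; rewrite cnormZ mulrC ler_wpM2l ?cnorm_ge0 //.
have nw : 0 <= Normc.normc (w i 0) by case: (w i 0) => *; exact: sqrtr_ge0.
rewrite -(@ler_pXn2r _ 2) ?nnegrE ?sqrtr_ge0 //.
rewrite sqr_sqrtr ?nrm2_ge0 //.
rewrite -lecR -nrm2E {1 2}xE (onb_dot _ _ lh oe) hdotE rmorphXn /= -/(`|w i 0|).
rewrite normCK mulrC (bigD1 i) //= lerDl sumr_ge0 // => j _.
by rewrite mulrC -normCK exprn_ge0.
Qed.

End SpectralCalculus.

(** * Improving convolution operators *)

(** Equality case of Jensen's inequality: after division by [m], the nonnegative slacks of the
    tangent bound sum to zero, so [l i = m] wherever [w i] is nonzero. *)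
Lemma powR_mean_extremal (R : realType) n (m q : R) (w l : 'I_n -> R) :
    (forall i, 0 <= w i) -> (forall i, 0 <= l i) -> \sum_i w i = 1 ->
    \sum_i w i * l i = m -> 0 < m -> 0 < q < 1 ->
    powR m q <= \sum_i w i * powR (l i) q ->
  \sum_i w i * l i ^+ 2 = m ^+ 2.
Proof.
move=> w0 l0 e0 e1 mp q01 le1.
have mn0 : m != 0 by rewrite gt_eqF.
pose s i := l i / m; have s0 i : 0 <= s i by rewrite divr_ge0 // ltW.
have sE i : l i = m * s i by rewrite /s mulrC divfK.
have e1' : \sum_i w i * s i = 1.
  apply: (mulfI mn0); rewrite mulr1 -[RHS]e1 mulr_sumr; apply: eq_bigr => i _.
  by rewrite mulrCA -sE.
have le2 : 1 <= \sum_i w i * powR (s i) q.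
  rewrite -(ler_pM2l (powR_gt0 q mp)) mulr1; apply: le_trans le1 _.
  rewrite mulr_sumr ler_sum // => i _; rewrite mulrCA ler_wpM2l //.
  by rewrite -powRM ?(ltW mp) // -sE.
have z0 : \sum_i w i * (1 + q * (s i - 1) - powR (s i) q) = 0.
  apply/le_anti/andP; split; last first.
    by apply: sumr_ge0 => i _; rewrite mulr_ge0 // subr_ge0 powR_tangent_le.
  have -> : \sum_i w i * (1 + q * (s i - 1) - powR (s i) q) =
      (1 - q) * (\sum_i w i) + q * (\sum_i w i * s i) - \sum_i w i * powR (s i) q.
    by rewrite !mulr_sumr -big_split -sumrB; apply: eq_bigr => i _ /=; ring.
  by rewrite e0 e1'; lra.
have ws i : w i * s i = w i.
  move/eqP: z0; rewrite psumr_eq0 => [/allP/(_ i (mem_index_enum _))/=|k _]; last first.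
    by rewrite mulr_ge0 // subr_ge0 powR_tangent_le.
  rewrite mulf_eq0 => /orP[/eqP ->|]; first by rewrite mul0r.
  have [->|s1] := eqVneq (s i) 1; first by rewrite mulr1.
  by have := powR_tangent_lt (s0 i) s1 q01; rewrite subr_eq0 => + /eqP => /[swap] ->; rewrite ltxx.
transitivity (\sum_i w i * m ^+ 2); last by rewrite -mulr_suml e0 mul1r.
apply: eq_bigr => i _.
have -> : w i * l i ^+ 2 = m ^+ 2 * (w i * s i * s i) by rewrite sE; ring.
by rewrite !ws mulrC.
Qed.

Section LpImproving.
Variables (R : realType) (A : finCstarAlg R) (h : A -> R[i]).
Local Notation C := R[i].
Local Notation N := (\dim {:A}).
Local Open Scope sesquilinear_scope.
Hypotheses (ph : posfun h) (fh : faithful h) (h1 : h 1 = 1).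
Hypothesis htr : forall x y, h (x * y) = h (y * x).
Local Notation nrm2 := (nrm2 h).

Let lh : scalar h := ph.1.

Lemma nrm2_star x : nrm2 (star x) = nrm2 x.
Proof. by rewrite /nrm2 starK htr. Qed.

Lemma nrm2Z (c : C) x : nrm2 (c *: x) = Normc.normc c ^+ 2 * nrm2 x.
Proof.
apply: complexI; rewrite -(nrm2E ph) rmorphM /= -(nrm2E ph) starZ -scalerAl -scalerAr.
by rewrite !(scalZ lh) mulrA rmorphXn /= -/(`|c|) normCK [c * _]mulrC.
Qed.

Lemma nrm2_parallelogram x y :
  nrm2 (x + y) + nrm2 (x - y) = 2 * nrm2 x + 2 * nrm2 y.
Proof.
apply: complexI; rewrite !(rmorphD, rmorphM) /= -!(nrm2E ph) starB starD.
rewrite !(mulrDl, mulrDr, mulNr, mulrN, opprK) !(scalD lh).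
have hN z : h (- z) = - h z by rewrite -scaleN1r (scalZ lh) mulN1r.
by rewrite !hN rmorph1; ring.
Qed.

Lemma nrm2_addc (c : C) x : h x = 0 ->
  nrm2 (c%:A + x) = Normc.normc c ^+ 2 + nrm2 x.
Proof.
move=> hx; apply: complexI; rewrite rmorphD /= -!(nrm2E ph) starD star_scalar.
rewrite mulrDl !mulrDr -!scalerAl -!scalerAr !mul1r !mulr1 !(scalD lh) !(scalZ lh).
rewrite h1 hx (posfun_star ph) hx rmorph0 !mulr0 add0r addr0 mulr1.
by rewrite rmorphXn /= -/(`|c|) normCK [c * _]mulrC.
Qed.

Lemma normc_ge0 (c : C) : 0 <= Normc.normc c.
Proof. by case: c => *; exact: sqrtr_ge0. Qed.

Lemma nrm2_decomp x :
  nrm2 x = Normc.normc (h x) ^+ 2 + nrm2 (x - (h x)%:A).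
Proof.
rewrite -nrm2_addc; first by rewrite addrC subrK.
by rewrite (scalB lh) (scalZ lh) h1 mulr1 subrr.
Qed.

Lemma nrm2_le_sum3 x y z : nrm2 (x + y + z) <= 4 * nrm2 x + 4 * nrm2 y + 2 * nrm2 z.
Proof.
have := nrm2_parallelogram x y; have := nrm2_parallelogram (x + y) z.
have := nrm2_ge0 ph (x - y); have := nrm2_ge0 ph (x + y - z); lra.
Qed.

(** The spread of [x^* x] around its mean is controlled by that of [x]. *)
Lemma nrm2_sqr_le : exists2 K, 1 <= K & forall x,
  nrm2 (star x * x) <= nrm2 x ^+ 2 + K * nrm2 x * nrm2 (x - (h x)%:A).
Proof.
have [K K0 KE] := cnorm_le_nrm2 ph fh.
(* In the three-term bound below, each of the two cross terms contributes 4 and the quadratic term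
   contributes [2 * K]. *)
exists (8 + 2 * K); first by lra.
move=> x; set c := h x; set y := x - c%:A; set m := nrm2 x.
have hy : h y = 0 by rewrite (scalB lh) (scalZ lh) h1 mulr1 subrr.
have mE : m = Normc.normc c ^+ 2 + nrm2 y := nrm2_decomp x.
have y0 := nrm2_ge0 ph y; have c0 : 0 <= Normc.normc c ^+ 2 := sqr_ge0 _.
have xE : x = c%:A + y by rewrite addrC subrK.
clearbody y.
have ym : nrm2 y <= m by rewrite mE lerDr.
have cm : Normc.normc c ^+ 2 <= m by rewrite mE lerDl.
have ha : h (star x * x) = m%:C%C by rewrite (nrm2E ph).
have := nrm2_decomp (star x * x); rewrite ha.
have -> : Normc.normc (m%:C%C : C) ^+ 2 = m ^+ 2.
  by rewrite /= expr0n addr0 sqrtr_sqr real_normK ?num_real.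
move=> ->; rewrite lerD2l.
have -> : star x * x - (m%:C%C)%:A =
    c^* *: y + c *: star y + (star y * y - (h (star y * y))%:A).
  rewrite {1 2}xE starD star_scalar mulrDl !mulrDr -!scalerAl -!scalerAr !mul1r !mulr1.
  rewrite (nrm2E ph y) mE rmorphD scalerDl /= rmorphXn /= -/(`|c|) normCK scalerA.
  rewrite [c * _]mulrC opprD.
  rewrite [LHS](AC ((2*2)*2) ((2*3*(4*6))*(1*5))) /= subrr addr0 //.
apply: le_trans (nrm2_le_sum3 _ _ _) _.
have n1 : nrm2 (c^* *: y) <= m * nrm2 y.
  rewrite nrm2Z ler_wpM2r //.
  suff -> : Normc.normc (c^*) = Normc.normc c by [].
  by case: c {xE mE cm hy y ym y0 c0} => a b /=; rewrite sqrrN.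
have n2 : nrm2 (c *: star y) <= m * nrm2 y by rewrite nrm2Z nrm2_star ler_wpM2r.
have n3 : nrm2 (star y * y - (h (star y * y))%:A) <= K * (m * nrm2 y).
  apply: (@le_trans _ _ (nrm2 (star y * y))).
    by rewrite [leRHS]nrm2_decomp lerDr sqr_ge0.
  apply: le_trans (nrm2_mul_le ph fh _ _) _; rewrite mulrA ler_wpM2r //.
  apply: le_trans (KE _) _; rewrite nrm2_star ler_wpM2l //.
move: n1 n2 n3; set t := m * nrm2 y; have -> : (8 + 2 * K) * m * nrm2 y = 8 * t + 2 * (K * t).
  by rewrite /t; ring.
by move: (nrm2 _) (nrm2 _) (nrm2 _) => n1 n2 n3; lra.
Qed.

Section Contraction.
Variable T : A -> A.
Hypotheses (lT : linear T) (T1 : T 1 = 1) (hT : forall x, h (T x) = h x).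

(** With [x0 = x - h x], the form [|x0|^2 - |T x0|^2 + |h x|^2] is positive definite on the whole
    algebra; its coercivity constant, restricted to the kernel of [h], is the gap. *)
Lemma contraction_gap :
    (forall x, h x = 0 -> x <> 0 -> nrm2 (T x) < nrm2 x) ->
  exists2 d, 0 < d <= 1 & forall x, h x = 0 -> nrm2 (T x) <= (1 - d) * nrm2 x.
Proof.
move=> strict; have [e oe] := exists_onb ph fh.
pose f i := e i - (h (e i))%:A; pose g i := T (f i); pose k i : A := (h (e i))%:A.
pose D := gram h f - gram h g + gram h k.
have fE w : lincomb f w = lincomb e w - (h (lincomb e w))%:A.
  rewrite /lincomb (scal_sum lh) scaler_suml -sumrB; apply: eq_bigr => i _.
  by rewrite scalerBr scalerA (scalZ lh).
have gE w : lincomb g w = T (lincomb f w).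
  by rewrite /lincomb (lin_sum lT); apply: eq_bigr => i _; rewrite (linZ lT).
have kE w : lincomb k w = (h (lincomb e w))%:A.
  rewrite /lincomb (scal_sum lh) scaler_suml; apply: eq_bigr => i _.
  by rewrite scalerA (scalZ lh).
have DE w : hdot w (D *m w) = (nrm2 (lincomb f w) - nrm2 (lincomb g w) +
    nrm2 (lincomb k w))%:C%C.
  rewrite mulmxDl mulmxBl hdotDr hdotBr -!gramE // !(nrm2E ph).
  by rewrite -rmorphB -rmorphD.
have hf w : h (lincomb f w) = 0.
  by rewrite fE (scalB lh) (scalZ lh) h1 mulr1 subrr.
have [||d d0 dE] := @pd_coercive _ _ D.
- by rewrite linearD linearB /= map_mxD map_mxB !(gram_herm _ ph).
- move=> w w0; rewrite DE ltcR.
  have [f0|f0] := eqVneq (lincomb f w) 0.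
    rewrite gE f0 (lin0 lT) subrr add0r lt_def (nrm2_ge0 ph) andbT.
    apply: contra_neq w0 => /(nrm2_eq0 ph fh); rewrite kE => k0.
    apply: (lincomb_inj lh oe); move: f0; rewrite fE k0 subr0 => ->.
    by rewrite /lincomb big1 // => i _; rewrite mxE scale0r.
  rewrite ltr_pwDl ?(nrm2_ge0 ph) // subr_gt0 gE strict //; exact/eqP.
have dR : d = (complex.Re d)%:C%C by rewrite RRe_real // gtr0_real.
set r := complex.Re d in dR; have r0 : 0 < r by move: d0; rewrite dR ltcR.
exists (Num.min r 1); first by rewrite lt_min r0 ltr01 ge_min lexx orbT.
move=> x hx; set w := \col_i h (star (e i) * x).
have xE : x = lincomb e w := onb_expand oe x.
have := dE w; rewrite DE gE fE kE -xE hx scale0r subr0.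
rewrite -(onb_dot w w lh oe) -xE (nrm2E ph) dR -rmorphM /= lecR.
have -> : nrm2 0 = 0 by rewrite /nrm2 mulr0 (scal0 lh).
have := nrm2_ge0 ph x; have : Num.min r 1 <= r by rewrite ge_min lexx.
by move: (Num.min r 1) => s; nra.
Qed.

Lemma lpnorm2 x : lpnorm h 2 x = powR (nrm2 x) 2^-1.
Proof.
have [w [l [w0 l0 _ [e1 _] ->]]] := lpnorm_spectral ph fh h1 x.
rewrite -e1; congr (powR _ _); apply: eq_bigr => i _.
by rewrite divff ?pnatr_eq0 // powRr1.
Qed.

(** With [n] the squared distance of [x] to [h x] and [t = n / m], the gap bounds the [2q]-th power
    of the norm of [T x] by [m^q (1 - q d t)]. The quadratic lower bound for powers, with the spread
    estimate, gives [Z >= m^q (1 - (1 - q) K t)]. *)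
Lemma Lp_improving_of_gap :
    (forall x, h x = 0 -> x <> 0 -> nrm2 (T x) < nrm2 x) ->
  exists p : R, 1 <= p < 2 /\ forall x, lpnorm h 2 (T x) <= lpnorm h p x.
Proof.
move=> /contraction_gap[d /andP[d0 d1] dE].
have [K K1 KE] := nrm2_sqr_le.
have Kd : 0 < K + d by lra.
(* Chosen so that [(1 - q) * K = q * d], which makes the two estimates meet; [d <= 1 <= K] gives
   [2 * q >= 1]. *)
pose q := K / (K + d).
have qE : (1 - q) * K = q * d by rewrite /q; field; rewrite gt_eqF.
have q0 : 0 < q by rewrite divr_gt0 //; lra.
have q1 : q < 1 by rewrite ltr_pdivrMr //; lra.
have q2 : 2^-1 <= q by rewrite ler_pdivlMr //; lra.
exists (2 * q); split; first by apply/andP; split; lra.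
move=> x; rewrite lpnorm2.
have [w [l [w0 l0 e0 [e1 e2] ->]]] := lpnorm_spectral ph fh h1 x.
have -> : 2 * q / 2 = q by rewrite mulrC mulKf // pnatr_eq0.
set Z := \sum_i _; have Z0 : 0 <= Z.
  by apply: sumr_ge0 => i _; rewrite mulr_ge0 // powR_ge0.
rewrite invfM mulrC powRrM ge0_ler_powR ?nnegrE ?powR_ge0 ?(nrm2_ge0 ph) //.
rewrite -[leLHS]powRr1 ?(nrm2_ge0 ph) // -(divff (lt0r_neq0 q0)) powRrM.
rewrite ge0_ler_powR ?nnegrE ?powR_ge0 // ?invr_ge0 ?(ltW q0) //.
set m := nrm2 x; set c := h x; set y := x - c%:A; set n := nrm2 y.
have n0 : 0 <= n := nrm2_ge0 ph _.
have hy : h y = 0 by rewrite (scalB lh) (scalZ lh) h1 mulr1 subrr.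
have mE : m = Normc.normc c ^+ 2 + n := nrm2_decomp x.
have nm : n <= m by rewrite mE lerDr sqr_ge0.
have Tle : nrm2 (T x) <= m - d * n.
  have -> : T x = c%:A + T y.
    by rewrite -{1}[x](subrK c%:A) -/y addrC (linD lT) (linZ lT) T1.
  rewrite nrm2_addc ?hT // mE; have := dE y hy; rewrite -/n; lra.
have [m0|mn0] := eqVneq m 0.
  have -> : nrm2 (T x) = 0.
    apply/le_anti; rewrite (nrm2_ge0 ph) andbT; apply: le_trans Tle _.
    by have := nm; rewrite m0 => ?; nra.
  by rewrite powR0 ?gt_eqF.
have mp : 0 < m by rewrite lt_def mn0 (nrm2_ge0 ph).
pose t := n / m; have t0 : 0 <= t by rewrite divr_ge0 // ltW.
have t1 : t <= 1 by rewrite ler_pdivrMr // mul1r.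
have nE : n = m * t by rewrite /t mulrC divfK.
have dt : 0 <= 1 - d * t by nra.
have q01 : 0 < q < 1 by rewrite q0.
apply: (@le_trans _ _ (powR m q * (1 - q * d * t))).
  apply: (@le_trans _ _ (powR (m * (1 - d * t)) q)).
    rewrite ge0_ler_powR ?nnegrE ?(ltW q0) ?(nrm2_ge0 ph) //.
      by rewrite mulr_ge0 // ltW.
    by apply: le_trans Tle _; rewrite nE; nra.
  rewrite powRM ?(ltW mp) // ler_wpM2l ?powR_ge0 //.
  have := powR_tangent_le dt q01; lra.
have ZE : Z = powR m q * \sum_i w i * powR (l i / m) q.
  rewrite mulr_sumr; apply: eq_bigr => i _; rewrite mulrCA; congr (_ * _).
  by rewrite -powRM ?(ltW mp) ?divr_ge0 ?(ltW mp) // mulrC divfK.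
rewrite ZE ler_wpM2l ?powR_ge0 //.
apply: (@le_trans _ _ (\sum_i w i * (l i / m - (1 - q) * ((l i / m) ^+ 2 - l i / m)))); last first.
  by apply: ler_sum => i _; rewrite ler_wpM2l // powR_ge_quadratic // divr_ge0 // ltW.
have -> : \sum_i w i * (l i / m - (1 - q) * ((l i / m) ^+ 2 - l i / m)) =
    (2 - q) / m * (\sum_i w i * l i) - (1 - q) / m ^+ 2 * (\sum_i w i * l i ^+ 2).
  rewrite !mulr_sumr -sumrB; apply: eq_bigr => i _; field; exact: mn0.
rewrite e1 e2 -/m divfK //.
have le2 : nrm2 (star x * x) <= m ^+ 2 * (1 + K * t).
  by apply: le_trans (KE x) _; rewrite -/m -/c -/y -/n nE; nra.
have le3 : (1 - q) / m ^+ 2 * nrm2 (star x * x) <= (1 - q) * (1 + K * t).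
  rewrite -mulrA; apply: ler_wpM2l; first by lra.
  by rewrite ler_pdivrMl ?exprn_gt0.
apply: le_trans (_ : 2 - q - (1 - q) * (1 + K * t) <= _); last by rewrite lerD2l lerN2.
have -> : (1 - q) * (1 + K * t) = (1 - q) + (1 - q) * K * t by ring.
by rewrite qE; lra.
Qed.

(** If [T] does not shrink [x], it shrinks no [z = 1 + c *: x] with [c] of modulus 1, so the
    [p]-norm of [z] reaches its 2-norm and [star z * z] is scalar. Hence [c *: x + c^* *: star x]
    does not depend on [c]. *)
Lemma gap_of_Lp_improving (p : R) : 1 <= p < 2 ->
    (forall x, lpnorm h 2 (T x) <= lpnorm h p x) ->
  forall x, h x = 0 -> x <> 0 -> nrm2 (T x) < nrm2 x.
Proof.
move=> /andP[p1 p2] Lp x hx xn0; rewrite ltNge; apply/negP => le1; apply: xn0.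
have p0 : 0 < p by lra.
have q01 : 0 < p / 2 < 1 by apply/andP; split; lra.
set m := 1 + nrm2 x.
have mp : 0 < m by rewrite ltr_pwDl // (nrm2_ge0 ph).
have key (c : C) : `|c| = 1 -> c *: x + c^* *: star x = (m - 1)%:C%C%:A - star x * x.
  move=> c1; have nc : Normc.normc c = 1 by apply: complexI; exact: c1.
  set z : A := 1 + c *: x.
  have zE : z = 1%:A + c *: x by rewrite scale1r.
  have nz : nrm2 z = m.
    by rewrite zE nrm2_addc ?(scalZ lh) ?hx ?mulr0 // Normc.normc1 expr1n nrm2Z nc expr1n mul1r.
  have nTz : m <= nrm2 (T z).
    have -> : T z = 1%:A + c *: T x by rewrite (linD lT) T1 (linZ lT) scale1r.
    rewrite nrm2_addc ?(scalZ lh) ?hT ?hx ?mulr0 //.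
    by rewrite Normc.normc1 expr1n nrm2Z nc expr1n mul1r lerD2l.
  have := Lp z; rewrite lpnorm2.
  have [w [l [w0 l0 e0 [e1 e2] ->]]] := lpnorm_spectral ph fh h1 z.
  rewrite nz in e1; set Z := \sum_i _ => leZ.
  have Z0 : 0 <= Z by apply: sumr_ge0 => i _; rewrite mulr_ge0 // powR_ge0.
  have leq : powR m (p / 2) <= Z.
    have := ge0_ler_powR (ltW p0) (powR_ge0 _ _) (powR_ge0 _ _) leZ.
    rewrite -!powRrM mulVf ?gt_eqF // powRr1 // => le2.
    apply: le_trans le2; rewrite [2^-1 * _]mulrC ge0_ler_powR ?nnegrE ?(ltW mp) ?(nrm2_ge0 ph) //.
    by rewrite divr_ge0 // ltW.
  have e3 := powR_mean_extremal w0 l0 e0 e1 mp q01 leq.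
  have haz : h (star z * z) = m%:C%C by rewrite (nrm2E ph) nz.
  have : nrm2 (star z * z - (h (star z * z))%:A) = 0.
    have := nrm2_decomp (star z * z); rewrite -e2 e3 {1}haz.
    have -> : Normc.normc (m%:C%C : C) ^+ 2 = m ^+ 2.
      by rewrite /= expr0n addr0 sqrtr_sqr real_normK ?num_real.
    by move=> e4; apply: (addrI (m ^+ 2)); rewrite addr0 -e4.
  move/(nrm2_eq0 ph fh)/eqP; rewrite subr_eq0 haz => /eqP.
  rewrite starD starA1 starZ mulrDl !mulrDr !mul1r !mulr1 -!scalerAl -!scalerAr.
  rewrite scalerA [c^* * c]mulrC -normCK c1 expr1n scale1r => e4.
  apply/eqP; rewrite eq_sym subr_eq eq_sym; apply/eqP.
  rewrite rmorphB rmorph1 scalerBl scale1r -e4.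
  by rewrite [RHS](AC ((2*2)*1) ((2*3*4)*(1*5))) /= subrr addr0.
have n1 : `|1 : C| = 1 by rewrite normr1.
have nN1 : `|-1 : C| = 1 by rewrite normrN1.
have ni : `|'i : C| = 1 by rewrite normCi.
have nNi : `|- 'i : C| = 1 by rewrite normrN normCi.
have two0 (y : A) : y = - y -> y = 0.
  move=> yy; apply/eqP; have : y *+ 2 == 0 by rewrite mulr2n {2}yy subrr.
  by rewrite -scaler_nat scaler_eq0 pnatr_eq0.
(* Opposite values of [c] give opposite, hence zero, elements. *)
have sum0 : x + star x = 0.
  apply: two0; have := key (-1) nN1; rewrite -(key 1 n1) rmorphN !rmorph1.
  by rewrite !scale1r !scaleN1r -opprD => ->.
have dif0 : x - star x = 0.
  have : 'i *: (x - star x) = 0.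
    have conjNi : (- 'i : C)^* = 'i by rewrite rmorphN /= conjCi opprK.
    apply: two0; have := key (- 'i) nNi; rewrite -(key 'i ni) conjNi conjCi.
    by rewrite !scaleNr scalerBr opprB => <-; rewrite addrC.
  by move/eqP; rewrite scaler_eq0 (negPf (neq0Ci _)) /= => /eqP.
apply: two0; apply/eqP; rewrite -addr_eq0.
by move/eqP: dif0; rewrite subr_eq0 => /eqP {2}->; rewrite sum0.
Qed.

Lemma Lp_improving_iff :
  (exists p : R, 1 <= p < 2 /\ forall x, lpnorm h 2 (T x) <= lpnorm h p x) <->
  (forall x, h x = 0 -> x <> 0 -> nrm2 (T x) < nrm2 x).
Proof.
split; last exact: Lp_improving_of_gap.
by move=> [p [p12 Lp]]; exact: gap_of_Lp_improving p12 Lp.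
Qed.

End Contraction.
End LpImproving.

(** * Operator norms and states *)

Section OperatorNorm.
Variable R : realType.
Local Notation C := R[i].
Local Open Scope sesquilinear_scope.

Lemma hdot_l2norm n (v : 'cV[C]_n) : hdot v v = (l2norm v ^+ 2)%:C%C.
Proof.
rewrite /l2norm sqr_sqrtr; last by apply: sumr_ge0 => i _; exact: sqr_ge0.
rewrite hdotE rmorph_sum; apply: eq_bigr => i _.
by rewrite mulrC -normCK rmorphXn.
Qed.

Lemma l2norm_ge0 n (v : 'cV[C]_n) : 0 <= l2norm v.
Proof. exact: sqrtr_ge0. Qed.

Lemma l2normZ n (c : C) (v : 'cV[C]_n) : l2norm (c *: v) = Normc.normc c * l2norm v.
Proof.
apply/eqP; rewrite -(@eqrXn2 _ 2) ?mulr_ge0 ?l2norm_ge0 ?normc_ge0 //.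
apply/eqP/complexI; rewrite -hdot_l2norm exprMn rmorphM /= -hdot_l2norm.
rewrite !hdotE mulr_sumr; apply: eq_bigr => i _.
by rewrite !mxE rmorphM rmorphXn /= -/(`|c|) normCK /=; ring.
Qed.

Lemma l2norm0 n : l2norm (0 : 'cV[C]_n) = 0.
Proof. by rewrite -[X in l2norm X](scale0r 0) l2normZ Normc.normc0 mul0r. Qed.

Lemma l2norm_gt0 n (v : 'cV[C]_n) : v != 0 -> 0 < l2norm v.
Proof.
move=> v0; rewrite lt_def l2norm_ge0 andbT; apply: contra_neq v0 => v0.
by apply: hdot_eq0; rewrite hdot_l2norm v0 expr0n.
Qed.

(** One direction rescales [v] to the unit ball; the other uses coercivity of [1 - M^* M] to keep
    the supremum away from 1. *)
Lemma opnorm_lt1P n (M : 'M[C]_n) :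
  opnorm M < 1 <-> forall v, v != 0 -> hdot (M *m v) (M *m v) < hdot v v.
Proof.
split=> [M1 v v0|strict].
  have [K K0 KE] := mulmx_bounded M.
  have KR : K = (complex.Re K)%:C%C by rewrite RRe_real // ger0_real.
  set k := complex.Re K in KR; have k0 : 0 <= k by move: K0; rewrite KR ler0c.
  have bnd : has_ubound [set l2norm (M *m v) | v in [set v : 'cV[C]_n | l2norm v <= 1]].
    exists (Num.sqrt k) => _ [u /= u1 <-].
    rewrite -(@ler_pXn2r _ 2) ?nnegrE ?l2norm_ge0 ?sqrtr_ge0 // (sqr_sqrtr k0).
    have := KE u; rewrite !hdot_l2norm KR -rmorphM lecR => /le_trans; apply.
    by rewrite ler_piMr // expr_le1 // l2norm_ge0.
  have L0 := l2norm_gt0 v0; set L := l2norm v in L0.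
  pose u := (L^-1)%:C%C *: v.
  have nL : Normc.normc ((L^-1)%:C%C : C) = L^-1.
    by rewrite /= expr0n addr0 sqrtr_sqr ger0_norm // invr_ge0 ltW.
  have u1 : l2norm u <= 1 by rewrite l2normZ nL mulVf // gt_eqF.
  have : l2norm (M *m u) < 1.
    apply: le_lt_trans M1; apply: ub_le_sup => //.
    by exists u.
  rewrite -scalemxAr l2normZ nL mulrC ltr_pdivrMr // mul1r => lt1.
  rewrite !hdot_l2norm ltcR ltr_pXn2r ?nnegrE ?l2norm_ge0 //.
have [||d d0 dE] := @pd_coercive _ _ (1%:M - M^t* *m M).
- by rewrite linearB /= map_mxB ctmxM trmxCK trmx1 map_mx1.
- move=> v v0; rewrite mulmxBl mul1mx hdotBr -mulmxA hdot_mulmxr trmxCK subr_gt0.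
  exact: strict.
have dR : d = (complex.Re d)%:C%C by rewrite RRe_real // gtr0_real.
set r := complex.Re d in dR; have r0 : 0 < r by move: d0; rewrite dR ltcR.
(* Only positivity of [r] is known, so the maximum keeps the square root meaningful. *)
pose s := Num.max 0 (1 - r).
have s0 : 0 <= s by rewrite le_max lexx.
have s1 : s < 1 by rewrite gt_max ltr01 gtrBl.
apply: (@le_lt_trans _ _ (Num.sqrt s)); last by rewrite -sqrtr1 ltr_sqrt.
apply: ge_sup; first by exists 0, 0; rewrite /= ?l2norm0 ?mulmx0 ?l2norm0.
move=> _ [v /= v1 <-].
rewrite -(@ler_pXn2r _ 2) ?nnegrE ?l2norm_ge0 ?sqrtr_ge0 // (sqr_sqrtr s0).
have := dE v; rewrite mulmxBl mul1mx hdotBr -mulmxA hdot_mulmxr trmxCK.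
rewrite !hdot_l2norm dR -rmorphM -rmorphB lecR => le1.
apply: (@le_trans _ _ ((1 - r) * l2norm v ^+ 2)); first by lra.
apply: (@le_trans _ _ (s * l2norm v ^+ 2)).
  by rewrite ler_wpM2r ?sqr_ge0 // le_max lexx orbT.
by rewrite ler_piMr // expr_le1 // l2norm_ge0.
Qed.

End OperatorNorm.

(** * Convolution of states and bounds on functionals *)

Section States.
Variables (R : realType) (G : finQuantumGroup R) (h : G -> R[i]).
Local Notation C := R[i].
Local Open Scope sesquilinear_scope.
Hypothesis hh : is_haar h.
Implicit Types f g : G -> C.

Let ph : posfun h := posfun_state hh.1.
Let lh : scalar h := ph.1.
Let fh : faithful h := haar_faithful hh.
Let h1 : h 1 = 1. Proof. by case: hh => -[]. Qed.
Let htr := haar_trace hh.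
Local Notation nrm2 := (nrm2 h).

Definition state f := posfun f /\ f 1 = 1.

Lemma unitary_sum n (u : 'M[G]_n) (w : 'cV[C]_n) : unitary_rep u ->
  \sum_i star (\sum_j w j 0 *: u i j) * (\sum_j w j 0 *: u i j) = (hdot w w)%:A.
Proof.
move=> [u1 _ _]; pose y := u *m scalmx G w.
have yE i : \sum_j w j 0 *: u i j = y i 0 by rewrite scalmxr.
transitivity ((adjmxr y *m y) 0 0).
  by rewrite [RHS]mxE; apply: eq_bigr => i _; rewrite yE [adjmxr y 0 i]mxE.
rewrite adjmxrM adjmxr_scalmx -mulmxA (mulmxA (adjmxr u)).
by rewrite -[adjmxr u]/(adjmx u) u1 mul1mx -scalmxM mxE.
Qed.

(** Cauchy-Schwarz applies to each entry of [u w], and by unitarity the squares of these entries sum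
    to the scalar [hdot w w]. *)
Lemma rep_contraction n (u : 'M[G]_n) f w : unitary_rep u -> state f ->
  hdot (map_mx f u *m w) (map_mx f u *m w) <= hdot w w.
Proof.
move=> uu [pf f1]; have lf := pf.1.
have -> : hdot w w = f (hdot w w)%:A by rewrite (scalZ lf) f1 mulr1.
rewrite -(unitary_sum w uu) (scal_sum lf) hdotE ler_sum // => i _.
rewrite mulrC -normCK; apply: le_trans (posfun_CS pf f1 _).
suff -> : (map_mx f u *m w) i 0 = f (\sum_j w j 0 *: u i j) by [].
rewrite mxE (scal_sum lf); apply: eq_bigr => j _.
by rewrite (scalZ lf) mxE mulrC.
Qed.

(** The Gram matrix of the right legs for [g] factors as [B^* B], which turns the value at
    [star x * x] into a sum of values of [f] at squares. *)
Lemma posfun_fconv f g : posfun f -> posfun g -> posfun (fconv f g).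
Proof.
move=> pf pg; split=> [|x]; first exact: fconv_scalar.
have [lf _] := pf; have [e oe] := exists_onb ph fh; have fr := onb_frame lh oe.
pose w := \col_i h (star (e i) * x); have xE : x = lincomb e w := onb_expand oe x.
pose v := coefmx e (fun i x => h (star (e i) * x)).
pose y i := \sum_j w j 0 *: v i j.
have cx : comul x = \sum_i tpure (e i) (y i) by rewrite {1}xE (comul_lincomb fr).
have [B gE] := psd_gram (gram_herm y pg) (gram_ge0 y pg).
rewrite /fconv (comul_starM cx cx) pair_big tlift_sum; last exact: bilin_mul lf pg.1.
rewrite -(pair_bigA _ (fun k l => f (star (e k) * e l) * g (star (y k) * y l))) /=.
have gkl k l : g (star (y k) * y l) = \sum_m (B m k)^* * B m l.
  have /matrixP/(_ k l) := gE; rewrite mxE => ->.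
  by rewrite mxE; apply: eq_bigr => m _; rewrite !mxE.
have -> : \sum_k \sum_l f (star (e k) * e l) * g (star (y k) * y l) =
    \sum_m f (star (\sum_k B m k *: e k) * \sum_k B m k *: e k).
  under eq_bigr => k _ do under eq_bigr => l _ do rewrite gkl mulr_sumr.
  under eq_bigr => k _ do rewrite exchange_big.
  rewrite exchange_big; apply: eq_bigr => m _ /=.
  rewrite star_sum mulr_suml (scal_sum lf); apply: eq_bigr => k _.
  rewrite mulr_sumr (scal_sum lf); apply: eq_bigr => l _.
  by rewrite starZ -scalerAl -scalerAr !(scalZ lf); ring.
by apply: sumr_ge0 => m _; exact: pf.2.
Qed.

Lemma state_fconv f g : state f -> state g -> state (fconv f g).
Proof.
move=> [pf f1] [pg g1]; split; first exact: posfun_fconv.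
rewrite fconv_slicer ?slicer1 ?(scalZ pf.1) ?f1 ?g1 ?mulr1 //.
- exact: pg.1.
- exact: pf.1.
- exact: pg.1.
Qed.

Lemma convpowS f k : convpow f k.+2 = fconv (convpow f k.+1) f.
Proof. by []. Qed.

Lemma state_convpow f k : state f -> state (convpow f k.+1).
Proof.
by move=> sf; elim: k => [//|k IH]; rewrite convpowS; exact: state_fconv.
Qed.

Lemma convpow_slicer f k x : scalar f ->
  convpow f k.+1 x = f (iter k (slicer f) x).
Proof.
move=> lf; elim: k x => [//|k IH] x; rewrite convpowS fconv_slicer //.
  by rewrite IH -iterSr.
by case: k {IH} => [//|k]; rewrite convpowS; exact: fconv_scalar.
Qed.

Lemma haar_slicer f x : scalar f -> f 1 = 1 -> h (slicer f x) = h x.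
Proof.
by move=> lf f1; rewrite -fconv_slicer // fconv_slicel // (hh.2 x).1 (scalZ lf) f1 mulr1.
Qed.

Lemma haar_slicel f x : scalar f -> f 1 = 1 -> h (slicel f x) = h x.
Proof.
by move=> lf f1; rewrite -fconv_slicel // fconv_slicer // (hh.2 x).2 (scalZ lf) f1 mulr1.
Qed.

Lemma linear_nrm2_bounded (T : G -> G) : linear T ->
  exists2 K, 0 <= K & forall x, nrm2 (T x) <= K * nrm2 x.
Proof.
move=> lT; have [e oe] := exists_onb ph fh.
pose M : 'M[C]_(\dim {:G}) := \matrix_(i, j) h (star (e i) * T (e j)).
have TE w : T (lincomb e w) = lincomb e (M *m w).
  rewrite [LHS](onb_expand oe); congr lincomb; apply/colP => i.
  rewrite mxE (lin_sum lT) mulr_sumr (scal_sum lh) [RHS]mxE.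
  by apply: eq_bigr => j _; rewrite (linZ lT) -scalerAr (scalZ lh) mxE mulrC.
have [K K0 KE] := mulmx_bounded M.
have KR : K = (complex.Re K)%:C%C by rewrite RRe_real // ger0_real.
exists (complex.Re K) => [|x]; first by rewrite -ler0c -KR.
rewrite -lecR rmorphM /= -KR -!(nrm2E ph).
set w := \col_i h (star (e i) * x); have xE : x = lincomb e w := onb_expand oe x.
by rewrite [in leLHS]xE TE [in leRHS]xE !(onb_dot _ _ lh oe).
Qed.

(** Apply the bound for operators to [x |-> (f x)%:A], whose [L^2] norm is the modulus of [f x]. *)
Lemma scalar_bounded f : scalar f ->
  exists2 K, 0 <= K & forall x, Normc.normc (f x) ^+ 2 <= K * nrm2 x.
Proof.
move=> lf; have [|K K0 KE] := @linear_nrm2_bounded (fun x => (f x)%:A).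
  by move=> a x y; rewrite lf scalerDl scalerA.
exists K => // x; apply: le_trans (KE x).
rewrite -[(f x)%:A]addr0 (nrm2_addc ph h1) ?(scal0 lh) //.
by rewrite lerDl (nrm2_ge0 ph).
Qed.

Lemma dual_norm_set_bounded f : scalar f ->
  has_ubound [set Normc.normc (f x) | x in [set x : G | cnorm x <= 1]].
Proof.
move=> lf; have [K K0 KE] := scalar_bounded lf.
exists (Num.sqrt K) => _ [x /= x1 <-].
rewrite -(@ler_pXn2r _ 2) ?nnegrE ?normc_ge0 ?sqrtr_ge0 // sqr_sqrtr //.
apply: le_trans (KE x) _; rewrite ler_piMr //.
apply: le_trans (nrm2_le_cnorm ph fh h1 x) _.
by rewrite expr_le1 // cnorm_ge0.
Qed.

Lemma dual_norm_ge f x : scalar f -> cnorm x <= 1 -> Normc.normc (f x) <= dual_norm f.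
Proof.
move=> lf x1; apply: ub_le_sup; first exact: dual_norm_set_bounded.
by exists x.
Qed.

Lemma dual_norm_le f B : (forall x, cnorm x <= 1 -> Normc.normc (f x) <= B) ->
  dual_norm f <= B.
Proof.
move=> fB; apply: ge_sup.
  by exists (Normc.normc (f 0)), 0 => //=; rewrite cnorm0.
by move=> _ [x /= x1 <-]; exact: fB.
Qed.

End States.

(** * Ergodicity of convolution operators *)

Section Ergodicity.
Variables (R : realType) (G : finQuantumGroup R) (I : irr_reps G)
  (h : G -> R[i]) (S : G -> G).
Local Notation C := R[i].
Local Open Scope sesquilinear_scope.
Hypotheses (hh : is_haar h) (hS : is_antipode I S).
Implicit Types f g : G -> C.

Let ph : posfun h := posfun_state hh.1.
Let lh : scalar h := ph.1.
Let fh : faithful h := haar_faithful hh.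
Let h1 : h 1 = 1. Proof. by case: hh => -[]. Qed.
Let htr := haar_trace hh.
Local Notation nrm2 := (nrm2 h).

Definition selfconv f := fconv (f \o S) f.

Definition ergodic f := forall x, h x = 0 -> slicer (selfconv f) x = x -> x = 0.

Definition strict_contraction (T : G -> G) :=
  forall x, h x = 0 -> x <> 0 -> nrm2 (T x) < nrm2 x.

Lemma state_antipode f : state f -> state (f \o S).
Proof.
move=> [pf f1]; split; first exact: posfun_antipode hh I S hS f pf.
by rewrite /= (antipode1 hh hS).
Qed.

Lemma state_selfconv f : state f -> state (selfconv f).
Proof. by move=> sf; apply: (state_fconv hh) => //; exact: state_antipode. Qed.

Lemma map_selfconv n (u : 'M[G]_n) f : state f -> unitary_rep u ->
  map_mx (selfconv f) u = (map_mx f u)^t* *m map_mx f u.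
Proof.
move=> sf uu; have [_ _ cu] := uu.
rewrite (map_mx_fconv (state_antipode sf).1.1 sf.1.1 cu).
by rewrite (map_antipode hS sf.1 uu).
Qed.

Section RegularCoordinates.
Variables (e : 'I_(\dim {:G}) -> G).
Hypothesis oe : onb h e.
Local Notation v := (coefmx e (fun i x => h (star (e i) * x))).

Let fr := onb_frame lh oe.
Let uv : unitary_rep v := (coefmx_unitary hh oe).1.

Lemma nrm2_lincomb w : (nrm2 (lincomb e w))%:C%C = hdot w w.
Proof. by rewrite -(nrm2E ph) (onb_dot _ _ lh oe). Qed.

Lemma slicer_fixed f w : scalar f ->
  slicer f (lincomb e w) = lincomb e w <-> map_mx f v *m w = w.
Proof.
move=> lf; rewrite (slicer_lincomb fr) //; split=> [|->] //.
exact: (lincomb_inj lh oe).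
Qed.

Lemma fixed_vector_scalar w : v *m scalmx G w = scalmx G w ->
  lincomb e w = (h (lincomb e w))%:A.
Proof.
move=> fw; apply: (comul_pure_scalar hh).
rewrite (comul_lincomb fr) tpure_suml; apply: eq_bigr => i _.
by rewrite -scalmxr fw mxE tpureZl tpureZr.
Qed.

End RegularCoordinates.

Lemma nrm2_slicer_le f x : state f -> nrm2 (slicer f x) <= nrm2 x.
Proof.
move=> sf; have [e oe] := exists_onb ph fh.
rewrite [x](onb_expand oe) (slicer_lincomb (onb_frame lh oe)); last exact: sf.1.1.
rewrite -lecR !(nrm2_lincomb oe); apply: rep_contraction => //.
exact: (coefmx_unitary hh oe).1.
Qed.

(** If [F] preserves the norm of [w], then [F^* F w = w]: expand the squared distance and use that
    [F^*], the matrix of the state [f \o S], is also a contraction. Conversely such a fixed vector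
    keeps its norm under [F]. *)
Lemma strict_contraction_slicer f : state f ->
  strict_contraction (slicer f) <-> ergodic f.
Proof.
move=> sf; have [e oe] := exists_onb ph fh; have fr := onb_frame lh oe.
have uv := (coefmx_unitary hh oe).1; set v := coefmx _ _ in uv.
have lf := sf.1.1; have lp := (state_selfconv sf).1.1.
split=> [strict x hx|erg x hx x0].
  rewrite [x](onb_expand oe); set w := \col_i _ => /(slicer_fixed oe w lp).
  rewrite (map_selfconv sf uv) => fw.
  apply: contrapT => x0; have hw : h (lincomb e w) = 0 by rewrite -(onb_expand oe).
  have := strict _ hw x0; rewrite (slicer_lincomb fr) // -ltcR !(nrm2_lincomb oe).
  by rewrite hdot_mulmxr mulmxA fw ltxx.
rewrite lt_def (nrm2_slicer_le _ sf) andbT; apply/eqP => e1; apply: x0.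
apply: erg => //; move: e1; rewrite [x](onb_expand oe); set w := \col_i _.
move/(congr1 (fun r => r%:C%C : C)); rewrite (slicer_lincomb fr) // !(nrm2_lincomb oe).
set F := map_mx f v => e1.
apply/(slicer_fixed oe w lp); rewrite (map_selfconv sf uv) -/F.
apply/eqP; rewrite -subr_eq0; apply/eqP/hdot_eq0/le_anti; rewrite hdot_ge0 andbT.
have := rep_contraction (F *m w) uv (state_antipode sf).
rewrite (map_antipode hS) -/F ?mulmxA //; last exact: sf.1.
rewrite hdotBr !hdotBl.
have -> : hdot (F^t* *m F *m w) w = hdot (F *m w) (F *m w).
  by rewrite hdot_mulmxr mulmxA.
have -> : hdot w (F^t* *m F *m w) = hdot (F *m w) (F *m w).
  by rewrite -mulmxA hdot_mulmxr trmxCK.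
rewrite e1 -subr_ge0 => le1; rewrite -subr_ge0; apply: le_trans le1 _; clear e1.
move: (hdot (F *m w) _) (hdot (_ *m F *m w) _) => p q.
by rewrite subrr subr0 sub0r opprB.
Qed.

(** For [f \o S] the matrix is [F F^*]. A vector [w] fixed by it gives [F^* w] fixed by [F^* F],
    hence zero, and then [w = F F^* w] is zero. *)
Lemma ergodic_antipode f : state f -> ergodic f -> ergodic (f \o S).
Proof.
move=> sf erg x hx; have sg := state_antipode sf.
have [e oe] := exists_onb ph fh; have fr := onb_frame lh oe.
have uv := (coefmx_unitary hh oe).1; set v := coefmx _ _ in uv.
rewrite [x](onb_expand oe); set w := \col_i _.
move/(slicer_fixed oe w (state_selfconv sg).1.1).
rewrite (map_selfconv sg uv) (map_antipode hS sf.1 uv) trmxCK -mulmxA => fw.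
set u := (map_mx f v)^t* *m w in fw.
have u0 : lincomb e u = 0.
  apply: erg.
    have := haar_slicer hh x sg.1.1 sg.2; rewrite hx [x](onb_expand oe) -/w.
    by rewrite (slicer_lincomb fr) ?(map_antipode hS sf.1 uv) //; exact: sg.1.1.
  apply/(slicer_fixed oe u (state_selfconv sf).1.1).
  by rewrite (map_selfconv sf uv) -mulmxA fw.
rewrite -fw; suff -> : u = 0 by rewrite mulmx0 /lincomb big1 // => i _; rewrite mxE scale0r.
apply: (lincomb_inj lh oe); rewrite u0 /lincomb big1 // => i _.
by rewrite mxE scale0r.
Qed.

Lemma ergodic_antipodeE f : state f -> ergodic (f \o S) <-> ergodic f.
Proof.
move=> sf; split; last exact: ergodic_antipode.
move/(ergodic_antipode (state_antipode sf)).
have -> // : (f \o S) \o S = f.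
by apply/funext => x /=; rewrite (antipodeK hh hS).
Qed.

Lemma slicel1 f : scalar f -> slicel f 1 = (f 1)%:A.
Proof.
by move=> lf; have [bl br] := bilin_slicel G lf; rewrite /slicel comul1 tlift_tpure.
Qed.

Lemma nrm2_antipode x : nrm2 (S x) = nrm2 x.
Proof.
have [_ mS _] := hS; rewrite /nrm2 -(antipode_star hh hS) -mS.
by rewrite (haar_antipode hh hS) htr.
Qed.

(** Conjugation by the antipode, which preserves [h] and the [L^2] norm, exchanges the two
    convolutions. *)
Lemma strict_contraction_slicel f : state f ->
  strict_contraction (slicel f) <-> ergodic f.
Proof.
move=> sf; rewrite -ergodic_antipodeE // -strict_contraction_slicer; last exact: state_antipode.
have lf := sf.1.1; have lS : linear S by case: hS.
have S0 x : S x = 0 -> x = 0.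
  by move=> x0; rewrite -(antipodeK hh hS x) x0 (lin0 lS).
split=> strict x hx x0.
  have := strict (S x); rewrite (haar_antipode hh hS) (slicel_antipode hh hS) //.
  rewrite !nrm2_antipode (antipodeK hh hS); apply=> //.
  by move/S0.
rewrite (slicel_antipode hh hS) // nrm2_antipode -(nrm2_antipode x).
apply: strict; first by rewrite (haar_antipode hh hS).
by move/S0.
Qed.

Lemma Lp_improving_left f : state f ->
  (exists p : R, 1 <= p < 2 /\ forall x, lpnorm h 2 (conv_fun_elt f x) <= lpnorm h p x)
  <-> ergodic f.
Proof.
move=> sf; rewrite -strict_contraction_slicer //; have lf := sf.1.1.
apply: (Lp_improving_iff ph fh h1 htr (T := slicer f)).
- exact: slicer_linear.
- by rewrite slicer1 // sf.2 scale1r.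
- by move=> x; apply: (haar_slicer hh); case: sf.
Qed.

Lemma Lp_improving_right f : state f ->
  (exists p : R, 1 <= p < 2 /\ forall x, lpnorm h 2 (conv_elt_fun x f) <= lpnorm h p x)
  <-> ergodic f.
Proof.
move=> sf; rewrite -strict_contraction_slicel //; have lf := sf.1.1.
apply: (Lp_improving_iff ph fh h1 htr (T := slicel f)).
- exact: slicel_linear.
- by rewrite slicel1 // sf.2 scale1r.
- by move=> x; apply: (haar_slicel hh); case: sf.
Qed.

(** A diagonal matrix unit is an invariant idempotent, so it is the identity and the dimension is
    1. *)
Lemma irreducible_one_trivial n :
  irreducible_rep (1%:M : 'M[G]_n) -> equiv_rep (1%:M : 'M[G]_n) (trivial_rep G).
Proof.
case: n => [|n] [// _ _ irr].
have [||/matrixP/(_ 0 0)|/matrixP/(_ ord_max ord_max)] := irr (delta_mx 0 0).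
- by rewrite mul_delta_mx.
- by rewrite mul1mx mulmx1 -scalmxM mul_delta_mx.
- by rewrite !mxE => /eqP; rewrite oner_eq0.
- rewrite !mxE eqxx; case: n {irr} => [|n] /=.
    by move=> _; exact: equiv_rep_refl.
  by move=> /eqP; rewrite eq_sym oner_eq0.
Qed.

(** The matrix [H] is an invariant idempotent, hence 0 or 1; if it is 1, invariance of [h] gives
    [u = 1], so [a] is the trivial class. *)
Lemma haar_irr (a : I) : a <> irr_one I -> map_mx h (irr_rep a) = 0.
Proof.
move=> na; have [n0 [u1 u2 cu] irr] := irr_irreducible a.
set u := irr_rep a in u1 u2 cu irr *; set H := map_mx h u.
have [Hu uH] := haar_rep hh cu.
have HH : H *m H = H.
  have := congr1 (map_mx h) uH; rewrite map_scalmxr_scalar // -/H => ->.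
  by apply/matrixP => i j; rewrite !mxE (scalZ lh) h1 mulr1.
have uH' : u *m scalmx G H = scalmx G H *m u *m scalmx G H.
  by rewrite -mulmxA uH -scalmxM HH.
have [//|H1] := irr H HH uH'.
have u1' : u = 1%:M by have := Hu; rewrite -/H H1 scalmx1 mul1mx.
case: na; apply: irr_inj; apply: equiv_rep_trans (equiv_rep_sym (irr_oneE I)).
rewrite -/u u1'; apply: irreducible_one_trivial.
by have := irr_irreducible a; rewrite -/u u1'.
Qed.

Lemma fourier_antipode f (a : I) : fourier f a = map_mx (f \o S) (irr_rep a).
Proof.
have [_ [_ _ _] _] := irr_irreducible a.
have [_ _ Sa] := hS.
by apply/matrixP => i j; rewrite !mxE /= Sa.
Qed.

(** The entries of [u w] lie in the kernel of [h], their squared norms sum to that of [w], and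
    convolution sends them to the entries for the image of [w]. One nonzero entry shrinks strictly
    and the others do not grow. *)
Lemma opnorm_fourier_lt1 f (a : I) : state f -> ergodic f -> a <> irr_one I ->
  opnorm (fourier f a) < 1.
Proof.
move=> sf erg na; have sg := state_antipode sf.
have /(strict_contraction_slicer sg) strict := ergodic_antipode sf erg.
apply/opnorm_lt1P => w w0; rewrite fourier_antipode; set g := f \o S in sg strict *.
have [_ uu _] := irr_irreducible a; have [_ _ cu] := uu.
have lg := sg.1.1; set u := irr_rep a in uu cu *.
pose x (z : 'cV[C]_(irr_dim a)) i := \sum_j z j 0 *: u i j.
have hx i : h (x w i) = 0.
  rewrite (scal_sum lh) big1 // => j _; rewrite (scalZ lh).
  by have /matrixP/(_ i j) := haar_irr na; rewrite !mxE -/u => ->; rewrite mulr0.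
have Tx i : slicer g (x w i) = x (map_mx g u *m w) i.
  rewrite (lin_sum (slicer_linear g)) /x.
  under [RHS]eq_bigr => k _ do rewrite mxE scaler_suml.
  rewrite [RHS]exchange_big; apply: eq_bigr => j _ /=; rewrite (linZ (slicer_linear g)).
  rewrite /slicer cu tlift_sum; last exact: bilin_slicer.
  by rewrite scaler_sumr; apply: eq_bigr => k _; rewrite scalerA mxE mulrC.
have sumE z : hdot z z = (\sum_i nrm2 (x z i))%:C%C.
  have := congr1 h (unitary_sum z uu); rewrite (scalZ lh) h1 mulr1 => <-.
  rewrite (scal_sum lh) rmorph_sum; apply: eq_bigr => i _ /=.
  by rewrite -(nrm2E ph).
rewrite !sumE ltcR; under eq_bigr do rewrite -Tx.
have [i xi0] : exists i, x w i <> 0.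
  apply: contrapT => nx; move/eqP: w0; apply; apply: hdot_eq0.
  rewrite sumE big1 // => i _.
  have -> : x w i = 0 by apply: contrapT => xi; apply: nx; exists i.
  by rewrite /nrm2 mulr0 (scal0 lh).
rewrite [ltLHS](bigD1 i) // [ltRHS](bigD1 i) //=.
apply: ltr_leD; first exact: strict.
by apply: ler_sum => j _; exact: nrm2_slicer_le.
Qed.

(** Induction on [u]. On a nontrivial irreducible, with [M] the Fourier coefficient, a fixed vector
    gives [M M^* z = z], so [M] preserves the norm of [M^* z]; strict contractivity forces
    [M^* z = 0]. On an orthogonal sum the two components of [w] are treated separately. *)
Lemma fixed_vector_rep f : state f ->
    (forall a : I, a <> irr_one I -> opnorm (fourier f a) < 1) ->
  forall n (u : 'M[G]_n), unitary_rep u -> forall w : 'cV[C]_n,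
    map_mx (selfconv f) u *m w = w -> u *m scalmx G w = scalmx G w.
Proof.
move=> sf lt1; have lp := (state_selfconv sf).1.1.
apply: unitary_rep_ind => [u w _|n u iu w fw|n k l Q Q' a b [QQ QQ' QtQ' Q'tQ QQs] Ka Kb w].
- by apply/matrixP => -[].
- have [a [T [T' [TT' T'T uE]]]] := irr_rep_similar I iu.
  have [a1|na] := pselect (a = irr_one I).
    suff u1 : u = 1%:M by rewrite u1 mul1mx.
    have [T0 [T0' [_ T0'T0 e0]]] := irr_oneE I.
    move: T T' TT' T'T uE; rewrite a1 => T T' TT' T'T ->.
    have -> : irr_rep (irr_one I) = 1%:M.
      rewrite -[LHS]mul1mx -scalmx1 -T0'T0 scalmxM -mulmxA e0 /trivial_rep mul1mx.
      by rewrite -scalmxM T0'T0 scalmx1.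
    by rewrite mulmx1 -scalmxM T'T scalmx1.
  have [_ ua _] := irr_irreducible a.
  set M := fourier f a.
  have ME : M = (map_mx f (irr_rep a))^t*.
    by rewrite /M fourier_antipode (map_antipode hS) //; exact: sf.1.
  have fz : M *m (M^t* *m (T *m w)) = T *m w.
    rewrite ME trmxCK mulmxA -(map_selfconv sf ua).
    rewrite -[in RHS]fw uE map_scalmxr_scalar // map_scalmxl_scalar //.
    by rewrite !mulmxA TT' mul1mx.
  have /opnorm_lt1P strict := lt1 a na; rewrite -/M in strict.
  have z0 : M^t* *m (T *m w) = 0.
    apply/eqP; apply: contraT => /strict.
    have -> : hdot (M^t* *m (T *m w)) (M^t* *m (T *m w)) = hdot (T *m w) (T *m w).
      transitivity (hdot (T *m w) (M *m (M^t* *m (T *m w)))); last by rewrite fz.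
      by rewrite [RHS]hdot_mulmxr.
    by rewrite fz ltxx.
  have -> : w = 0 by rewrite -[w]mul1mx -T'T -mulmxA -fz z0 !mulmx0.
  by rewrite scalmx0 mulmx0.
have addP m p (x y : 'M[G]_(m, p)) :
    map_mx (selfconv f) (x + y) = map_mx (selfconv f) x + map_mx (selfconv f) y.
  by apply/matrixP => i j; rewrite !mxE (scalD lp).
rewrite addP !map_scalmxr_scalar // !map_scalmxl_scalar // => fw.
have fa : a *m scalmx G (Q^t* *m w) = scalmx G (Q^t* *m w).
  apply: Ka; rewrite -[in RHS]fw mulmxDl mulmxDr !mulmxA QQ QtQ' !mul0mx addr0.
  by rewrite mul1mx.
have fb : b *m scalmx G (Q'^t* *m w) = scalmx G (Q'^t* *m w).
  apply: Kb; rewrite -[in RHS]fw mulmxDl mulmxDr !mulmxA QQ' Q'tQ !mul0mx add0r.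
  by rewrite mul1mx.
rewrite mulmxDl -!mulmxA -!scalmxM fa fb -!scalmxM -scalmxD !mulmxA -mulmxDl QQs.
by rewrite mul1mx.
Qed.

Lemma ergodic_of_fourier f : state f ->
  (forall a : I, a <> irr_one I -> opnorm (fourier f a) < 1) -> ergodic f.
Proof.
move=> sf lt1 x hx; have [e oe] := exists_onb ph fh.
have uv := (coefmx_unitary hh oe).1.
move: hx; rewrite [x](onb_expand oe); set w := \col_i _ => hw.
move/(slicer_fixed oe w (state_selfconv sf).1.1) => fw.
rewrite (fixed_vector_scalar oe (fixed_vector_rep sf lt1 uv fw)).
by rewrite hw scale0r.
Qed.

Lemma cesaro_scalar f n : scalar f ->
  scalar (fun x : G => n%:R^-1 * (\sum_(1 <= k < n.+1) convpow f k x) - h x).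
Proof.
move=> lf a x y; have lk k : scalar (convpow f k).
  by case: k => [|[|k]] //; rewrite convpowS; exact: fconv_scalar.
rewrite lh; under eq_bigr => k _ do rewrite lk.
by rewrite big_split /= -mulr_sumr; ring.
Qed.

(** On [ker h] the map [1 - T] is invertible, [T] being convolution by [f]; with
    [x - h(x) = y - T y] the Cesaro sums telescope. *)
Lemma cesaro_bound f : state f ->
    (forall x, h x = 0 -> slicer f x = x -> x = 0) ->
  exists2 B : R, 0 <= B & forall n, (0 < n)%N ->
    dual_norm (fun x : G => n%:R^-1 * (\sum_(1 <= k < n.+1) convpow f k x) - h x)
      <= n%:R^-1 * B.
Proof.
move=> sf erg; have lf := sf.1.1; have lT := slicer_linear f; have f1 := sf.2.
have T1 : slicer f 1 = 1 by rewrite slicer1 // f1 scale1r.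
(* Adding [h x] makes [1 - T] invertible on the whole space instead of the kernel of [h] only. *)
pose U x := x - slicer f x + (h x)%:A.
have hT x : h (slicer f x) = h x by exact: (haar_slicer hh).
have hU x : h (U x) = h x.
  by rewrite (scalD lh) (scalB lh) hT subrr add0r (scalZ lh) h1 mulr1.
have linU : linear U.
  move=> a x y; rewrite /U lT lh scalerDl scalerDr scalerBr -scalerA opprD.
  by rewrite [LHS](AC ((2*2)*2) ((1*3*5)*(2*4*6))) /= scalerA.
have U0 x : U x = 0 -> x = 0.
  move=> x0; have hx : h x = 0 by rewrite -hU x0 (scal0 lh).
  apply: erg => //; apply/eqP; rewrite eq_sym -subr_eq0.
  by move: x0; rewrite /U hx scale0r addr0 => ->.
have [g [lg _ Ug]] := surj_linear_inv linU (inj_linear_surj linU U0).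
have [K1 K10 K1E] := linear_nrm2_bounded hh lg.
have [K2 K20 K2E] := scalar_bounded hh lf.
(* Telescoping leaves two values of [f], at [y] and at its [n]-th iterate, both of squared norm at
   most [K1]; [K2] bounds [f]. *)
exists (2 * Num.sqrt (K2 * K1)); first by rewrite mulr_ge0 // sqrtr_ge0.
move=> n n0; apply: dual_norm_le => x x1.
set y := g (x - (h x)%:A).
have xE : x = (h x)%:A + (y - slicer f y).
  have hy : h y = 0.
    by rewrite -hU Ug (scalB lh) (scalZ lh) h1 mulr1 subrr.
  have := Ug (x - (h x)%:A); rewrite -/y /U hy scale0r addr0 => ->.
  by rewrite addrC subrK.
have iterT k (c : C) z : iter k (slicer f) (c%:A + z) = c%:A + iter k (slicer f) z.
  elim: k => [//|k /= ->]; by rewrite (linD lT) (linZ lT) T1.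
have iterB k (z z' : G) : iter k (slicer f) (z - z') =
    iter k (slicer f) z - iter k (slicer f) z'.
  by elim: k => [//|k /= ->]; rewrite (linB lT).
have sumE : \sum_(1 <= k < n.+1) convpow f k x =
    n%:R * h x + (f y - f (iter n (slicer f) y)).
  rewrite big_add1 /=.
  under eq_bigr => k _ do
    rewrite (convpow_slicer _ _ lf) {1}xE iterT iterB -iterSr (scalD lf) (scalZ lf)
      (scalB lf) f1 mulr1.
  rewrite big_split /= sumr_const_nat subn0 mulr_natl; congr (_ + _).
  rewrite -[RHS]opprB -(telescope_sumr (fun k => f (iter k (slicer f) y)) (leq0n n)).
  by rewrite -sumrN; apply: eq_bigr => k _; rewrite opprB.
have nC : (n%:R : C) != 0 by rewrite pnatr_eq0 -lt0n.
rewrite sumE mulrDr mulKf // addrC addKr Normc.normcM.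
have -> : Normc.normc (n%:R^-1 : C) = n%:R^-1.
  by rewrite Normc.normcV normcMn Normc.normc1.
rewrite ler_wpM2l ?invr_ge0 ?ler0n //.
have ny : nrm2 y <= K1.
  apply: le_trans (K1E _) _; rewrite ler_piMr //.
  apply: (@le_trans _ _ (nrm2 x)).
    by rewrite [leRHS](nrm2_decomp ph h1) lerDr sqr_ge0.
  apply: le_trans (nrm2_le_cnorm ph fh h1 x) _.
  by rewrite expr_le1 // cnorm_ge0.
have nT k : nrm2 (iter k (slicer f) y) <= K1.
  by elim: k => [//|k IH] /=; apply: le_trans (nrm2_slicer_le _ sf) IH.
have fle z : nrm2 z <= K1 -> Normc.normc (f z) <= Num.sqrt (K2 * K1).
  move=> zK; rewrite -(@ler_pXn2r _ 2) ?nnegrE ?normc_ge0 ?sqrtr_ge0 //.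
  rewrite sqr_sqrtr ?mulr_ge0 //; apply: le_trans (K2E z) _.
  by rewrite ler_wpM2l.
apply: le_trans (le_normcD _ _) _; rewrite normcN mulr_natl mulr2n.
by rewrite lerD // fle // (nT n).
Qed.

Lemma cesaro_cvg f : state f ->
    (forall x, h x = 0 -> slicer f x = x -> x = 0) ->
  (fun n : nat => dual_norm (fun x : G =>
     n%:R^-1 * (\sum_(1 <= k < n.+1) convpow f k x) - h x)) @ \oo --> (0 : R).
Proof.
move=> sf erg; have [B B0 BE] := cesaro_bound sf erg.
apply/cvgr0Pnorm_lt => eps eps0.
near=> n.
have n0 : (0 < n)%N by near: n; exact: nbhs_infty_gt.
have nB : B / eps + 1 <= n%:R by near: n; exact: nbhs_infty_ger.
have nR : (0 : R) < n%:R by rewrite ltr0n.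
rewrite ger0_norm.
  apply: le_lt_trans (BE n n0) _; rewrite ltr_pdivrMl // -ltr_pdivrMr //.
  by apply: lt_le_trans nB; rewrite ltrDl.
have := dual_norm_ge hh (x := 0) (cesaro_scalar n sf.1.1).
rewrite cnorm0 => /(_ ler01); apply: le_trans; exact: normc_ge0.
Unshelve. all: by end_near.
Qed.

(** If all powers vanish at [x], the Cesaro means stay at distance at least the modulus of [h z]
    from [h], where [z] is [x] rescaled to the unit ball and [h z] is nonzero by faithfulness. *)
Lemma cesaro_charges f : state f ->
    (fun n : nat => dual_norm (fun x : G =>
      n%:R^-1 * (\sum_(1 <= k < n.+1) convpow f k x) - h x)) @ \oo --> (0 : R) ->
  forall x : G, cpos x -> x <> 0 -> exists n : nat, (1 <= n)%N /\ 0 < convpow f n x.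
Proof.
move=> sf cv x [y xE] x0; apply: contrapT => nx.
have p0 k : (1 <= k)%N -> convpow f k x = 0.
  case: k => // k _; apply/eqP; apply: contraT => pk; exfalso; apply: nx.
  exists k.+1; split=> //; rewrite lt_def pk xE.
  by have [[_ +] _] := state_convpow hh k sf; apply.
have xn0 : x != 0 by apply/eqP.
have c0 := cnorm_gt0 xn0.
have hx0 : h x != 0.
  apply/eqP => hx; apply: x0; have : nrm2 y = 0 by rewrite /nrm2 -xE hx.
  by move/(nrm2_eq0 ph fh) => y0; rewrite xE y0 mulr0.
pose z := ((cnorm x)^-1)%:C%C *: x.
have nc : Normc.normc (((cnorm x)^-1)%:C%C : C) = (cnorm x)^-1.
  by rewrite /= expr0n addr0 sqrtr_sqr ger0_norm // invr_ge0 ltW.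
have z1 : cnorm z <= 1 by rewrite cnormZ nc mulVf // gt_eqF.
have hz0 : 0 < Normc.normc (h z).
  rewrite lt_def normc_ge0 andbT; apply/eqP => /Normc.eq0_normc/eqP.
  rewrite (scalZ lh) mulf_eq0 (negPf hx0) orbF => /eqP e.
  by move: nc; rewrite e Normc.normc0 => /esym/eqP; rewrite invr_eq0 gt_eqF.
have /cvgr0Pnorm_lt/(_ _ hz0) [n _ /(_ n (leqnn n))] := cv.
rewrite ltNge => /negP; apply; apply: le_trans (ler_norm _).
apply: le_trans _ (dual_norm_ge hh (cesaro_scalar n sf.1.1) z1).
rewrite big_nat_cond big1 => [|k /andP[/andP[k1 _] _]].
  by rewrite mulr0 sub0r normcN.
have lk : scalar (convpow f k).
  case: k {k1} => [|[|k]]; [exact: sf.1.1|exact: sf.1.1|].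
  by rewrite convpowS; exact: fconv_scalar.
by rewrite (scalZ lk) p0 // mulr0.
Qed.

(** A vector fixed by the matrix of [f] is fixed by those of all its powers, so every power vanishes
    on the squares of the defects [y i - w i], and these are then zero. *)
Lemma ergodic_of_charges f : state f ->
    (forall x : G, cpos x -> x <> 0 -> exists n : nat, (1 <= n)%N /\ 0 < convpow f n x) ->
  forall x, h x = 0 -> slicer f x = x -> x = 0.
Proof.
move=> sf ch x hx; have [e oe] := exists_onb ph fh; have fr := onb_frame lh oe.
have uv := (coefmx_unitary hh oe).1; set v := coefmx _ _ in uv; have [_ _ cv] := uv.
move: hx; rewrite [x](onb_expand oe); set w := \col_i _ => hw.
move/(slicer_fixed oe w sf.1.1); rewrite -/v => fw.
have fwn n : map_mx (convpow f n.+1) v *m w = w.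
  elim: n => [//|n IH]; rewrite convpowS map_mx_fconv //; last exact: sf.1.1.
    by rewrite -mulmxA fw.
  exact: (state_convpow hh n sf).1.1.
pose y i := \sum_j w j 0 *: v i j.
have y0 i : y i = (w i 0)%:A.
  apply/eqP; rewrite -subr_eq0; apply/eqP/fh; set z := y i - _.
  suff -> : star z * z = 0 by rewrite (scal0 lh).
  apply: contrapT => z0; have [|[|n] [k1]] := ch _ _ z0; [by exists z|by []|].
  have [pn n1] := state_convpow hh n sf.
  have /= := defect_sum pn n1 (fwn n).
  rewrite -[X in _ = X - _](scal_sum pn.1) (unitary_sum w uv).
  rewrite (scalZ pn.1) n1 mulr1 subrr => /eqP.
  rewrite psumr_eq0 => [/allP/(_ i (mem_index_enum _))/= /eqP -> |k _].
    by rewrite ltxx.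
  exact: pn.2.
rewrite (fixed_vector_scalar oe) ?hw ?scale0r // -/v.
by apply/matrixP => i j; rewrite ord1 scalmxr -/(y i) y0 [RHS]mxE.
Qed.

End Ergodicity.

Theorem theorem4p4 (R : realType) (G : finQuantumGroup R) (I : irr_reps G)
    (h : G -> R[i]) (S : G -> G) (phi : G -> R[i])
    (hh : is_haar h) (hS : is_antipode I S) (hphi : is_state phi) :
  let psi : G -> R[i] := fconv (phi \o S) phi in
  [<-> exists p : R, 1 <= p < 2 /\
         forall x : G, lpnorm h 2 (conv_fun_elt phi x) <= lpnorm h p x;
       exists p : R, 1 <= p < 2 /\
         forall x : G, lpnorm h 2 (conv_elt_fun x phi) <= lpnorm h p x;
       forall a : I, a <> irr_one I -> opnorm (fourier phi a) < 1;
       (fun n : nat => dual_norm (fun x : G =>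
          n%:R^-1 * (\sum_(1 <= k < n.+1) convpow psi k x) - h x))
         @ \oo --> (0 : R);
       forall x : G, cpos x -> x <> 0 ->
         exists n : nat, (1 <= n)%N /\ 0 < convpow psi n x].
Proof.
move=> psi; have sphi : state phi.
  by split; [exact: posfun_state | case: hphi].
have spsi : state psi := state_selfconv hh hS sphi.
(* The five implications form a cycle. [ergodic phi] unfolds to the fixed-point condition for
   convolution by [psi], the form used for the Cesaro means and for the return to the first
   assertion. *)
split; first by move/(Lp_improving_left hh hS sphi)/(Lp_improving_right hh hS sphi).
split.
  move/(Lp_improving_right hh hS sphi) => erg a na.
  exact: (opnorm_fourier_lt1 hh hS sphi erg na).
split.
  by move/(ergodic_of_fourier hh hS sphi) => erg; exact: (cesaro_cvg hh spsi erg).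
split; first exact: (cesaro_charges hh spsi).
move=> ch; apply/(Lp_improving_left hh hS sphi).
exact: (ergodic_of_charges hh spsi ch).
Qed.
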